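(* Let $G=(V,E)$ be a graph satisfying (G1)–(G3) of the context, $\theta:V\to(0,\infty)$ a speed measure, and suppose that the conductances $\omega\in(0,\infty)^E$ satisfy the integrability assumption (I) of the context with exponents $p,q,r\in(1,\infty]$ and constant $C_{\mathrm{int}}$. Then there exist constants $c_1,\dots,c_5\in(0,\infty)$ and $\gamma$, depending only on $d,d',p,q,r,C_{\mathrm{int}}$ and the constants $C_{\mathrm{deg}},C_{\mathrm{reg}},C_{S_1}$ of the graph, such that for any given $t$ and $x\in V$ with $\sqrt t\ge N_1(x)\vee N_2(x)\vee N_4(x,\omega)$ and all $y\in V$ the following hold. (i) If $d_\theta^\omega(x,y)\le c_1t$ then $$p_\theta^\omega(t,x,y)\le c_2\,t^{-d/2}\Big(1+\frac{d(x,y)}{\sqrt t}\Big)^{\gamma}\exp\Big(-c_3\frac{d_\theta^\omega(x,y)^2}{t}\Big).$$ (ii) If $d_\theta^\omega(x,y)\ge c_5t$ then $$p_\theta^\omega(t,x,y)\le c_2\,t^{-d/2}\Big(1+\frac{d(x,y)}{\sqrt t}\Big)^{\gamma}\exp\Big(-c_4\,d_\theta^\omega(x,y)\Big(1\vee\log\frac{d_\theta^\omega(x,y)}{t}\Big)\Big).$$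
   Context: Setting. $G=(V,E)$ is an infinite, connected, locally finite graph with non-oriented edges; $x\sim y$ means $\{x,y\}\in E$. $d(x,y)$ is the graph distance, $B(x,r)=\{y\in V: d(x,y)\le r\}$, and $|A|$ is the cardinality of $A\subset V$. (The symbol $d$ without arguments is a number, the volume growth exponent.) Standing assumptions on $G$: (G1) There is $C_{\mathrm{deg}}\in[1,\infty)$ with $|\{y:y\sim x\}|\le C_{\mathrm{deg}}$ for all $x\in V$. (G2) There are $d\ge2$ and $C_{\mathrm{reg}}\in(0,\infty)$ such that for all $x\in V$ there is $N_1(x)<\infty$ with $C_{\mathrm{reg}}^{-1}n^d\le|B(x,n)|\le C_{\mathrm{reg}}n^d$ for all $n\ge N_1(x)$. (G3) There are $d'\ge d$ and $C_{S_1}\in(0,\infty)$ such that for all $x\in V$ there is $N_2(x)<\infty$ such that for all $n\ge N_2(x)$ and all $u:V\to\mathbb R$ with $\operatorname{supp}u\subset B(x,n)$, $$\Big(\sum_{y\in B(x,n)}|u(y)|^{\frac{d'}{d'-1}}\Big)^{\frac{d'-1}{d'}}\le C_{S_1}n^{1-\frac{d}{d'}}\sum_{\{y,z\}\in E,\ \{y,z\}\cap B(x,n)\ne\emptyset}|u(y)-u(z)| .$$ Conductances are positive weights $\omega(e)\in(0,\infty)$, $e\in E$, with $\omega(x,y)=\omega(y,x)=\omega(\{x,y\})$; $\mu^\omega(x)=\sum_{y\sim x}\omega(x,y)$ and $\nu^\omega(x)=\sum_{y\sim x}1/\omega(x,y)$. Random walk: $X=(X_t)_{t\ge0}$ is the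 continuous-time Markov chain on $V$ with generator $(\mathcal L_\theta^\omega f)(x)=\frac1{\theta(x)}\sum_{y\sim x}\omega(x,y)(f(y)-f(x))$, $\mathrm P_x^\omega$ is its law started at $x$, and its heat kernel is $p_\theta^\omega(t,x,y)=\mathrm P_x^\omega[X_t=y]/\theta(y)$. The metric $d_\theta^\omega$ is $$d_\theta^\omega(x,y)=\inf_{\gamma}\sum_{i=0}^{l_\gamma-1}\Big(1\wedge\frac{\theta(z_i)\wedge\theta(z_{i+1})}{\omega(z_i,z_{i+1})}\Big)^{1/2},$$ the infimum being over all nearest-neighbour paths $(z_0,\dots,z_{l_\gamma})$ with $z_0=x$, $z_{l_\gamma}=y$. Averaged norms: for finite non-empty $B\subset V$, $\phi:V\to[0,\infty)$ and $p\in[1,\infty)$, $\|f\|_{p,B,\phi}=\big(\frac1{|B|}\sum_{x\in B}|f(x)|^p\phi(x)\big)^{1/p}$; $\|f\|_{p,B}=\|f\|_{p,B,1}$; for $p=\infty$ the norm (with or without weight) is $\max_{x\in B}|f(x)|$. Integrability assumption (I): $p,q,r\in(1,\infty]$ satisfy $$\frac1r+\frac1p\cdot\frac{r-1}{r}+\frac1q<\frac2{d'}$$ (with the usual conventions, e.g. $(r-1)/r=1$ if $r=\infty$), and there is $C_{\mathrm{int}}\in[1,\infty)$ such that for all $x\in V$ there is $N_4(x,\omega)<\infty$ such that for all $n\ge N_4(x,\omega)$, $$\|1\vee\mu^\omega/\theta\|_{p,B(x,n),\theta}\cdot\|1\vee\nu^\omega\|_{q,B(x,n)}\cdot\|1\vee\theta\|_{r,B(x,n)}\cdot\|1\vee1/\theta\|_{q,B(x,n)}\le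 C_{\mathrm{int}} .$$ *)

(* Defs.v *)
From HB Require Import structures.
From mathcomp Require Import all_boot all_order all_algebra finmap.
From mathcomp Require Import all_classical all_reals all_analysis.
Set Implicit Arguments.
Unset Strict Implicit.
Unset Printing Implicit Defensive.
Import Order.TTheory GRing.Theory Num.Theory.
Import numFieldNormedType.Exports.
Local Open Scope classical_set_scope.
Local Open Scope ring_scope.

(* The path (z_0, ..., z_l) is encoded by x = z_0 and the list p of the other
   vertices. *)
Definition paths (V : choiceType) (E : rel V) (x y : V) : set (seq V) :=
  [set p | path E x p /\ last x p = y].

Definition locally_finite (V : choiceType) (E : rel V) : Prop :=
  forall x, finite_set [set y | E x y].

Record infinite_graph (V : choiceType) (E : rel V) : Prop := InfiniteGraph {
  edge_irrefl : irreflexive E;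
  edge_sym : symmetric E;
  graph_connected : forall x y, paths E x y !=set0;
  graph_infinite : infinite_set [set: V];
  graph_locally_finite : locally_finite E }.

Section Graph.
Context {R : realType} {V : choiceType} (E : rel V).

Definition graph_dist (x y : V) : R :=
  inf [set (size p)%:R | p in paths E x y].

Definition gball (x : V) (n : nat) : set V :=
  [set y | graph_dist x y <= n%:R].

Definition ncard (A : set V) : R := (#|` fset_set A|)%:R.

Definition bounded_degree (Cdeg : R) : Prop :=
  forall x, ncard [set y | E x y] <= Cdeg.

Definition volume_regular (d Creg : R) (N1 : V -> nat) : Prop :=
  forall x n, (N1 x <= n)%N ->
    Creg^-1 * n%:R `^ d <= ncard (gball x n) <= Creg * n%:R `^ d.

(* Every edge {y, z} occurs as the two ordered pairs (y, z) and (z, y), whence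
   the factor 1/2. *)
Definition edge_variation (u : V -> R) (A : set V) : R :=
  2^-1 * \sum_(yz \in [set yz : V * V | E yz.1 yz.2 /\ (A yz.1 \/ A yz.2)])
    `|u yz.1 - u yz.2|.

Definition local_sobolev (d d' CS : R) (N2 : V -> nat) : Prop :=
  forall x n, (N2 x <= n)%N ->
  forall u : V -> R, [set y | u y != 0] `<=` gball x n ->
    (\sum_(y \in gball x n) `|u y| `^ (d' / (d' - 1))) `^ ((d' - 1) / d')
      <= CS * n%:R `^ (1 - d / d') * edge_variation u (gball x n).

(* For p = +oo the weight is ignored. *)
Definition avg_norm (p : \bar R) (B : set V) (phi f : V -> R) : R :=
  match p with
  | r%:E => ((ncard B)^-1 * \sum_(x \in B) (`|f x| `^ r * phi x)) `^ r^-1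
  | +oo%E => \big[Num.max/0]_(x <- fset_set B) `|f x|
  | -oo%E => 0
  end.

(* The conductance of the edge {x, y} is omega x y; values of omega at
   non-adjacent pairs are never used. *)
Definition conductances (omega : V -> V -> R) : Prop :=
  forall x y, E x y -> 0 < omega x y /\ omega x y = omega y x.

Section Weights.
Context (omega : V -> V -> R) (theta : V -> R).

Definition mu (x : V) : R := \sum_(y \in [set y | E x y]) omega x y.

Definition nu (x : V) : R := \sum_(y \in [set y | E x y]) (omega x y)^-1.

Definition generator (f : V -> R) (x : V) : R :=
  (theta x)^-1 * \sum_(y \in [set y | E x y]) (omega x y * (f y - f x)).

Definition intrinsic_dist (x y : V) : R :=
  inf [set \sum_(i < size p)
             (let z := nth x (x :: p) i in
              let z' := nth x (x :: p) i.+1 in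
              Num.sqrt (Num.min 1 (Num.min (theta z) (theta z') / omega z z')))
      | p in paths E x y].

Definition integrability (p q r : \bar R) (Cint : R) (N4 : V -> nat) : Prop :=
  forall x n, (N4 x <= n)%N ->
    let B := gball x n in
    let one := fun=> 1 : R in
    avg_norm p B theta (fun z => Num.max 1 (mu z / theta z))
    * avg_norm q B one (fun z => Num.max 1 (nu z))
    * avg_norm r B one (fun z => Num.max 1 (theta z))
    * avg_norm q B one (fun z => Num.max 1 (theta z)^-1) <= Cint.

End Weights.

(* The rates of a generator L acting on functions are its matrix entries:
   q(x, y) = (L 1_y)(x) for y != x, and the total rate is - (L 1_x)(x). *)
Definition jump_rate (L : (V -> R) -> V -> R) (x y : V) : R :=
  if x == y then 0 else L (fun z => (z == y)%:R) x.

Definition exit_rate (L : (V -> R) -> V -> R) (x : V) : R :=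
  - L (fun z => (z == x)%:R) x.

Context {disp : measure_display} {T : measurableType disp}.

(* Jump chain Y and holding times S of the chain with generator L, started at x
   under P x: the jump chain has transition probabilities q(a, b) / q(a), and
   given Y the S_i are independent exponential variables of rates q(Y_i). *)
Record jump_chain_holding_times (L : (V -> R) -> V -> R)
    (P : V -> probability T R) (Y : nat -> T -> V) (S : nat -> T -> R) : Prop :=
  JumpChainHoldingTimes {
  jump_chain_measurable : forall n v, measurable [set w | Y n w = v];
  holding_time_measurable : forall n, measurable_fun [set: T] (S n);
  holding_time_gt0 : forall n w, 0 < S n w;
  jump_holding_law : forall x n (y : nat -> V) (s : nat -> R),
    (forall i, 0 <= s i) ->
    P x [set w | forall i, (i <= n)%N -> Y i w = y i /\ s i < S i w]
    = ((y 0%N == x)%:R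
       * \prod_(i < n) (jump_rate L (y i) (y i.+1) / exit_rate L (y i))
       * \prod_(i < n.+1) expR (- (exit_rate L (y i) * s i)))%:E }.

(* X is the minimal right-continuous chain; X t w = None when t is not smaller
   than the explosion time. *)
Definition markov_chain (L : (V -> R) -> V -> R)
    (P : V -> probability T R) (X : R -> T -> option V) : Prop :=
  exists (Y : nat -> T -> V) (S : nat -> T -> R),
    jump_chain_holding_times L P Y S /\
    forall (t : R) w v, 0 <= t ->
      X t w = Some v <->
      exists n, \sum_(i < n) S i w <= t < \sum_(i < n.+1) S i w /\ Y n w = v.

Definition heat_kernel (theta : V -> R) (P : V -> probability T R)
    (X : R -> T -> option V) (t : R) (x y : V) : R :=
  fine (P x [set w | X t w = Some y]) / theta y.

End Graph.

(* Main.v *)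
Require Import Defs.
From HB Require Import structures.
From mathcomp Require Import all_boot all_order all_algebra finmap.
From mathcomp Require Import all_classical all_reals all_analysis.
From mathcomp Require Import ring lra.
Set Implicit Arguments.
Unset Strict Implicit.
Unset Printing Implicit Defensive.
Import Order.TTheory GRing.Theory Num.Theory.
Import numFieldNormedType.Exports.
Local Open Scope classical_set_scope.
Local Open Scope ring_scope.

(* It suffices to bound, uniformly in K, the heat kernel h of the walk killed
   outside the ball B(x, K): the probability that the walk goes from x to y in time
   t with at most N jumps is compared with the solution of the backward equation on
   a larger ball, and N tends to infinity. For h we use Davies' method. Let psi =
   lambda d_theta(x, .); the cap 1 /\ (theta /\ theta) / omega in the metric
   makes exp(psi) a perturbation of size lambda^2 exp(2 lambda) of the energy. A De
   Giorgi iteration, based on the Sobolev inequality (G3) and the moment condition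
   (I), bounds exp(psi) u by its initial L^2 norm for solutions u. Its truncation
   levels are multiples of (1 + d(x, .) / sqrt t)^M, which is where the polynomial
   factor comes from. Duality turns this into a pointwise bound
   t^(-d/2) (1 + d(x, y) / sqrt t)^M exp(- lambda d_theta(x, y) + C lambda^2
   exp(2 lambda) t), and lambda is optimised in the two regimes. *)

(** * Calculus and elementary inequalities *)

(** Regularity is assumed only for balls centred at x whose radius is at least of order [sqrt t].
    Working in a ball around y is therefore impossible: the estimates live on the whole finite
    graph, with a weight growing with the distance from x, and (G2), (G3) and (I) are used only at
    the scales [2 ^ i * n], with n of order [sqrt t]. The second obstacle is that mu is not bounded
    by theta. The time derivative produces theta, but gradients of cutoffs and of truncation levels
    produce mu. Truncations are therefore measured with the weight max(theta, mu), and the gain of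
    integrability has to be proved for this larger weight; this is how 1/p enters the condition on
    the exponents. Constants are quantified before the graph in every estimate, so that they depend
    on the parameters only. Infinite exponents among p, q, r are traded for large finite ones at the
    outset, which is possible because (I) is strict. Explosion needs no separate treatment, since
    only events with boundedly many jumps are compared with the killed flow. *)

Section Calculus.
Context {R : realType}.
Implicit Types (f g F G : R -> R) (a b s t : R).

Lemma is_derive_continuous f (df : R) s : is_derive s 1 f df -> {for s, continuous f}.
Proof.
move=> h; apply: differentiable_continuous.
by apply/derivable1_diffP; case: h.
Qed.

Lemma nondecreasing_of_derive F f a b : a <= b ->
  (forall s, a <= s <= b -> is_derive s 1 F (f s)) ->
  (forall s, a <= s <= b -> 0 <= f s) -> F a <= F b.
Proof.
move=> ab dF f0.
have [||c cab] := @MVT_segment R F f a b ab.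
- by move=> s; rewrite in_itv /= => /andP[/ltW h1 /ltW h2]; apply: dF; rewrite h1.
- apply: continuous_in_subspaceT => s; rewrite inE /= in_itv /= => sab.
  exact: is_derive_continuous (dF _ sab).
move: cab; rewrite in_itv /= => cab e.
by rewrite -subr_ge0 e mulr_ge0 ?f0 // subr_ge0.
Qed.

(** Stands in for monotonicity of the integral: an integral over time is represented by the
    increment of an antiderivative, and estimates between integrands pass to increments in this
    way. *)
Lemma increment_le F f G g a b : a <= b ->
  (forall s, a <= s <= b -> is_derive s 1 F (f s)) ->
  (forall s, a <= s <= b -> is_derive s 1 G (g s)) ->
  (forall s, a <= s <= b -> f s <= g s) -> F b - F a <= G b - G a.
Proof.
move=> ab dF dG fg.
suff : G a - F a <= G b - F b by lra.
apply: (@nondecreasing_of_derive (G - F) (fun s => g s - f s)) => // s sab.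
  by have ? := dF _ sab; have ? := dG _ sab; exact: is_deriveB.
by rewrite subr_ge0 fg.
Qed.

Lemma is_derive_scale (c : R) f (df : R) s :
  is_derive s 1 f df -> is_derive s 1 (fun t => c * f t) (c * df).
Proof. by move=> h; exact: (@is_deriveZ R R R f c s 1 df h). Qed.

Lemma is_derive_add f g (df dg : R) s : is_derive s 1 f df -> is_derive s 1 g dg ->
  is_derive s 1 (fun t => f t + g t) (df + dg).
Proof. by move=> h1 h2; exact: is_deriveD. Qed.

Lemma is_derive_mul f g (df dg : R) s : is_derive s 1 f df -> is_derive s 1 g dg ->
  is_derive s 1 (fun t => f t * g t) (df * g s + f s * dg).
Proof.
move=> h1 h2; apply: is_derive_eq; rewrite /GRing.scale /=; ring.
Qed.

Lemma exists_antiderivative f a b : continuous f -> a < b ->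
  exists F, forall s, a <= s <= b -> is_derive s 1 F (f s).
Proof.
move=> cf ab.
(* Integrating from [a - 1], and using the fundamental theorem up to [b + 1], makes every point of
   [a, b] interior, so that the derivative is two-sided at the endpoints too. *)
pose F x := (\int[lebesgue_measure]_(t in `[(a - 1)%R, x]) f t)%R.
exists F => s /andP[a_s sb].
have [||||d1 d2] := @continuous_FTC1_closed R f (a - 1) s (b + 1).
- by lra.
- apply: continuous_compact_integrable; first exact: segment_compact.
  exact: continuous_subspaceT.
- by lra.
- exact: cf.
apply: DeriveDef; first exact: d1.
by rewrite -derive1E.
Qed.

(** Squaring removes the kink of the positive part at 0, where the difference quotient is at most
    |h|. This allows the L^2 norm of a truncated solution to be differentiated in time. *)
Lemma is_derive_posr_sqr (x : R) :
  is_derive x 1 (fun y : R => Num.max 0 y ^+ 2) (2 * Num.max 0 x).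
Proof.
have : [\/ x < 0, 0 < x | x = 0] by case: (ltgtP x 0) => h; [constructor 1|constructor 2|constructor 3].
move=> [x0|x0|->].
- rewrite (max_idPl (ltW x0)) mulr0.
  apply: (@near_eq_is_derive _ _ _ (cst 0)).
  near=> y; rewrite (max_idPl _) ?expr0n // ltW //.
  by near: y; exact: lt_nbhsl.
- rewrite (max_idPr (ltW x0)).
  apply: (@near_eq_is_derive _ _ _ (fun y : R => y ^+ 2)).
    near=> y; rewrite (max_idPr _) // ltW //.
    by near: y; exact: lt_nbhsr.
  apply: is_derive_eq; rewrite /GRing.scale /=; ring.
- rewrite maxxx mulr0.
  have H : (fun h : R => h^-1 *: (Num.max 0 (h + 0) ^+ 2 - Num.max 0 0 ^+ 2)) @ 0^' --> (0 : R).
    apply/cvgrPdist_le => /= e e0; near=> h.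
    rewrite addr0 maxxx expr0n /= subr0 sub0r normrN /GRing.scale /=.
    have h0 : h != 0 by near: h; exact: nbhs_dnbhs_neq.
    have he : `|h| <= e.
      near: h; apply: dnbhs0_le; exact: e0.
    have [hn|hp] := leP h 0; first by rewrite expr0n mulr0 normr0 ltW.
    by rewrite expr2 mulKf.
  apply: DeriveDef.
    apply/cvg_ex; exists 0; move: H; rewrite /= => H.
    apply: cvg_trans H; apply: near_eq_cvg; near=> h => /=.
    by rewrite /GRing.scale /= !mulr1.
  apply/cvg_lim => //; move: H; rewrite /= => H.
  apply: cvg_trans H; apply: near_eq_cvg; near=> h => /=.
  by rewrite /GRing.scale /= !mulr1.
Unshelve. all: by end_near.
Qed.

Lemma is_derive_bigsum (I : finType) (P : pred I) (h : I -> R -> R) (dh : I -> R) s :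
  (forall i, P i -> is_derive s 1 (h i) (dh i)) ->
  is_derive s 1 (fun t => \sum_(i | P i) h i t) (\sum_(i | P i) dh i).
Proof.
move=> H; rewrite -[X in is_derive _ _ X]/(fun t => \sum_(i | P i) h i t).
elim: (index_enum I) => [|i r IH].
  under eq_fun do rewrite big_nil.
  by rewrite big_nil; exact: is_derive_cst.
under eq_fun do rewrite big_cons.
rewrite big_cons; case: ifPn => // Pi.
by have ? := H i Pi; exact: is_deriveD.
Qed.

End Calculus.

(** * Hoelder and Young inequalities for finite sums and real powers *)

Section Holder.
Context {R : realType}.

Lemma powR_addr (x r s : R) : 0 < x -> x `^ (r + s) = x `^ r * x `^ s.
Proof. by move=> x0; rewrite powRD // (gt_eqF x0) /= implybT. Qed.

Lemma ler_powR_base (r x y : R) : 0 <= r -> 0 <= x -> x <= y -> x `^ r <= y `^ r.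
Proof.
move=> r0 x0 xy; apply: ge0_ler_powR; rewrite ?nnegrE //.
exact: le_trans xy.
Qed.

Lemma ler_sqr_base (x y : R) : 0 <= x -> x <= y -> x ^+ 2 <= y ^+ 2.
Proof. by move=> x0 xy; rewrite !expr2 ler_pM. Qed.

Lemma eq_ler (x y : R) : x = y -> x <= y.
Proof. by move=> ->. Qed.

Lemma prod_powR n (x : R) (a : 'I_n -> R) : 0 < x ->
  \prod_(j < n) x `^ a j = x `^ (\sum_(j < n) a j).
Proof.
move=> x0; apply: (big_rec2 (fun u v : R => u = x `^ v)); first by rewrite powRr0.
by move=> j u v _ ->; rewrite powR_addr.
Qed.

(** With A > 0 the weighted mean, [y <= A * expR (y / A - 1)] for every y; in the weighted product
    the exponents [a j * (y j / A - 1)] add up to 0. *)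
Lemma weighted_AGM n (a y : 'I_n -> R) : (forall j, 0 <= a j) ->
  \sum_(j < n) a j = 1 -> (forall j, 0 <= y j) ->
  \prod_(j < n) y j `^ a j <= \sum_(j < n) a j * y j.
Proof.
move=> a0 a1 y0; set A := \sum_(j < n) a j * y j.
have A0 : 0 <= A by apply: sumr_ge0 => j _; rewrite mulr_ge0.
have [Az|An] := eqVneq A 0.
  have [j aj] : exists j, a j != 0.
    apply: contrapT => h; move: a1; rewrite big1 => [/eqP|j _].
      by rewrite eq_sym oner_eq0.
    by apply/eqP; apply: contraT => aj; exfalso; apply: h; exists j.
  have /eqP : a j * y j = 0.
    apply/eqP; move/eqP: Az; rewrite psumr_eq0; last by move=> i _; rewrite mulr_ge0.
    by move/allP => /(_ j); rewrite mem_index_enum => /(_ isT).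
  rewrite mulf_eq0 (negPf aj) /= => /eqP yj.
  by rewrite (bigD1 j) //= yj powR0 // mul0r Az.
have {An}Agt : 0 < A by rewrite lt_def An.
have H j : y j `^ a j <= A `^ a j * expR (a j * (y j / A - 1)).
  have [aj|aj] := eqVneq (a j) 0.
    by rewrite aj !powRr0 mul0r expR0 mulr1.
  have [yj|yj] := eqVneq (y j) 0.
    by rewrite yj powR0 // mulr_ge0 // ?powR_ge0 // expR_ge0.
  have yp : 0 < y j by rewrite lt_def yj y0.
  rewrite (_ : y j `^ a j = A `^ a j * (y j / A) `^ a j); last first.
    by rewrite -powRM ?divr_ge0 // mulrCA divff ?gt_eqF // mulr1.
  rewrite ler_wpM2l ?powR_ge0 // (mulrC (a j)) expRM.
  apply: ler_powR_base; rewrite ?divr_ge0 //.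
  by apply: le_trans (expR_ge1Dx _); rewrite addrCA subrr addr0.
apply: (@le_trans _ _ (\prod_(j < n) (A `^ a j * expR (a j * (y j / A - 1))))).
  by apply: ler_prod => j _; rewrite powR_ge0 H.
rewrite big_split /= prod_powR // a1 powRr1 //.
rewrite -expR_sum (_ : \sum_(j < n) _ = 0) ?expR0 ?mulr1 //.
under eq_bigr do rewrite mulrBr mulr1 mulrA.
by rewrite sumrB -mulr_suml a1 divff ?subrr // gt_eqF.
Qed.

(** Dividing each [f j] by its bound [T j] reduces the claim to the pointwise weighted mean
    inequality, summed over i. Positive bounds in place of the sums themselves keep the division
    meaningful. *)
Lemma holder_lt (I : finType) (P : pred I) n (a : 'I_n -> R) (f : 'I_n -> I -> R)
    (T : 'I_n -> R) : (forall j, 0 <= a j) -> \sum_(j < n) a j = 1 ->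
  (forall j i, P i -> 0 <= f j i) -> (forall j, 0 < T j) ->
  (forall j, \sum_(i | P i) f j i <= T j) ->
  \sum_(i | P i) \prod_(j < n) f j i `^ a j <= \prod_(j < n) T j `^ a j.
Proof.
move=> a0 a1 f0 T0 fT.
have T0' j : 0 <= T j by exact: ltW.
have K i : P i -> \prod_(j < n) f j i `^ a j <=
    (\prod_(j < n) T j `^ a j) * \sum_(j < n) a j * (f j i / T j).
  move=> Pi; apply: (@le_trans _ _
    ((\prod_(j < n) T j `^ a j) * \prod_(j < n) (f j i / T j) `^ a j)); last first.
    rewrite ler_wpM2l ?prodr_ge0 // => [j _|]; first by rewrite powR_ge0.
    by apply: weighted_AGM => // j; rewrite divr_ge0 ?f0.
  rewrite -big_split /=; apply: eq_ler.
  apply: eq_bigr => j _; rewrite -powRM ?divr_ge0 ?f0 //.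
  by rewrite mulrCA divff ?mulr1 // gt_eqF.
apply: (le_trans (ler_sum _ K)).
rewrite -mulr_sumr ler_piMr ?prodr_ge0 // => [j _|]; first by rewrite powR_ge0.
rewrite exchange_big /= -[leRHS]a1 ler_sum // => j _.
by rewrite -mulr_sumr -mulr_suml ler_piMr // ler_pdivrMr // mul1r.
Qed.

Lemma holder_sum (I : finType) (P : pred I) n (a : 'I_n -> R) (f : 'I_n -> I -> R) :
  (forall j, 0 <= a j) -> \sum_(j < n) a j = 1 ->
  (forall j i, P i -> 0 <= f j i) ->
  \sum_(i | P i) \prod_(j < n) f j i `^ a j
    <= \prod_(j < n) (\sum_(i | P i) f j i) `^ a j.
Proof.
move=> a0 a1 f0.
have S0 j : 0 <= \sum_(i | P i) f j i by apply: sumr_ge0 => i; exact: f0.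
have [[j [aj Sj]]|h] := pselect (exists j, a j != 0 /\ \sum_(i | P i) f j i = 0).
  rewrite big1 ?prodr_ge0 // => [k _|i Pi]; first by rewrite powR_ge0.
  rewrite (bigD1 j) //= (_ : f j i = 0) ?powR0 ?mul0r //.
  move/eqP: Sj; rewrite psumr_eq0; last exact: f0.
  by move/allP => /(_ i); rewrite mem_index_enum Pi => /(_ isT) /eqP.
(* A vanishing sum can now only carry the exponent 0; enlarging it by 1 changes no factor, since a
   zeroth power is 1, and makes all bounds positive. *)
pose T j := if a j == 0 then 1 + \sum_(i | P i) f j i else \sum_(i | P i) f j i.
rewrite (_ : \prod_(j < n) _ = \prod_(j < n) T j `^ a j); last first.
  apply: eq_bigr => j _; rewrite /T; case: eqP => // ->.
  by rewrite !powRr0.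
apply: holder_lt => // j; rewrite /T; case: ifPn => aj.
- by rewrite ltr_pwDl.
- by rewrite lt_def S0 andbT; apply/eqP => Sj; apply: h; exists j.
- by rewrite lerDr.
- by [].
Qed.

Lemma AGM2 (a x y : R) : 0 <= a <= 1 -> 0 <= x -> 0 <= y ->
  x `^ a * y `^ (1 - a) <= a * x + (1 - a) * y.
Proof.
move=> /andP[a0 a1] x0 y0.
have := @weighted_AGM 2 (fun j => nth 0 [:: a; 1 - a] j) (fun j => nth 0 [:: x; y] j).
rewrite !big_ord_recl !big_ord0 /= mulr1 !addr0; apply.
- by case=> [[|[|k]]] //= _; rewrite subr_ge0.
- by rewrite addrCA subrr addr0.
- by case=> [[|[|k]]].
Qed.

Lemma holder2 (I : finType) (P : pred I) (a : R) (f g : I -> R) :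
  0 <= a <= 1 -> (forall i, P i -> 0 <= f i) -> (forall i, P i -> 0 <= g i) ->
  \sum_(i | P i) f i `^ a * g i `^ (1 - a)
    <= (\sum_(i | P i) f i) `^ a * (\sum_(i | P i) g i) `^ (1 - a).
Proof.
move=> /andP[a0 a1] f0 g0.
have := @holder_sum I P 2 (fun j => nth 0 [:: a; 1 - a] j)
  (fun j => nth (fun=> 0) [:: f; g] j).
rewrite !big_ord_recl !big_ord0 /= mulr1 !addr0.
under eq_bigr do rewrite !big_ord_recl !big_ord0 /= mulr1.
apply.
- by case=> [[|[|k]]] //= _; rewrite subr_ge0.
- by rewrite addrCA subrr addr0.
- by case=> [[|[|k]]].
Qed.

Lemma holder4 (I : finType) (P : pred I) (a1 a2 a3 a4 : R) (f1 f2 f3 f4 : I -> R) :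
  0 <= a1 -> 0 <= a2 -> 0 <= a3 -> 0 <= a4 -> a1 + a2 + a3 + a4 = 1 ->
  (forall i, P i -> [/\ 0 <= f1 i, 0 <= f2 i, 0 <= f3 i & 0 <= f4 i]) ->
  \sum_(i | P i) f1 i `^ a1 * f2 i `^ a2 * f3 i `^ a3 * f4 i `^ a4
    <= (\sum_(i | P i) f1 i) `^ a1 * (\sum_(i | P i) f2 i) `^ a2
     * (\sum_(i | P i) f3 i) `^ a3 * (\sum_(i | P i) f4 i) `^ a4.
Proof.
move=> h1 h2 h3 h4 hs f0.
have := @holder_sum I P 4 (fun j => nth 0 [:: a1; a2; a3; a4] j)
  (fun j => nth (fun=> 0) [:: f1; f2; f3; f4] j).
rewrite !big_ord_recl !big_ord0 /= mulr1 !addr0 !addrA !mulrA.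
under eq_bigr do rewrite !big_ord_recl !big_ord0 /= mulr1 !mulrA.
apply => //; first by case=> [[|[|[|[|k]]]]].
by case=> [[|[|[|[|k]]]]] //= _ i /f0 [].
Qed.

Lemma cauchy_schwarz_sum (I : finType) (P : pred I) (f g : I -> R) :
  (\sum_(i | P i) f i * g i) ^+ 2
    <= (\sum_(i | P i) f i ^+ 2) * (\sum_(i | P i) g i ^+ 2).
Proof.
have h0 (u : I -> R) : 0 <= \sum_(i | P i) u i ^+ 2 by apply: sumr_ge0 => i _; exact: sqr_ge0.
have h : `|\sum_(i | P i) f i * g i| <=
    (\sum_(i | P i) f i ^+ 2) `^ 2^-1 * (\sum_(i | P i) g i ^+ 2) `^ (1 - 2^-1).
  apply: (le_trans (ler_norm_sum _ _ _)).
  apply: (le_trans _ (@holder2 I P 2^-1 (fun i => f i ^+ 2) (fun i => g i ^+ 2) _ _ _)).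
  - apply: eq_ler; apply: eq_bigr => i _.
    rewrite (_ : 1 - 2^-1 = 2^-1 :> R); last by field.
    by rewrite !powR12_sqrt ?sqr_ge0 // !sqrtr_sqr normrM.
  - by apply/andP; split; lra.
  - by move=> i _; exact: sqr_ge0.
  - by move=> i _; exact: sqr_ge0.
rewrite -real_normK ?num_real //.
move: h; rewrite (_ : 1 - 2^-1 = 2^-1 :> R); last by field.
rewrite !powR12_sqrt // => h.
have := @lerXn2r R 2 _ _ _ _ h; rewrite !nnegrE exprMn !sqr_sqrtr //; exact.
Qed.

(** Young's inequality with weight 1/m gives m y x^(m-1) <= y^m + (m-1) x^m, which is the tangent
    bound x^m - y^m <= m x^(m-1) (x - y). The right-hand side is symmetric because the larger value
    may sit at either end of an edge. *)
Lemma diff_powR_le (m x y : R) : 1 <= m -> 0 <= x -> 0 <= y ->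
  `|x `^ m - y `^ m| <= m * (x `^ (m - 1) + y `^ (m - 1)) * `|x - y|.
Proof.
move=> m1; have m0 : 0 < m by exact: lt_le_trans m1.
wlog xy : x y / y <= x => [H x0 y0|x0 y0].
  have /orP[/H/(_ x0 y0)//|/H/(_ y0 x0)] := le_total y x.
  by rewrite distrC (addrC (y `^ _)) (distrC y).
have [xz|xn] := eqVneq x 0.
  have -> : y = 0 by apply/eqP; rewrite eq_le y0 -xz xy.
  by rewrite xz !subrr normr0 mulr0.
have xp : 0 < x by rewrite lt_def xn.
rewrite !ger0_norm ?subr_ge0 //; last first.
  by apply: ler_powR_base => //; exact: ltW.
apply: (@le_trans _ _ (m * x `^ (m - 1) * (x - y))); last first.
  rewrite ler_wpM2r ?subr_ge0 // ler_wpM2l ?(ltW m0) //.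
  by rewrite lerDl powR_ge0.
have := @AGM2 m^-1 (y `^ m) (x `^ m).
rewrite -!powRrM divff ?gt_eqF // powRr1 // => /(_ _ _ _).
rewrite invr_ge0 (ltW m0) invf_le1 // m1 !powR_ge0 => /(_ isT isT isT).
rewrite (_ : m * (1 - m^-1) = m - 1); last by rewrite mulrBr divff ?gt_eqF ?mulr1.
move=> h.
have e : x `^ m = x `^ (m - 1) * x.
  by rewrite -[X in _ * X]powRr1 ?(ltW xp) // -powR_addr ?subrK.
have {h} := ler_wpM2l (ltW m0) h.
rewrite mulrDr !mulrA divff ?gt_eqF // mul1r.
rewrite (_ : m * (1 - m^-1) = m - 1); last by rewrite mulrBr divff ?gt_eqF ?mulr1.
rewrite e; move: (x `^ (m - 1)) (y `^ m) => X Y; nra.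
Qed.

End Holder.

(** * Interpolation inequalities *)

Definition dirichlet {R : realType} {I : finType} (c : I -> I -> R) (f : I -> R) : R :=
  \sum_y \sum_z c y z * (f y - f z) ^+ 2.

Section WeightedSobolev.
Context {R : realType} {I : finType}.
Variables (c : I -> I -> R) (nu : I -> R).
Hypothesis c_ge0 : forall y z, 0 <= c y z.
Hypothesis c_sym : forall y z, c y z = c z y.
Hypothesis nu_ge : forall y, \sum_(z | 0 < c y z) (c y z)^-1 <= nu y.

Lemma dirichlet_ge0 f : 0 <= dirichlet c f.
Proof. by apply: sumr_ge0 => y _; apply: sumr_ge0 => z _; rewrite mulr_ge0 ?sqr_ge0. Qed.

Lemma nu_ge0 y : 0 <= nu y.
Proof.
by apply: le_trans (nu_ge y); apply: sumr_ge0 => z cz; rewrite invr_ge0 ltW.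
Qed.

(** Cauchy-Schwarz after writing 1 = c^(1/2) c^(-1/2) on every edge: one half gives the energy, and
    in the other half the reciprocal conductances at a vertex add up to at most nu. *)
Lemma variation_powR_sqr_le (m : R) (f : I -> R) : 1 <= m -> (forall y, 0 <= f y) ->
  (\sum_y \sum_(z | 0 < c y z) `|f y `^ m - f z `^ m|) ^+ 2
    <= 4 * m ^+ 2 * dirichlet c f * \sum_y nu y * f y `^ (2 * (m - 1)).
Proof.
move=> m1 f0; have m0 : 0 <= m by exact: le_trans m1.
pose F (yz : I * I) := Num.sqrt (c yz.1 yz.2) * `|f yz.1 - f yz.2|.
pose G (yz : I * I) := (Num.sqrt (c yz.1 yz.2))^-1 *
   (f yz.1 `^ (m - 1) + f yz.2 `^ (m - 1)).
have S1 : \sum_y \sum_(z | 0 < c y z) `|f y `^ m - f z `^ m| <=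
    m * \sum_(yz : I * I | 0 < c yz.1 yz.2) F yz * G yz.
  rewrite pair_big_dep /= mulr_sumr ler_sum // => -[y z] /= cyz.
  apply: (le_trans (diff_powR_le m1 (f0 y) (f0 z))).
  rewrite /F /G /=; apply: eq_ler.
  have cn : Num.sqrt (c y z) != 0 by rewrite gt_eqF // sqrtr_gt0.
  by field.
have S2 : \sum_(yz : I * I | 0 < c yz.1 yz.2) F yz ^+ 2 <= dirichlet c f.
  rewrite /dirichlet pair_big /= [leRHS](bigID (fun yz : I * I => 0 < c yz.1 yz.2)) /=.
  rewrite (_ : \sum_(i | 0 < c i.1 i.2) F i ^+ 2 =
     \sum_(i | 0 < c i.1 i.2) c i.1 i.2 * (f i.1 - f i.2) ^+ 2); last first.
    apply: eq_bigr => -[y z] /= cyz.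
    by rewrite /F exprMn sqr_sqrtr ?(ltW cyz) // real_normK ?num_real.
  by rewrite lerDl; apply: sumr_ge0 => yz _; rewrite mulr_ge0 ?sqr_ge0.
have S3 : \sum_(yz : I * I | 0 < c yz.1 yz.2) G yz ^+ 2 <=
    4 * \sum_y nu y * f y `^ (2 * (m - 1)).
  pose h y := f y `^ (2 * (m - 1)).
  have hE y : h y = (f y `^ (m - 1)) ^+ 2.
    by rewrite /h mulrC powRrM powR_mulrn // powR_ge0.
  have G1 yz : 0 < c yz.1 yz.2 ->
      G yz ^+ 2 <= 2 * ((c yz.1 yz.2)^-1 * h yz.1) + 2 * ((c yz.1 yz.2)^-1 * h yz.2).
    move=> cyz; rewrite /G exprMn exprVn sqr_sqrtr ?(ltW cyz) // !hE.
    have : 0 < (c yz.1 yz.2)^-1 by rewrite invr_gt0.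
    move: (_^-1) (f _ `^ _) (f _ `^ _) => a x y a0.
    have := sqr_ge0 (x - y); nra.
  apply: (le_trans (ler_sum _ G1)).
  have D1 : \sum_(yz : I * I | 0 < c yz.1 yz.2) (c yz.1 yz.2)^-1 * h yz.1 <=
      \sum_y nu y * h y.
    rewrite -(pair_big_dep predT (fun y z => 0 < c y z) (fun y z => (c y z)^-1 * h y)) /=.
    apply: ler_sum => y _; rewrite -mulr_suml ler_wpM2r // /h powR_ge0 //.
  have D2 : \sum_(yz : I * I | 0 < c yz.1 yz.2) (c yz.1 yz.2)^-1 * h yz.2 <=
      \sum_y nu y * h y.
    rewrite -(pair_big_dep predT (fun y z => 0 < c y z) (fun y z => (c y z)^-1 * h z)) /=.
    rewrite (exchange_big_dep predT) //=.
    apply: ler_sum => y _; rewrite -mulr_suml ler_wpM2r //; first by rewrite /h powR_ge0.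
    apply: le_trans (nu_ge y); apply: eq_ler.
    by apply: eq_big => z; rewrite c_sym.
  rewrite big_split /= -!mulr_sumr; move: D1 D2; rewrite /h; lra.
have T0 : 0 <= \sum_y \sum_(z | 0 < c y z) `|f y `^ m - f z `^ m|.
  by apply: sumr_ge0 => y _; apply: sumr_ge0.
have FG0 : 0 <= \sum_(yz : I * I | 0 < c yz.1 yz.2) F yz * G yz.
  apply: sumr_ge0 => yz _; rewrite /F /G !mulr_ge0 ?sqrtr_ge0 ?invr_ge0 ?sqrtr_ge0 //.
  by rewrite addr_ge0 ?powR_ge0.
apply: (@le_trans _ _ ((m * \sum_(yz : I * I | 0 < c yz.1 yz.2) F yz * G yz) ^+ 2)).
  exact: (ler_sqr_base T0 S1).
have S0 : 0 <= \sum_(yz : I * I | 0 < c yz.1 yz.2) G yz ^+ 2.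
  by apply: sumr_ge0 => yz _; exact: sqr_ge0.
have CS := @cauchy_schwarz_sum R _ (fun yz : I * I => 0 < c yz.1 yz.2) F G.
have /(le_trans CS) {}CS := ler_wpM2r S0 S2.
have /(le_trans CS) {}CS := ler_wpM2l (dirichlet_ge0 f) S3.
rewrite exprMn; have /le_trans := ler_wpM2l (sqr_ge0 m) CS; apply.
by apply: eq_ler; ring.
Qed.

(** The L^1 Sobolev inequality is applied to f^m, with m such that m d'/(d'-1) = 2/ri. Hoelder with
    nu in L^q turns the weighted sum of f^(2(m-1)) into a power of the same sum G of f^(2/ri), and
    dividing by G^(1-1/q) leaves G^ri. Thus 2/ri is the Sobolev exponent as degraded by the moment
    of nu. *)
Lemma weighted_sobolev (d' q ri K V : R) (P : pred I) (f : I -> R) :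
  2 <= d' -> 1 < q -> ri = 1 - 2 / d' + q^-1 -> 0 <= K -> 0 <= V ->
  (forall y, 0 <= f y) -> (forall y, ~~ P y -> f y = 0) ->
  \sum_(y | P y) nu y `^ q <= V ->
  (forall m, 0 < m -> (\sum_y (f y `^ m) `^ (d' / (d' - 1))) `^ ((d' - 1) / d')
     <= K * \sum_y \sum_(z | 0 < c y z) `|f y `^ m - f z `^ m|) ->
  (\sum_y f y `^ (2 / ri)) `^ ri <=
    4 * (K * (2 / ri * (d' - 1) / d')) ^+ 2 * V `^ q^-1 * dirichlet c f.
Proof.
move=> hd' hq riE K0 V0 f0 fP nuV hS.
have q0 : 0 < q by exact: lt_trans hq.
have qi0 : 0 < q^-1 by rewrite invr_gt0.
have qi1 : q^-1 < 1 by rewrite invf_lt1.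
have d0 : 0 < d' by exact: lt_le_trans hd'.
have d2 : 2 / d' <= 1 by rewrite ler_pdivrMr // mul1r.
have ri0 : 0 < ri by rewrite riE; lra.
have [m mdef] : exists m, m = 2 / ri * (d' - 1) / d' by eexists.
rewrite -mdef.
have mE : m - 1 = (1 - q^-1) / ri.
  rewrite mdef; have -> : q^-1 = ri - 1 + 2 / d' by rewrite riE; ring.
  by field; rewrite !gt_eqF.
have m1 : 1 <= m by rewrite -subr_ge0 mE divr_ge0 ?ltW // subr_gt0.
set G := \sum_y f y `^ (2 / ri).
have G0 : 0 <= G by apply: sumr_ge0 => y _; rewrite powR_ge0.
have D0 := dirichlet_ge0 f.
have [Gz|Gn] := eqVneq G 0.
  rewrite Gz powR0 ?gt_eqF // mulr_ge0 // mulr_ge0 ?powR_ge0 // mulr_ge0 //.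
  exact: sqr_ge0.
have Gp : 0 < G by rewrite lt_def Gn.
have := hS m (lt_le_trans ltr01 m1).
under eq_bigr do rewrite -powRrM.
have -> : m * (d' / (d' - 1)) = 2 / ri.
  rewrite mdef; field; rewrite !gt_eqF //=; lra.
rewrite -/G => hG.
have {}hG : G `^ (2 * ((d' - 1) / d')) <=
    4 * (K * m) ^+ 2 * dirichlet c f * \sum_y nu y * f y `^ (2 * (m - 1)).
  rewrite mulrC powRrM powR_mulrn ?powR_ge0 //.
  apply: (@le_trans _ _ ((K * \sum_y \sum_(z | 0 < c y z) `|f y `^ m - f z `^ m|) ^+ 2)).
    by apply: ler_sqr_base hG; rewrite powR_ge0.
  rewrite !exprMn; have := @variation_powR_sqr_le m f m1 f0.
  move/(ler_wpM2l (sqr_ge0 K)) => h; apply: (le_trans h).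
  by apply: eq_ler; ring.
have hH : \sum_y nu y * f y `^ (2 * (m - 1)) <= V `^ q^-1 * G `^ (1 - q^-1).
  apply: (@le_trans _ _ (\sum_(y | P y) (nu y `^ q) `^ q^-1 * (f y `^ (2 / ri)) `^ (1 - q^-1))).
    rewrite [leLHS](bigID P) /= [X in _ + X]big1 ?addr0 => [|y /fP ->]; last first.
      rewrite powR0 ?mulr0 // mE mulf_neq0 // ?mulf_neq0 ?invr_eq0 ?gt_eqF //.
      by rewrite subr_gt0.
    apply: ler_sum => y _; rewrite -!powRrM divff ?gt_eqF // powRr1 ?nu_ge0 //.
    rewrite mE (_ : 2 * ((1 - q^-1) / ri) = 2 / ri * (1 - q^-1)) //.
    by ring.
  apply: (le_trans (@holder2 _ I P q^-1 _ _ _ _ _)).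
  - by rewrite (ltW qi0) (ltW qi1).
  - by move=> y _; rewrite powR_ge0.
  - by move=> y _; rewrite powR_ge0.
  rewrite ler_pM ?powR_ge0 //.
    apply: ler_powR_base => //; first exact: ltW.
    by apply: sumr_ge0 => y _; rewrite powR_ge0.
  apply: ler_powR_base; first by rewrite subr_ge0 ltW.
    by apply: sumr_ge0 => y _; rewrite powR_ge0.
  by rewrite /G [leRHS](bigID P) /= lerDl; apply: sumr_ge0 => y _; rewrite powR_ge0.
(* This balance of exponents is what determines the value of [ri]. *)
have e : 2 * ((d' - 1) / d') = ri + (1 - q^-1).
  by rewrite riE; field; apply/andP; split; rewrite gt_eqF.
move: hG; rewrite e powR_addr // => hG.
rewrite -(ler_pM2r (powR_gt0 (1 - q^-1) Gp)).
apply: (le_trans hG).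
have -> : 4 * (K * m) ^+ 2 * V `^ q^-1 * dirichlet c f * G `^ (1 - q^-1)
  = (4 * (K * m) ^+ 2 * dirichlet c f) * (V `^ q^-1 * G `^ (1 - q^-1)) by ring.
by rewrite ler_wpM2l // mulr_ge0 // mulr_ge0 // sqr_ge0.
Qed.

End WeightedSobolev.

(* A finite piece I of an ambient graph: winn marks the vertices at which the walk
   is not killed, wdist is the distance to a base point, and wmu and wnu only
   dominate the sums over I, being computed in the ambient graph. *)
Record weighted_graph (R : realType) (I : finType) := WeightedGraph {
  wc : I -> I -> R;
  wtheta : I -> R;
  wmu : I -> R;
  wnu : I -> R;
  wdist : I -> R;
  winn : pred I;
  wc_ge0 : forall y z, 0 <= wc y z;
  wc_sym : forall y z, wc y z = wc z y;
  wtheta_gt0 : forall y, 0 < wtheta y;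
  wmu_ge : forall y, \sum_z wc y z <= wmu y;
  wnu_ge : forall y, \sum_(z | 0 < wc y z) (wc y z)^-1 <= wnu y;
  wdist_ge0 : forall y, 0 <= wdist y;
  wdist_adj : forall y z, 0 < wc y z -> `|wdist y - wdist z| <= 1 }.

(** * Scale regularity, weighted Hoelder inequality and cutoffs *)

Section Interpolation.
Context {R : realType}.

Section Local.
Context {I : finType} (G : weighted_graph R I).

Definition wratio (y : I) : R := Num.max 1 (wmu G y / wtheta G y).
(** This is max(theta, mu). The factorised form separates the p-th moment of the ratio from powers
    of theta. *)
Definition wweight (y : I) : R := wratio y * wtheta G y.
Definition energy (f : I -> R) : R := dirichlet (wc G) f.
Definition l2norm2 (f : I -> R) : R := \sum_y wtheta G y * f y ^+ 2.
Definition supported (f : I -> R) : Prop := forall y, ~~ winn G y -> f y = 0.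

(** What (G2), (G3) and (I) provide on one ball. Averages become sums bounded by the volume order
    m^d, and the radius is 2 m because cutoffs at scale m are supported there. *)
Record regular_scale (d d' p q r C m : R) : Prop := RegularScale {
  scale_nu : \sum_(y | wdist G y <= 2 * m) wnu G y `^ q <= C * m `^ d;
  scale_ratio :
    \sum_(y | wdist G y <= 2 * m) wratio y `^ p * wtheta G y <= C * m `^ d;
  scale_theta : \sum_(y | wdist G y <= 2 * m) wtheta G y `^ r <= C * m `^ d;
  scale_sobolev : forall u : I -> R, (forall y, 0 <= u y) -> supported u ->
    (forall y, ~~ (wdist G y <= 2 * m) -> u y = 0) ->
    (\sum_y u y `^ (d' / (d' - 1))) `^ ((d' - 1) / d')
      <= C * m `^ (1 - d / d') * \sum_y \sum_(z | 0 < wc G y z) `|u y - u z| }.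

Lemma l2norm2_ge0 f : 0 <= l2norm2 f.
Proof. by apply: sumr_ge0 => y _; rewrite mulr_ge0 ?sqr_ge0 ?ltW ?wtheta_gt0. Qed.

Lemma energy_ge0 f : 0 <= energy f.
Proof. by apply: dirichlet_ge0; exact: wc_ge0. Qed.

Lemma wratio_ge1 y : 1 <= wratio y.
Proof. by rewrite /wratio le_max lexx. Qed.

Lemma wratio_ge0 y : 0 <= wratio y.
Proof. exact: le_trans (wratio_ge1 y). Qed.

Lemma wmu_le_weight y : wmu G y <= wweight y.
Proof.
rewrite /wweight -ler_pdivrMr ?wtheta_gt0 //.
by rewrite /wratio le_max lexx orbT.
Qed.

Lemma wtheta_le_weight y : wtheta G y <= wweight y.
Proof. by rewrite ler_peMl ?wratio_ge1 // ltW ?wtheta_gt0. Qed.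

Lemma wweight_ge0 y : 0 <= wweight y.
Proof. by apply: le_trans (wtheta_le_weight y); rewrite ltW ?wtheta_gt0. Qed.

Lemma sum_wc_le_weight y : \sum_z wc G y z <= wweight y.
Proof. exact: le_trans (wmu_ge G y) (wmu_le_weight y). Qed.

(** Hoelder with the four exponents 1/p, a, b ri and t, for the ratio, f^2, g^(2/ri) and theta^r.
    The hypothesis containing [b * ri] says that they add up to 1; the one containing [r * t] says
    that the powers of theta spread over three of the factors recombine to theta. *)
Lemma weighted_holder (p r ri a b t V : R) (P : pred I) (f g : I -> R) :
  1 < p -> 0 < ri -> 0 <= a -> 0 < b -> 0 <= t -> 0 < r -> 0 < V ->
  p^-1 + a + r * t = 1 -> p^-1 + a + b * ri + t = 1 ->
  (forall y, 0 <= f y) -> (forall y, 0 <= g y) ->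
  \sum_(y | P y) wratio y `^ p * wtheta G y <= V ->
  \sum_(y | P y) wtheta G y `^ r <= V ->
  \sum_(y | P y) wweight y * (f y `^ (2 * a) * g y `^ (2 * b))
    <= V `^ (p^-1 + t) * (l2norm2 f `^ a * (\sum_y g y `^ (2 / ri)) `^ (b * ri)).
Proof.
move=> p1 ri0 a0 b0 t0 r0 V0 e1 e2 f0 g0 hp hr.
have p0 : 0 < p by exact: lt_trans p1.
have pi0 : 0 <= p^-1 by rewrite invr_ge0 ltW.
have th0 y : 0 <= wtheta G y by rewrite ltW ?wtheta_gt0.
have E y : wweight y * (f y `^ (2 * a) * g y `^ (2 * b)) =
   (wratio y `^ p * wtheta G y) `^ p^-1 * (wtheta G y * f y ^+ 2) `^ a *
   (g y `^ (2 / ri)) `^ (b * ri) * (wtheta G y `^ r) `^ t.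
  rewrite -[f y ^+ 2]powR_mulrn // !powRM ?powR_ge0 // -!powRrM divff ?gt_eqF // powRr1 ?wratio_ge0 //.
  rewrite (_ : 2 / ri * (b * ri) = 2 * b); last by field; rewrite gt_eqF.
  rewrite /wweight.
  rewrite -[X in wratio y * X * _]powRr1 // -e1 !powR_addr ?wtheta_gt0 //.
  by ring.
under eq_bigr do rewrite E.
have h4 := @holder4 R I P p^-1 a (b * ri) t
   (fun y => wratio y `^ p * wtheta G y) (fun y => wtheta G y * f y ^+ 2)
   (fun y => g y `^ (2 / ri)) (fun y => wtheta G y `^ r).
apply: (le_trans (h4 _ _ _ _ _ _)) => //.
- by rewrite mulr_ge0 // ltW.
- by move=> y _; rewrite ?mulr_ge0 ?powR_ge0 ?sqr_ge0.
have S1 : (\sum_(y | P y) wratio y `^ p * wtheta G y) `^ p^-1 <= V `^ p^-1.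
  apply: ler_powR_base => //; apply: sumr_ge0 => y _.
  by rewrite mulr_ge0 ?powR_ge0.
have S2 : (\sum_(y | P y) wtheta G y * f y ^+ 2) `^ a <= l2norm2 f `^ a.
  apply: ler_powR_base => //.
    by apply: sumr_ge0 => y _; rewrite mulr_ge0 ?sqr_ge0.
  rewrite /l2norm2 [leRHS](bigID P) /= lerDl.
  by apply: sumr_ge0 => y _; rewrite mulr_ge0 ?sqr_ge0.
have S3 : (\sum_(y | P y) g y `^ (2 / ri)) `^ (b * ri) <=
    (\sum_y g y `^ (2 / ri)) `^ (b * ri).
  apply: ler_powR_base => //; first by rewrite mulr_ge0 // ltW.
    by apply: sumr_ge0 => y _; rewrite powR_ge0.
  rewrite [leRHS](bigID P) /= lerDl.
  by apply: sumr_ge0 => y _; rewrite powR_ge0.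
have S4 : (\sum_(y | P y) wtheta G y `^ r) `^ t <= V `^ t.
  apply: ler_powR_base => //; apply: sumr_ge0 => y _.
  by rewrite powR_ge0.
rewrite powR_addr // [leRHS](_ : _ = V `^ p^-1 * l2norm2 f `^ a *
  (\sum_y g y `^ (2 / ri)) `^ (b * ri) * V `^ t); last by ring.
do ![apply: ler_pM; rewrite ?mulr_ge0 ?powR_ge0 //].
Qed.

Definition cutoff (m : R) (y : I) : R := Num.max 0 (Num.min 1 (2 - wdist G y / m)).

Lemma cutoff_ge0 m y : 0 <= cutoff m y.
Proof. by rewrite /cutoff le_max lexx. Qed.

Lemma cutoff_le1 m y : cutoff m y <= 1.
Proof. by rewrite /cutoff ge_max ler01 ge_min lexx. Qed.

Lemma cutoff_eq1 m y : 0 < m -> wdist G y <= m -> cutoff m y = 1.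
Proof.
move=> m0 ym; have h : wdist G y / m <= 1 by rewrite ler_pdivrMr // mul1r.
by rewrite /cutoff (min_idPl _) ?(max_idPr _) //; lra.
Qed.

Lemma cutoff_eq0 m y : 0 < m -> ~~ (wdist G y <= 2 * m) -> cutoff m y = 0.
Proof.
rewrite -ltNge => m0 ym.
have h : 2 < wdist G y / m by rewrite ltr_pdivlMr.
by rewrite /cutoff (max_idPl _) // ge_min; apply/orP; right; lra.
Qed.

Lemma cutoff_lip m y z : 0 < m -> 0 < wc G y z -> `|cutoff m y - cutoff m z| <= m^-1.
Proof.
move=> m0 /wdist_adj h.
have {h} : `|wdist G y / m - wdist G z / m| <= m^-1.
  rewrite -mulrBl normrM [X in _ * X]gtr0_norm ?invr_gt0 // -[leRHS]mul1r.
  by rewrite ler_wpM2r // invr_ge0 ltW.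
rewrite /cutoff; move: (_ / m) (_ / m) => u v.
rewrite !ler_norml => /andP[h1 h2].
rewrite /Num.max /Num.min.
by repeat case: ifPn; rewrite -?leNgt => *; apply/andP; split; lra.
Qed.

Lemma exprS_diff_le n (x y : R) : 0 <= x <= y ->
  y ^+ n.+1 - x ^+ n.+1 <= n.+1%:R * y ^+ n * (y - x).
Proof.
move=> /andP[x0 xy]; have y0 : 0 <= y by exact: le_trans xy.
elim: n => [|n IH]; first by rewrite !expr1 expr0 mulr1 mul1r.
have xyn : x ^+ n.+1 <= y ^+ n.+1 by apply: lerXn2r.
rewrite [y ^+ n.+2]exprS [x ^+ n.+2]exprS -[n.+2]addn1 natrD.
have /(ler_wpM2l y0) : y ^+ n.+1 - x ^+ n.+1 <= n.+1%:R * y ^+ n * (y - x) by [].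
have -> : y * (n.+1%:R * y ^+ n * (y - x)) = n.+1%:R * y ^+ n.+1 * (y - x).
  by rewrite exprS; ring.
move=> h; have : 0 <= (y - x) * (y ^+ n.+1 - x ^+ n.+1) by rewrite mulr_ge0 ?subr_ge0.
move: h xyn; move: (y ^+ n.+1) (x ^+ n.+1) (n.+1%:R) => Y X N; nra.
Qed.

End Local.
End Interpolation.

(** * Interpolation on a single ball *)

Section LocalInterpolation.
Context {R : realType}.

(* The interpolation inequality below gains the power 2 + 2 gain over 2; the
   integrability condition on p, q, r is equivalent to gain > 0. *)
Definition gain (d' p q r : R) : R :=
  1 - p^-1 - (1 - 2 / d' + q^-1) / (1 - r^-1).

(** Taking y as the larger of the two cutoff values lets the error keep the factor y^n: a cutoff
    survives on the right, so that the error can later be reabsorbed. Here e bounds the variation of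
    the cutoff along an edge. *)
Lemma cutoff_product_sqr_le n (x y f h e : R) : 0 <= x <= y -> y <= 1 -> y - x <= e ->
  (x ^+ n.+1 * f - y ^+ n.+1 * h) ^+ 2
    <= 2 * (f - h) ^+ 2 + 2 * n.+1%:R ^+ 2 * e ^+ 2 * (y ^+ n) ^+ 2 * h ^+ 2.
Proof.
move=> xy y1 xye; have := exprS_diff_le n xy; move: xy => /andP[x0 xy].
have y0 : 0 <= y by exact: le_trans xy.
have X1 : x ^+ n.+1 <= 1 by rewrite exprn_ile1 // (le_trans xy).
have X0 : 0 <= x ^+ n.+1 by rewrite exprn_ge0.
have XY : x ^+ n.+1 <= y ^+ n.+1 by apply: lerXn2r.
have yn : 0 <= n.+1%:R * y ^+ n by rewrite mulr_ge0 ?exprn_ge0.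
move=> /le_trans /(_ (ler_wpM2l yn xye)) h1.
have {}h1 : (y ^+ n.+1 - x ^+ n.+1) ^+ 2 <= (n.+1%:R * y ^+ n * e) ^+ 2.
  by apply: ler_sqr_base h1; rewrite subr_ge0.
apply: (@le_trans _ _ (2 * (f - h) ^+ 2 + 2 * (n.+1%:R * y ^+ n * e) ^+ 2 * h ^+ 2));
  last by apply: eq_ler; ring.
apply: (@le_trans _ _ (2 * (f - h) ^+ 2 + 2 * (y ^+ n.+1 - x ^+ n.+1) ^+ 2 * h ^+ 2));
  last by rewrite lerD2l ler_wpM2r ?sqr_ge0 // ler_pM2l.
have -> : x ^+ n.+1 * f - y ^+ n.+1 * h =
   x ^+ n.+1 * (f - h) - (y ^+ n.+1 - x ^+ n.+1) * h by ring.
move: (x ^+ n.+1) (y ^+ n.+1) X0 X1 => X Y X0 X1.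
apply: (@le_trans _ _ (2 * (X * (f - h)) ^+ 2 + 2 * ((Y - X) * h) ^+ 2)).
  have := sqr_ge0 (X * (f - h) + (Y - X) * h); nra.
have : X ^+ 2 * (f - h) ^+ 2 <= (f - h) ^+ 2 by rewrite ler_piMl ?sqr_ge0 // expr_le1.
by rewrite !exprMn -mulrA; move: ((f - h) ^+ 2) (X ^+ 2 * _) => u v; lra.
Qed.

Section OneGraph.
Context {I : finType} (G : weighted_graph R I).

(** Each edge error is charged to the endpoint with the larger cutoff, and the conductances incident
    to a vertex sum to at most [wweight]. This is where mu enters the Sobolev argument. *)
Lemma energy_cutoff n (m : R) (f : I -> R) : 0 < m ->
  energy G (fun y => cutoff G m y ^+ n.+1 * f y)
    <= 2 * energy G f + 4 * n.+1%:R ^+ 2 / m ^+ 2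
       * \sum_y wweight G y * ((cutoff G m y ^+ n) ^+ 2 * f y ^+ 2).
Proof.
move=> m0; pose h y := (cutoff G m y ^+ n) ^+ 2 * f y ^+ 2.
have h0 y : 0 <= h y by rewrite mulr_ge0 ?sqr_ge0.
set K := 2 * n.+1%:R ^+ 2 * m^-1 ^+ 2 : R.
have K0 : 0 <= K by rewrite mulr_ge0 ?sqr_ge0 // mulr_ge0 ?sqr_ge0.
have E y z : wc G y z * (cutoff G m y ^+ n.+1 * f y - cutoff G m z ^+ n.+1 * f z) ^+ 2
   <= 2 * (wc G y z * (f y - f z) ^+ 2) + K * (wc G y z * h y) + K * (wc G y z * h z).
  have [->|cn] := eqVneq (wc G y z) 0; first by rewrite !mul0r !mulr0 !addr0.
  have cp : 0 < wc G y z by rewrite lt_def cn wc_ge0.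
  rewrite [leRHS](_ : _ = wc G y z * (2 * (f y - f z) ^+ 2 + K * h y + K * h z)); last by ring.
  rewrite ler_pM2l //.
  have := cutoff_lip m0 cp; have := cutoff_ge0 G m y; have := cutoff_ge0 G m z.
  have := cutoff_le1 G m y; have := cutoff_le1 G m z.
  have Kh x : K * h x = 2 * n.+1%:R ^+ 2 * m^-1 ^+ 2 * (cutoff G m x ^+ n) ^+ 2 * f x ^+ 2.
    by rewrite /K /h !mulrA.
  move=> z1 y1 z0 y0; have [yz|zy] := leP (cutoff G m y) (cutoff G m z).
    rewrite distrC ger0_norm ?subr_ge0 // => yze.
    have xy : 0 <= cutoff G m y <= cutoff G m z by rewrite y0.
    apply: (le_trans (cutoff_product_sqr_le n (f y) (f z) xy z1 yze)).
    by rewrite -Kh; have := mulr_ge0 K0 (h0 y); lra.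
  rewrite ger0_norm ?subr_ge0 ?(ltW zy) // => yze.
  have xy : 0 <= cutoff G m z <= cutoff G m y by rewrite z0 (ltW zy).
  rewrite -[leLHS]sqrrN opprB.
  apply: (le_trans (cutoff_product_sqr_le n (f z) (f y) xy y1 yze)).
  rewrite -Kh -[(f z - f y) ^+ 2]sqrrN opprB.
  by have := mulr_ge0 K0 (h0 z); lra.
have S1 : \sum_y \sum_z wc G y z * h y <= \sum_y wweight G y * h y.
  apply: ler_sum => y _; rewrite -mulr_suml ler_wpM2r //.
  exact: sum_wc_le_weight.
have S2 : \sum_y \sum_z wc G y z * h z <= \sum_y wweight G y * h y.
  rewrite exchange_big /=; apply: ler_sum => y _; rewrite -mulr_suml ler_wpM2r //.
  by apply: le_trans (sum_wc_le_weight G y); apply: ler_sum => z _; rewrite wc_sym.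
apply: (@le_trans _ _ (2 * energy G f + K * (\sum_y \sum_z wc G y z * h y)
   + K * (\sum_y \sum_z wc G y z * h z))).
  rewrite /energy /dirichlet !mulr_sumr -!big_split /=; apply: ler_sum => y _.
  by rewrite !mulr_sumr -!big_split /=; apply: ler_sum => z _.
have -> : 4 * n.+1%:R ^+ 2 / m ^+ 2 = K + K by rewrite /K exprVn; ring.
have := ler_wpM2l K0 S1; have := ler_wpM2l K0 S2; rewrite mulrDl; lra.
Qed.

(** Either the nonlinear term is at most Z/2 and is absorbed on the left, or Z^(1-b) < 2 C X^(1-b)
    and taking a root bounds Z by X. *)
Lemma self_absorption (b C X Z E : R) : 0 < b < 1 -> 0 < C -> 0 <= X -> 0 <= Z -> 0 <= E ->
  Z <= 2 * E + C * (X `^ (1 - b) * Z `^ b) ->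
  Z <= (4 + (2 * C) `^ (1 - b)^-1) * (E + X).
Proof.
move=> /andP[b0 b1] C0 X0 Z0 E0 h.
have c1 : 0 < 1 - b by rewrite subr_gt0.
have D0 : 0 <= (2 * C) `^ (1 - b)^-1 by rewrite powR_ge0.
have [le|lt] := leP (C * (X `^ (1 - b) * Z `^ b)) (Z / 2).
  have : 0 <= (2 * C) `^ (1 - b)^-1 * (E + X) by rewrite mulr_ge0 ?addr_ge0.
  by rewrite mulrDl; lra.
have [Zz|Zn] := eqVneq Z 0.
  by rewrite Zz mulr_ge0 ?addr_ge0.
have Zp : 0 < Z by rewrite lt_def Zn.
have {}lt : Z `^ (1 - b) < 2 * C * X `^ (1 - b).
  rewrite -(ltr_pM2r (powR_gt0 b Zp)) -powR_addr // subrK powRr1 //; lra.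
have c1' : 0 <= (1 - b)^-1 by rewrite invr_ge0 ltW.
have := ler_powR_base c1' (powR_ge0 _ _) (ltW lt).
rewrite powRM ?powR_ge0 ?mulr_ge0 ?(ltW C0) // -!powRrM divff ?gt_eqF // !powRr1 //.
move=> hh; apply: (le_trans hh).
have : 0 <= (2 * C) `^ (1 - b)^-1 * E by rewrite mulr_ge0.
rewrite mulrDl mulrDr; lra.
Qed.

End OneGraph.
End LocalInterpolation.

Section Interpolate.
Context {R : realType}.

Lemma powR_inj_exponents (m a b : R) : a = b -> m `^ a = m `^ b.
Proof. by move=> ->. Qed.

(** The hypothesis rearranges to ri < (1 - 1/p)(1 - 1/r), which is at once [0 < gain] and [b < 1].
    The value of b is the one for which the mu-weighted cutoff error interpolates between the L^2
    norm, with weight 1 - b, and the Sobolev norm, with weight b; [p^-1 <= b] makes the remaining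
    Hoelder exponent non-negative. *)
Lemma gain_exponents (d' p q r : R) : 2 <= d' -> 1 < p -> 1 < q -> 1 < r ->
  r^-1 + p^-1 * (1 - r^-1) + q^-1 < 2 / d' ->
  let ri := 1 - 2 / d' + q^-1 in let b := p^-1 * (1 - r^-1) / (1 - r^-1 - ri) in
  [/\ 0 < ri, 0 < gain d' p q r, 0 < b < 1 & p^-1 <= b] /\
  [/\ 0 < 1 - r^-1, 0 < 1 - r^-1 - ri & 0 < r^-1].
Proof.
move=> hd hp hq hr hcond ri b.
have p0 : 0 < p^-1 by rewrite invr_gt0 (lt_trans ltr01).
have q0 : 0 < q^-1 by rewrite invr_gt0 (lt_trans ltr01).
have r0 : 0 < r^-1 by rewrite invr_gt0 (lt_trans ltr01).
have p1 : p^-1 < 1 by rewrite invf_lt1 // (lt_trans ltr01).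
have r1 : r^-1 < 1 by rewrite invf_lt1 // (lt_trans ltr01).
have d2 : 2 / d' <= 1 by rewrite ler_pdivrMr ?mul1r // (lt_le_trans _ hd).
have ri0 : 0 < ri by rewrite /ri; lra.
have rr : 0 < 1 - r^-1 by rewrite subr_gt0.
have pr : 0 < p^-1 * (1 - r^-1) by rewrite mulr_gt0.
have h : ri < (1 - p^-1) * (1 - r^-1) by rewrite /ri; lra.
have rrr : 0 < 1 - r^-1 - ri by lra.
split; split => //.
- rewrite /gain -/ri subr_gt0 ltr_pdivrMr //.
- by rewrite divr_gt0 //= ltr_pdivrMr // mul1r; lra.
- rewrite /b ler_pdivlMr // ler_pM2l //; lra.
Qed.

(* Sobolev and Hoelder applied to a power of a cutoff times f; the energy created
   by the cutoff involves mu, and is reabsorbed because b < 1 in gain_exponents. *)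
Lemma local_interpolation (d d' p q r C : R) :
  2 <= d' -> 1 < p -> 1 < q -> 1 < r ->
  r^-1 + p^-1 * (1 - r^-1) + q^-1 < 2 / d' -> 0 < C ->
  exists K : R, 0 < K /\
    forall (I : finType) (G : weighted_graph R I) (m : R), 1 <= m ->
    regular_scale G d d' p q r C m ->
    forall f : I -> R, (forall y, 0 <= f y) -> supported G f ->
    \sum_(y | wdist G y <= m) wweight G y * f y `^ (2 + 2 * gain d' p q r)
      <= K * m `^ (- (d * gain d' p q r)) *
         (l2norm2 G f `^ gain d' p q r * (m ^+ 2 * energy G f + l2norm2 G f)).
Proof.
move=> hd hp hq hr hcond C0.
have [[ri0 s0 b01 pb] [rr0 rrr0 r0]] := gain_exponents hd hp hq hr hcond.
move: ri0 s0 b01 pb rrr0.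
set ri := 1 - 2 / d' + q^-1; set s := gain d' p q r.
set b := p^-1 * _ / _ => ri0 s0 /andP[b0 b1] pb rrr0.
have sE : s = 1 - p^-1 - ri / (1 - r^-1) by [].
have bE : b = p^-1 * (1 - r^-1) / (1 - r^-1 - ri) by [].
have riE : ri = 1 - 2 / d' + q^-1 by [].
clearbody s b ri.
have rp : 0 < r by rewrite (lt_trans ltr01).
have b1' : 0 < 1 - b by rewrite subr_gt0.
(* The exponents of theta^r in the two uses of [weighted_holder] below, first for the cutoff error
   and then for the final estimate; the exponent identities required there force these values. *)
have [t1 t1E] : exists x, x = (b - p^-1) * r^-1 by eexists.
have [t2 t2E] : exists x, x = ri * r^-1 / (1 - r^-1) by eexists.
have t10 : 0 <= t1 by rewrite t1E mulr_ge0 ?subr_ge0 // ltW.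
have t20 : 0 <= t2 by rewrite t2E divr_ge0 ?mulr_ge0 // ltW.
(* The cutoff enters g with the power n+1, the error term with the power 2 n, and Hoelder puts 2
   (n+1) b on it. As the cutoff is at most 1, the comparison needs (n+1) b <= n, which b < 1
   allows. *)
have [n [n1 hn]] : exists n : nat, (0 < n)%N /\ n.+1%:R * b <= n%:R.
  exists (Num.trunc (b / (1 - b))).+1; split => //.
  have := Num.Theory.truncnS_gt (b / (1 - b)); rewrite ltr_pdivrMr //.
  by rewrite -[in X in _ -> X * _ <= _]natr1; move: (_.+1%:R) => N; lra.
pose mh := 2 / ri * (d' - 1) / d'.
have [Sob SobE] : exists x, x = 4 * (C * mh) ^+ 2 * C `^ q^-1 by eexists.
pose C4 := 4 * n.+1%:R ^+ 2 * (C `^ (p^-1 + t1) * Sob `^ b) + 1.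
pose C5 := 4 + (2 * C4) `^ (1 - b)^-1.
have Sob0 : 0 <= Sob by rewrite SobE mulr_ge0 ?powR_ge0 // mulr_ge0 // sqr_ge0.
have C40 : 0 < C4 by rewrite ltr_wpDl // mulr_ge0 ?mulr_ge0 ?sqr_ge0 ?powR_ge0.
have C50 : 0 < C5 by rewrite ltr_pwDl // powR_ge0.
exists (C `^ (p^-1 + t2) * Sob * C5 + 1); split.
  by rewrite ltr_wpDl // mulr_ge0 ?(ltW C50) // mulr_ge0 ?powR_ge0.
move=> I G m m1 [Hnu Hrat Hth Hsob] f f0 fin.
have m0 : 0 < m by exact: lt_le_trans m1.
set P := fun y => wdist G y <= 2 * m.
pose V := C * m `^ d.
have V0 : 0 < V by rewrite mulr_gt0 // powR_gt0.
pose g y := cutoff G m y ^+ n.+1 * f y.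
have eta0 y : 0 <= cutoff G m y ^+ n.+1 by rewrite exprn_ge0 // cutoff_ge0.
have eta1 y : cutoff G m y ^+ n.+1 <= 1 by rewrite exprn_ile1 // ?cutoff_ge0 ?cutoff_le1.
have g0 y : 0 <= g y by rewrite mulr_ge0.
have gP y : ~~ P y -> g y = 0 by move=> Py; rewrite /g cutoff_eq0 // expr0n mul0r.
have gf y : g y <= f y by rewrite /g ler_piMl.
pose X := l2norm2 G f; pose E := energy G f; pose Eg := energy G g.
have X0 : 0 <= X by exact: l2norm2_ge0.
have E0 : 0 <= E by exact: energy_ge0.
have Eg0 : 0 <= Eg by exact: energy_ge0.
pose S := \sum_y g y `^ (2 / ri).
have S0 : 0 <= S by apply: sumr_ge0 => y _; rewrite powR_ge0.
have hS : S `^ ri <= Sob * m `^ (2 - d * (1 - ri)) * Eg.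
  have := @weighted_sobolev R I (wc G) (wnu G) (wc_ge0 G) (wc_sym G) (wnu_ge G)
    d' q ri (C * m `^ (1 - d / d')) V P g hd hq riE _ (ltW V0) g0 gP Hnu.
  rewrite mulr_ge0 ?powR_ge0 ?(ltW C0) // => /(_ isT) H.
  apply: (le_trans (H _)).
    move=> e e0; apply: Hsob => y.
    - by rewrite powR_ge0.
    - by move=> /fin fy; rewrite /g fy mulr0 powR0 // gt_eqF.
    - by move=> /gP ->; rewrite powR0 // gt_eqF.
  rewrite -/Eg ler_wpM2r // -/mh SobE /V powRM ?powR_ge0 ?(ltW C0) // -powRrM.
  apply: eq_ler.
  rewrite (_ : 2 - d * (1 - ri) = (1 - d / d') * 2 + d * q^-1); last first.
    by rewrite riE; field; rewrite !gt_eqF // ?(lt_le_trans _ hd) // (lt_trans ltr01).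
  rewrite [m `^ (_ * 2 + _)]powR_addr // [m `^ (_ * 2)]powRrM.
  by rewrite (powR_mulrn 2) ?powR_ge0 //; ring.
have hQ : \sum_y wweight G y * ((cutoff G m y ^+ n) ^+ 2 * f y ^+ 2)
    <= C `^ (p^-1 + t1) * Sob `^ b * (X `^ (1 - b) * (m ^+ 2 * Eg) `^ b).
  apply: (@le_trans _ _ (\sum_(y | P y) wweight G y * (f y `^ (2 * (1 - b)) * g y `^ (2 * b)))).
    rewrite [leLHS](bigID P) /= [X in _ + X]big1 ?addr0 => [|y Py]; last first.
      by rewrite cutoff_eq0 // expr0n (gtn_eqF n1) expr0n mul0r mulr0.
    apply: ler_sum => y _; rewrite ler_wpM2l ?wweight_ge0 //.
    have [->|fn] := eqVneq (f y) 0; first by rewrite expr0n mulr0 mulr_ge0 ?powR_ge0.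
    have fp : 0 < f y by rewrite lt_def fn f0.
    rewrite /g powRM // [leRHS]mulrCA -powR_addr // -mulrDr subrK mulr1 powR_mulrn //.
    rewrite ler_wpM2r ?sqr_ge0 //.
    have [->|cn] := eqVneq (cutoff G m y) 0.
      by rewrite expr0n (gtn_eqF n1) expr0n powR_ge0.
    have cp : 0 < cutoff G m y by rewrite lt_def cn cutoff_ge0.
    rewrite -exprM -[_ ^+ (n * 2)]powR_mulrn ?(ltW cp) // -[_ ^+ n.+1]powR_mulrn ?(ltW cp) // -powRrM.
    apply: ger_powR; first by rewrite cp cutoff_le1.
    by rewrite natrM; clear - hn; lra.
  have e1 : p^-1 + (1 - b) + r * t1 = 1.
    by rewrite t1E mulrCA divff ?gt_eqF // mulr1; ring.
  have e2 : p^-1 + (1 - b) + b * ri + t1 = 1.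
    rewrite t1E; move: bE rrr0; move: (p^-1) (r^-1) => a e bE rrr0.
    have : b * (1 - e - ri) = a * (1 - e) by rewrite bE mulfVK // gt_eqF.
    clear; lra.
  have := weighted_holder hp ri0 (ltW b1') b0 t10 rp V0 e1 e2 f0 g0 Hrat Hth.
  move=> h; apply: (le_trans h).
  rewrite -/S -/X (mulrC b ri) powRrM.
  have hSb : (S `^ ri) `^ b <= (Sob * m `^ (2 - d * (1 - ri)) * Eg) `^ b.
    by apply: ler_powR_base => //; rewrite ?powR_ge0 // ltW.
  have V1 : 0 <= V `^ (p^-1 + t1) by rewrite powR_ge0.
  apply: (@le_trans _ _ (V `^ (p^-1 + t1) * (X `^ (1 - b) * (Sob * m `^ (2 - d * (1 - ri)) * Eg) `^ b))).
    by rewrite ler_wpM2l // ler_wpM2l // powR_ge0.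
  apply: eq_ler; rewrite -[m ^+ 2]powR_mulrn ?(ltW m0) //.
  rewrite /V !powRM ?powR_ge0 ?(ltW C0) ?mulr_ge0 ?powR_ge0 //.
  have -> : (m `^ 2) `^ b = m `^ (2 * b) by rewrite -powRrM.
  have -> : m `^ (2 * b) = (m `^ d) `^ (p^-1 + t1) * (m `^ (2 - d * (1 - ri))) `^ b.
    rewrite -!powRrM -powR_addr //; apply: powR_inj_exponents.
    have -> : p^-1 + t1 = b - b * ri by clear - e2; lra.
    by ring.
  move: (C `^ _) ((m `^ d) `^ _) (X `^ _) (Sob `^ _) ((m `^ _) `^ b) (Eg `^ _).
  by move=> x1 x2 x3 x4 x5 x6; ring.
(* The energy of g bounds itself through the cutoff error, but with the power b < 1; hence it is
   controlled by the energy and the L^2 norm of f. *)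
have hZ : m ^+ 2 * Eg <= C5 * (m ^+ 2 * E + X).
  have m2 : 0 <= m ^+ 2 by exact: sqr_ge0.
  have m2E : 0 <= m ^+ 2 * E by exact: mulr_ge0.
  have m2Eg : 0 <= m ^+ 2 * Eg by exact: mulr_ge0.
  apply: (@self_absorption R b C4) => //; first by rewrite b0.
  have := ler_wpM2l m2 (energy_cutoff G n f m0); rewrite -/g -/Eg -/E => hE.
  apply: (le_trans hE); rewrite mulrDr (mulrCA (m ^+ 2)) lerD2l.
  set Q := \sum_y _ in hQ *.
  have -> : m ^+ 2 * (4 * n.+1%:R ^+ 2 / m ^+ 2 * Q) = 4 * n.+1%:R ^+ 2 * Q.
    by field; rewrite gt_eqF.
  have n0 : 0 <= 4 * n.+1%:R ^+ 2 :> R by rewrite mulr_ge0 ?sqr_ge0.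
  have := ler_wpM2l n0 hQ; rewrite /C4.
  have : 0 <= X `^ (1 - b) * (m ^+ 2 * Eg) `^ b by rewrite mulr_ge0 ?powR_ge0.
  move: (X `^ _ * _) => U U0; rewrite mulrDl mul1r mulrA; clear - U0; lra.
(* On the smaller ball g = f, so f^(2+2s) = f^(2s) g^2, and g carries the cutoff that the Sobolev
   inequality needs. Hoelder is now used with a = s and b = 1. *)
apply: (@le_trans _ _ (\sum_(y | P y) wweight G y * (f y `^ (2 * s) * g y `^ (2 * 1)))).
  apply: (@le_trans _ _ (\sum_(y | wdist G y <= m) wweight G y * (f y `^ (2 * s) * g y `^ (2 * 1)))).
    apply: ler_sum => y ym; rewrite ler_wpM2l ?wweight_ge0 //.
    rewrite /g cutoff_eq1 // expr1n mul1r mulr1.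
    have [->|fn] := eqVneq (f y) 0.
      by rewrite (@powR0 _ (2 + 2 * s)) ?mulr_ge0 ?powR_ge0 // gt_eqF //; lra.
    by rewrite -powR_addr ?lt_def ?fn ?f0 // addrC.
  rewrite [leRHS](bigID (fun y => wdist G y <= m)) /=.
  rewrite (_ : \sum_(y | P y && (wdist G y <= m)) _ = \sum_(y | wdist G y <= m)
     wweight G y * (f y `^ (2 * s) * g y `^ (2 * 1))); last first.
    apply: eq_bigl => y; rewrite /P; case: (leP (wdist G y) m) => h; rewrite ?andbF // andbT.
    lra.
  by rewrite lerDl; apply: sumr_ge0 => y _; rewrite mulr_ge0 ?wweight_ge0 // mulr_ge0 ?powR_ge0.
have e1 : p^-1 + s + r * t2 = 1.
  rewrite sE t2E (_ : r * (ri * r^-1 / (1 - r^-1)) = ri / (1 - r^-1)); first by ring.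
  by rewrite mulrA mulrCA divff ?gt_eqF // mulr1.
have e2 : p^-1 + s + 1 * ri + t2 = 1.
  rewrite sE t2E; move: rr0; move: (r^-1) (p^-1) => e a e0; field; lra.
have := weighted_holder hp ri0 (ltW s0) ltr01 t20 rp V0 e1 e2 f0 g0 Hrat Hth.
move=> h; apply: (le_trans h); rewrite -/S -/X mul1r.
apply: (@le_trans _ _ (V `^ (p^-1 + t2) * (X `^ s * (Sob * m `^ (2 - d * (1 - ri)) * Eg)))).
  by rewrite ler_wpM2l ?powR_ge0 // ler_wpM2l // powR_ge0.
have -> : V `^ (p^-1 + t2) * (X `^ s * (Sob * m `^ (2 - d * (1 - ri)) * Eg)) =
    C `^ (p^-1 + t2) * Sob * m `^ (- (d * s)) * (X `^ s * (m ^+ 2 * Eg)).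
  rewrite /V powRM ?powR_ge0 ?(ltW C0) //.
  have -> : m `^ (- (d * s)) = (m `^ d) `^ (p^-1 + t2) * m `^ (2 - d * (1 - ri)) / m ^+ 2.
    rewrite -powR_mulrn ?(ltW m0) // -powRN -powRrM -!powR_addr //.
    apply: powR_inj_exponents; have sE' : s = 1 - p^-1 - ri - t2 by clear - e2; lra.
    by rewrite sE'; ring.
  by field; rewrite gt_eqF.
have U0 : 0 <= m `^ (- (d * s)) * X `^ s by rewrite mulr_ge0 ?powR_ge0.
have W0 : 0 <= m ^+ 2 * E + X by rewrite addr_ge0 // mulr_ge0 // sqr_ge0.
have A0 : 0 <= C `^ (p^-1 + t2) * Sob by rewrite mulr_ge0 ?powR_ge0.
rewrite -/E [leLHS](_ : _ = (m `^ (- (d * s)) * X `^ s) * (C `^ (p^-1 + t2) * Sob * (m ^+ 2 * Eg))); last by ring.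
rewrite [leRHS](_ : _ = (m `^ (- (d * s)) * X `^ s) *
   ((C `^ (p^-1 + t2) * Sob * C5 + 1) * (m ^+ 2 * E + X))); last by ring.
rewrite ler_wpM2l //.
by apply: (le_trans (ler_wpM2l A0 hZ)); rewrite mulrA [leRHS]mulrDl mul1r lerDl.
Qed.

End Interpolate.

(** * Interpolation on the whole graph with a growing weight *)

Section GlobalInterpolation.
Context {R : realType}.

Definition growth {I : finType} (G : weighted_graph R I) (M : nat) (n : R) (y : I) : R :=
  (1 + wdist G y / n) ^+ M.

Lemma sum_half_pow_le k : \sum_(i < k) (2^-1 : R) ^+ i <= 2.
Proof.
suff -> : \sum_(i < k) (2^-1 : R) ^+ i = 2 - 2 * 2^-1 ^+ k.
  by rewrite gerBl mulr_ge0 // exprn_ge0.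
elim: k => [|k IH]; first by rewrite big_ord0 expr0; ring.
by rewrite big_ord_recr /= IH exprS; field.
Qed.

(** If i > 0 is least with dist <= 2^i n, then [1 + dist / n] is at least 2^(i-1), and raising it to
    2 s M >= 3 gives the weight 8 * 8^(-i). The power 3 is chosen because the local estimate at
    scale 2^i n loses a factor 4^i, so that 2^(-i) remains to be summed. *)
Lemma growth_layers {I : finType} (G : weighted_graph R I) (M k : nat) (s n : R) (y : I) :
  0 < n -> 0 < s -> 3 <= 2 * s * M%:R -> wdist G y <= 2 ^+ k * n ->
  (growth G M n y `^ (2 * s))^-1
    <= \sum_(i < k.+1) 8 * 8^-1 ^+ i * (wdist G y <= 2 ^+ i * n)%R%:R.
Proof.
move=> n0 s0 hM hk.
have ex : exists i, wdist G y <= 2 ^+ i * n by exists k.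
case: (ex_minnP ex) => i hi imin.
have ik : (i < k.+1)%N by rewrite ltnS; exact: imin.
rewrite (bigD1 (Ordinal ik)) //= hi mulr1.
apply: ler_wpDr.
  by apply: sumr_ge0 => j _; rewrite !mulr_ge0 ?exprn_ge0 ?invr_ge0.
have base1 : 1 <= 1 + wdist G y / n by rewrite lerDl divr_ge0 ?wdist_ge0 ?ltW.
have b0 : 0 <= 1 + wdist G y / n by exact: le_trans base1.
have -> : growth G M n y `^ (2 * s) = (1 + wdist G y / n) `^ (2 * s * M%:R).
  by rewrite /growth -powR_mulrn // -powRrM (mulrC M%:R).
case: i hi imin ik => [|i] hi imin ik.
  rewrite expr0 mulr1 (@le_trans _ _ 1) //; last by rewrite ler1n.
  rewrite invf_le1; last by rewrite powR_gt0 // (lt_le_trans ltr01).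
  have e0 : 0 <= 2 * s * M%:R by apply: le_trans hM.
  by have := ler_powR_base e0 ler01 base1; rewrite powR1.
have lt : 2 ^+ i * n < wdist G y.
  by rewrite ltNge; apply/negP => /imin; rewrite ltnn.
have two : 2 ^+ i <= 1 + wdist G y / n.
  apply: (@le_trans _ _ (wdist G y / n)); last by rewrite lerDr.
  by rewrite ler_pdivlMr // ltW.
have p0 : 0 < (2 : R) ^+ i by rewrite exprn_gt0.
have -> : 8 * 8^-1 ^+ i.+1 = ((2 ^+ i) `^ 3)^-1 :> R.
  rewrite exprS mulrA divff // mul1r exprVn (powR_mulrn 3) ?ltW //.
  by rewrite -exprM mulnC exprM; congr (_ ^+ _)^-1; ring.
rewrite lef_pV2 ?posrE ?powR_gt0 ?(lt_le_trans p0) //.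
apply: (@le_trans _ _ ((1 + wdist G y / n) `^ 3)).
  by apply: ler_powR_base => //; exact: ltW.
by apply: ler_powR.
Qed.

(* Summing the local inequality over the balls of radius 2 ^+ i * n; the negative
   power of growth makes the sum converge. *)
Lemma global_interpolation (d d' p q r C : R) :
  2 <= d -> 2 <= d' -> 1 < p -> 1 < q -> 1 < r ->
  r^-1 + p^-1 * (1 - r^-1) + q^-1 < 2 / d' -> 0 < C ->
  exists (K : R) (M : nat), 0 < K /\
    forall (I : finType) (G : weighted_graph R I) (n : R), 1 <= n ->
    (forall i, regular_scale G d d' p q r C (2 ^+ i * n)) ->
    forall f : I -> R, (forall y, 0 <= f y) -> supported G f ->
    \sum_y wweight G y * f y `^ (2 + 2 * gain d' p q r)
           / growth G M n y `^ (2 * gain d' p q r)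
      <= K * n `^ (- (d * gain d' p q r)) *
         (l2norm2 G f `^ gain d' p q r * (n ^+ 2 * energy G f + l2norm2 G f)).
Proof.
move=> hd hd' hp hq hr hcond C0.
have [[_ s0 _ _] _] := gain_exponents hd' hp hq hr hcond.
have [K [K0 HK]] := local_interpolation d hd' hp hq hr hcond C0.
set s := gain d' p q r in s0 HK *.
have [M hM] : exists M : nat, 3 <= 2 * s * M%:R.
  exists (Num.trunc (3 / (2 * s))).+1.
  have s2 : 0 < 2 * s by rewrite mulr_gt0.
  have := Num.Theory.truncnS_gt (3 / (2 * s)).
  by rewrite ltr_pdivrMr // mulrC => /ltW.
exists (16 * K), M; split; first by rewrite mulr_gt0.
move=> I G n n1 Hreg f f0 fin.
have n0 : 0 < n by exact: lt_le_trans n1.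
(* A finite graph is exhausted by finitely many scales. Their number does not enter the final
   constant, since the layers sum geometrically. *)
have [k hk] : exists k : nat, forall y, wdist G y <= 2 ^+ k * n.
  pose D := \sum_y wdist G y.
  exists (Num.trunc D).+1 => y.
  have h1 : wdist G y <= D.
    by rewrite /D (bigD1 y) //= lerDl sumr_ge0 // => z _; exact: wdist_ge0.
  apply: (le_trans h1); apply: (@le_trans _ _ (2 ^+ (Num.trunc D).+1)); last first.
    by rewrite ler_peMr // exprn_ge0.
  apply: (le_trans (ltW (Num.Theory.truncnS_gt D))).
  by rewrite -natrX ler_nat ltnW // ltn_expl.
set X := l2norm2 G f; set E := energy G f.
have X0 : 0 <= X by exact: l2norm2_ge0.
have E0 : 0 <= E by exact: energy_ge0.
set B := n `^ (- (d * s)) * (X `^ s * (n ^+ 2 * E + X)).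
have B0 : 0 <= B by rewrite !mulr_ge0 ?powR_ge0 // addr_ge0 // mulr_ge0 // sqr_ge0.
have L i : \sum_(y | wdist G y <= 2 ^+ i * n) wweight G y * f y `^ (2 + 2 * s)
    <= K * 4 ^+ i * B.
  have i1 : 1 <= (2 : R) ^+ i by rewrite exprn_ege1 // ler1n.
  have i0 : 0 < (2 : R) ^+ i by exact: lt_le_trans i1.
  have m1 : 1 <= 2 ^+ i * n.
    by rewrite -[leLHS]mulr1; apply: ler_pM.
  apply: (le_trans (HK I G _ m1 (Hreg i) f f0 fin)); rewrite -/X -/E.
  rewrite powRM ?(ltW i0) ?(ltW n0) //.
  (* The decay in i coming from the volume factor is given away; only the loss 4^i from the squared
     radius is kept. *)
  have h1 : (2 ^+ i) `^ (- (d * s)) <= 1.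
    rewrite powRN invf_le1 ?powR_gt0 //.
    have e0 : 0 <= d * s by rewrite mulr_ge0 ?(ltW s0) // (le_trans _ hd).
    by have := ler_powR_base e0 ler01 i1; rewrite powR1.
  have h2 : (2 ^+ i * n) ^+ 2 * E + X <= 4 ^+ i * (n ^+ 2 * E + X).
    have -> : (2 ^+ i * n) ^+ 2 = 4 ^+ i * n ^+ 2.
      by rewrite exprMn -exprM mulnC exprM; congr (_ ^+ _ * _); ring.
    have : X <= 4 ^+ i * X by rewrite ler_peMl // exprn_ege1 // ler1n.
    by move=> h; rewrite mulrDr [4 ^+ i * (n ^+ 2 * E)]mulrA lerD2l.
  have n2 : 0 <= K * n `^ (- (d * s)) * X `^ s.
    by rewrite mulr_ge0 ?powR_ge0 // mulr_ge0 ?powR_ge0 // ltW.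
  have h3 : 0 <= (2 ^+ i * n) ^+ 2 * E + X.
    by rewrite addr_ge0 // mulr_ge0 // sqr_ge0.
  have := ler_wpM2l n2 (le_trans (ler_piMl h3 h1) h2); rewrite /B.
  move: ((2 ^+ i) `^ _) (n `^ _) (X `^ s) ((2 ^+ i * n) ^+ 2 * E + X) (n ^+ 2 * E + X) => u v w z z'.
  have -> : K * v * w * (u * z) = K * (u * v) * (w * z) by ring.
  by have -> : K * v * w * (4 ^+ i * z') = K * 4 ^+ i * (v * (w * z')) by ring.
apply: (@le_trans _ _ (\sum_y \sum_(i < k.+1) 8 * 8^-1 ^+ i *
    (if wdist G y <= 2 ^+ i * n then wweight G y * f y `^ (2 + 2 * s) else 0))).
  apply: ler_sum => y _.
  have Wf : 0 <= wweight G y * f y `^ (2 + 2 * s) by rewrite mulr_ge0 ?wweight_ge0 ?powR_ge0.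
  apply: (le_trans (ler_wpM2l Wf (growth_layers n0 s0 hM (hk y)))).
  rewrite mulr_sumr; apply: ler_sum => i _.
  by case: ifP => _; rewrite ?mulr1 ?mulr0 // mulrC.
rewrite exchange_big /=.
apply: (@le_trans _ _ (\sum_(i < k.+1) 8 * K * B * 2^-1 ^+ i)).
  apply: ler_sum => i _; rewrite -mulr_sumr -big_mkcond /=.
  have c0 : 0 <= 8 * 8^-1 ^+ i :> R by rewrite mulr_ge0 // exprn_ge0 // invr_ge0.
  apply: (le_trans (ler_wpM2l c0 (L i))).
  rewrite (_ : 2^-1 = 8^-1 * 4 :> R); last by field.
  by rewrite exprMn; apply: eq_ler; ring.
rewrite -mulr_sumr.
have c0 : 0 <= 8 * K * B by rewrite mulr_ge0 // mulr_ge0 // ltW.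
apply: (le_trans (ler_wpM2l c0 (sum_half_pow_le _))).
by apply: eq_ler; rewrite /B; ring.
Qed.

End GlobalInterpolation.

(** * Local boundedness of solutions *)

Section EdgeInequality.
Context {R : realType}.

(** The error that conjugation with exp psi causes on an edge along which psi changes by x, made
    symmetric so that both endpoints see the same quantity. *)
Definition tilt (x : R) : R := (expR x - 1) ^+ 2 + (expR (- x) - 1) ^+ 2.

Lemma tilt_ge0 x : 0 <= tilt x.
Proof. by rewrite addr_ge0 ?sqr_ge0. Qed.

Lemma tiltN x : tilt (- x) = tilt x.
Proof. by rewrite /tilt opprK addrC. Qed.

(** A Caccioppoli inequality on one edge: A and B are truncated values, a and b their levels. With e
    = exp x and f = 1/e, the difference of the two sides is a combination of squares with
    non-negative factors; the quantity e + f - 2 = f (e - 1)^2, which is not a square in this sense,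
    lies between 0 and [tilt x / 2]. *)
Lemma truncated_edge_le (A B a b x : R) : 0 <= A -> 0 <= B ->
  A * (expR x * (B + b) - (A + a)) + B * (expR (- x) * (A + a) - (B + b))
    <= - 2^-1 * (A - B) ^+ 2 + tilt x * (A ^+ 2 + B ^+ 2 + 2 * b ^+ 2)
       + 2 * (a - b) ^+ 2.
Proof.
move=> A0 B0; rewrite /tilt.
have eE : expR x * expR (- x) = 1 by rewrite expRxMexpNx_1.
have := expR_gt0 x; have := expR_gt0 (- x).
move: (expR x) (expR (- x)) eE => e f ef f0 e0.
have s1 : 0 <= e + f - 2.
  have -> : e + f - 2 = f * (e - 1) ^+ 2.
    have -> : f * (e - 1) ^+ 2 = (e * f) * e - 2 * (e * f) + f by ring.
    by rewrite ef; ring.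
  by rewrite mulr_ge0 ?sqr_ge0 // ltW.
have s2 : e + f - 2 <= ((e - 1) ^+ 2 + (f - 1) ^+ 2) / 2.
  have := sqr_ge0 (e - 1 - (1 - f)).
  have -> : (e - 1 - (1 - f)) ^+ 2 =
     (e - 1) ^+ 2 + (f - 1) ^+ 2 - 2 * (e + f - 1 - e * f) by ring.
  rewrite ef; lra.
have s2' : 0 <= ((e - 1) ^+ 2 + (f - 1) ^+ 2) / 2 - (e + f - 2) by rewrite subr_ge0.
have f1 := sqr_ge0 ((A - B) / 2 - (b - a)).
have f2 := sqr_ge0 ((A - B) / 2 - (e - 1) * b).
have f3 := mulr_ge0 s1 (sqr_ge0 (A - B)).
have f4 := mulr_ge0 s1 (sqr_ge0 (B - b)).
have f5 := sqr_ge0 (B * (f - 1) - (a - b)).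
have f6 := mulr_ge0 s2' (sqr_ge0 A).
have f7 := mulr_ge0 s2' (sqr_ge0 B).
have f8 := mulr_ge0 s2' (sqr_ge0 b).
have g1 := mulr_ge0 (sqr_ge0 (e - 1)) (sqr_ge0 A).
have g2 := mulr_ge0 (sqr_ge0 (f - 1)) (sqr_ge0 A).
have g3 := mulr_ge0 (sqr_ge0 (e - 1)) (sqr_ge0 B).
have g4 := mulr_ge0 (sqr_ge0 (f - 1)) (sqr_ge0 B).
have g5 := mulr_ge0 (sqr_ge0 (e - 1)) (sqr_ge0 b).
have g6 := mulr_ge0 (sqr_ge0 (f - 1)) (sqr_ge0 b).
have g7 := sqr_ge0 (a - b).
clear s1 s2 s2' ef A0 B0 e0 f0.
lra.
Qed.

Definition excess (v l : R) : R := Num.max 0 (v - l).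
Definition on_excess (v l c : R) : R := if l < v then c else 0.

Lemma excess_ge0 v l : 0 <= excess v l.
Proof. by rewrite /excess le_max lexx. Qed.

Lemma excess_gt v l : l < v -> excess v l = v - l.
Proof. by move=> lv; rewrite /excess (max_idPr _) // subr_ge0 ltW. Qed.

Lemma excess_le v l : v <= l -> excess v l = 0.
Proof. by move=> lv; rewrite /excess (max_idPl _) // subr_le0. Qed.

(** Only a level that is exceeded may appear on the right. When one endpoint is below its level, its
    value is first raised to that level, and the endpoints are ordered so that the single level b
    left in [truncated_edge_le] belongs to the other one. *)
Lemma level_edge_le (K e v w l m x : R) : 1 <= K -> 0 <= l -> 0 <= m ->
  l ^+ 2 <= K * m ^+ 2 -> m ^+ 2 <= K * l ^+ 2 ->
  (l - m) ^+ 2 <= e * l ^+ 2 -> (l - m) ^+ 2 <= e * m ^+ 2 ->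
  excess v l * (expR x * w - v) + excess w m * (expR (- x) * v - w)
    <= - 2^-1 * (excess v l - excess w m) ^+ 2
       + 2 * K * tilt x * ((excess v l ^+ 2 + on_excess v l (l ^+ 2))
                         + (excess w m ^+ 2 + on_excess w m (m ^+ 2)))
       + 2 * e * (on_excess v l (l ^+ 2) + on_excess w m (m ^+ 2)).
Proof.
move=> K1 l0 m0 lm ml lme lme'.
have [vl|lv] := leP v l; have [wm|mw] := leP w m.
- rewrite /on_excess !ltNge vl wm /= !excess_le // !mul0r subrr expr0n /=; lra.
- have A0 := excess_ge0 v l; have B0 := excess_ge0 w m.
  have h := truncated_edge_le l m x A0 B0.
  apply: (@le_trans _ _ (excess v l * (expR x * (excess w m + m) - (excess v l + l)) +
     excess w m * (expR (- x) * (excess v l + l) - (excess w m + m)))).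
    rewrite (excess_le vl) !mul0r !add0r ler_wpM2l // (excess_gt mw) subrK.
    by rewrite lerD2r ler_wpM2l // expR_ge0.
  apply: (le_trans h); rewrite (excess_le vl) (excess_gt mw).
  rewrite /on_excess mw ltNge vl /=.
  have t0 := tilt_ge0 x; have t1 := sqr_ge0 (w - m).
  have t2 := sqr_ge0 m.
  have h1 : tilt x * (0 ^+ 2 + (w - m) ^+ 2 + 2 * m ^+ 2) <=
     2 * K * tilt x * (0 ^+ 2 + 0 + ((w - m) ^+ 2 + m ^+ 2)).
    rewrite (_ : 2 * K * tilt x * _ = tilt x * (K * (2 * ((w - m) ^+ 2 + m ^+ 2)))); last by ring.
    rewrite ler_wpM2l // expr0n add0r.
    apply: (@le_trans _ _ (1 * (2 * ((w - m) ^+ 2 + m ^+ 2)))); first lra.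
    by rewrite ler_wpM2r //; lra.
  lra.
- have A0 := excess_ge0 v l; have B0 := excess_ge0 w m.
  have h := truncated_edge_le m l (- x) B0 A0.
  apply: (@le_trans _ _ (excess w m * (expR (- x) * (excess v l + l) - (excess w m + m)) +
     excess v l * (expR (- - x) * (excess w m + m) - (excess v l + l)))).
    rewrite (excess_le wm) !mul0r !add0r addr0 opprK ler_wpM2l // (excess_gt lv) subrK.
    by rewrite lerD2r ler_wpM2l // expR_ge0.
  apply: (le_trans h); rewrite (excess_le wm) (excess_gt lv).
  rewrite /on_excess lv ltNge wm /= tiltN.
  have t0 := tilt_ge0 x; have t1 := sqr_ge0 (v - l).
  have t2 := sqr_ge0 l.
  have h1 : tilt x * (0 ^+ 2 + (v - l) ^+ 2 + 2 * l ^+ 2) <=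
     2 * K * tilt x * ((v - l) ^+ 2 + l ^+ 2 + (0 ^+ 2 + 0)).
    rewrite (_ : 2 * K * tilt x * _ = tilt x * (K * (2 * ((v - l) ^+ 2 + l ^+ 2)))); last by ring.
    rewrite ler_wpM2l // expr0n add0r.
    apply: (@le_trans _ _ (1 * (2 * ((v - l) ^+ 2 + l ^+ 2)))); first lra.
    by rewrite ler_wpM2r //; lra.
  lra.
have A0 := excess_ge0 v l; have B0 := excess_ge0 w m.
have h := truncated_edge_le l m x A0 B0.
have ve : excess v l + l = v by rewrite excess_gt // subrK.
have we : excess w m + m = w by rewrite excess_gt // subrK.
rewrite ve we in h; apply: (le_trans h).
rewrite /on_excess lv mw; move: (excess v l) (excess w m) => A B.
have t0 := tilt_ge0 x.
have h1 : tilt x * (A ^+ 2 + B ^+ 2 + 2 * m ^+ 2) <=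
     2 * K * tilt x * ((A ^+ 2 + l ^+ 2) + (B ^+ 2 + m ^+ 2)).
  rewrite (_ : 2 * K * tilt x * _ = tilt x *
    (K * (2 * ((A ^+ 2 + l ^+ 2) + (B ^+ 2 + m ^+ 2))))); last by ring.
  rewrite ler_wpM2l //.
  have := sqr_ge0 A; have := sqr_ge0 B; have := sqr_ge0 l; have := sqr_ge0 m.
  move: (A ^+ 2) (B ^+ 2) (l ^+ 2) (m ^+ 2) => a b l' m' q1 q2 q3 q4.
  apply: (@le_trans _ _ (1 * (2 * ((a + l') + (b + m'))))); first lra.
  by rewrite ler_wpM2r //; lra.
have := sqr_ge0 (l - m); move: ((l - m) ^+ 2) lme lme' h1 => q; clear; lra.
Qed.

End EdgeInequality.

(** * Energy estimate for truncations of tilted solutions *)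

Section TruncatedEnergy.
Context {R : realType} {I : finType} (G : weighted_graph R I).

(** The heat equation with zero values off [winn], for all real times, so that derivatives at time 0
    are two-sided. *)
Record killed_solution (w : R -> I -> R) : Prop := KilledSolution {
  killed_derive : forall (s : R) (z : I), is_derive s 1 (fun t : R => w t z)
    (if winn G z then (wtheta G z)^-1 * \sum_y wc G z y * (w s y - w s z) else 0);
  killed_ge0 : forall s z, 0 <= s -> 0 <= w s z;
  killed_supp : forall s z, ~~ winn G z -> w s z = 0 }.

Lemma continuous_bigsum (J : finType) (h : J -> R -> R) (s : R) :
  (forall i, {for s, continuous (h i)}) ->
  {for s, continuous (fun t => \sum_i h i t)}.
Proof.
move=> H; elim: (index_enum J) => [|i r IH].
  have -> : (fun t => \sum_(i <- [::]) h i t) = cst 0.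
    by apply/funext => t; rewrite big_nil.
  exact: cst_continuous.
have -> : (fun t => \sum_(j <- i :: r) h j t) =
    (h i \+ (fun t => \sum_(j <- r) h j t)).
  by apply/funext => t; rewrite big_cons.
exact: (continuousD (H i) IH).
Qed.

Variables (psi Phi : I -> R) (w : R -> I -> R) (H K e : R).
Hypothesis wP : killed_solution w.
Hypothesis K1 : 1 <= K.
Hypothesis Phi_gt0 : forall y, 0 < Phi y.
Hypothesis Phi_cmp : forall y z, 0 < wc G y z -> Phi y ^+ 2 <= K * Phi z ^+ 2.
Hypothesis Phi_lip : forall y z, 0 < wc G y z -> (Phi y - Phi z) ^+ 2 <= e * Phi z ^+ 2.
Hypothesis psi_lip : forall z,
  \sum_y wc G z y * tilt (psi y - psi z) <= H * wtheta G z.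
Hypothesis e0 : 0 <= e.

(* Truncating at the level k * Phi, which grows with the distance, replaces the
   spatial cutoffs of the usual De Giorgi iteration. *)
Definition tilted (s : R) (z : I) : R := expR (psi z) * w s z.
Definition level (k s : R) (z : I) : R := excess (tilted s z) (k * Phi z).
Definition level_ind (k s : R) (z : I) : R :=
  on_excess (tilted s z) (k * Phi z) ((k * Phi z) ^+ 2).

Lemma level_ge0 k s z : 0 <= level k s z.
Proof. exact: excess_ge0. Qed.

Lemma level_ind_ge0 k s z : 0 <= level_ind k s z.
Proof. by rewrite /level_ind /on_excess; case: ifP => // _; exact: sqr_ge0. Qed.

Lemma level_supp k s : 0 <= k -> supported G (level k s).
Proof.
move=> k0 z zn; rewrite /level /tilted (killed_supp wP) // mulr0 excess_le //.
by rewrite mulr_ge0 // ltW.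
Qed.

Lemma tilted_continuous z : continuous (fun s => tilted s z).
Proof.
move=> s; apply: (@continuousM R R (fun=> expR (psi z)) (fun t => w t z)).
  exact: cst_continuous.
exact: is_derive_continuous (killed_derive wP s z).
Qed.

Lemma level_continuous k z : continuous (fun s => level k s z).
Proof.
move=> s; apply: (@continuous_max R R (fun=> 0) (fun t => tilted t z - k * Phi z)).
  exact: cst_continuous.
by apply: continuousB; [exact: tilted_continuous|exact: cst_continuous].
Qed.

Lemma level_sum_continuous k (u : I -> R) :
  continuous (fun s => \sum_z u z * level k s z ^+ 2).
Proof.
move=> s; apply: continuous_bigsum => z.
apply: (@continuousM R R (fun=> u z) (fun t => level k t z ^+ 2)).
  exact: cst_continuous.
exact: (continuousM (@level_continuous k z s) (@level_continuous k z s)).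
Qed.

Lemma level_energy_continuous k : continuous (fun s => energy G (level k s)).
Proof.
move=> s; apply: continuous_bigsum => y; apply: continuous_bigsum => z.
apply: (@continuousM R R (fun=> wc G y z)
  (fun t => (level k t y - level k t z) ^+ 2)); first exact: cst_continuous.
have hc : {for s, continuous (fun t => level k t y - level k t z)}.
  by apply: continuousB; exact: level_continuous.
exact: (continuousM hc hc).
Qed.

Definition level_dissipation (k s : R) : R :=
  \sum_z wtheta G z * (2 * level k s z * (expR (psi z) *
    (if winn G z then (wtheta G z)^-1 * \sum_y wc G z y * (w s y - w s z) else 0))).

Lemma level_l2_derive (k s : R) :
  is_derive s 1 (fun t : R => l2norm2 G (level k t)) (level_dissipation k s).
Proof.
apply: is_derive_bigsum => z _.
have h1 := killed_derive wP s z.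
set dw := (if _ then _ else _) in h1 *.
have h2 : is_derive s 1 (fun t : R => tilted t z - k * Phi z) (expR (psi z) * dw).
  by apply: is_derive_eq; rewrite subr0.
have h3 := is_derive_posr_sqr (tilted s z - k * Phi z).
have h4 := @is_derive1_comp R (fun y => Num.max 0 y ^+ 2) _ s _ _ h3 h2.
have h5 := @is_deriveZ R R R _ (wtheta G z) s 1 _ h4.
exact: h5.
Qed.

(** Summation by parts: pairing the terms of (z, y) and (y, z) turns the time derivative into a sum
    of left-hand sides of [level_edge_le]. The tilt errors at a vertex add up to H theta by
    [psi_lip], the level errors to at most max(theta, mu). *)
Lemma level_dissipation_le k s : 0 <= k ->
  level_dissipation k s <= - 2^-1 * energy G (level k s)
    + 4 * K * H * (\sum_z wtheta G z * (level k s z ^+ 2 + level_ind k s z))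
    + 4 * e * (\sum_z wweight G z * level_ind k s z).
Proof.
move=> k0.
pose g z y := level k s z * (wc G z y * (expR (psi z - psi y) * tilted s y - tilted s z)).
have -> : level_dissipation k s = \sum_z \sum_y (g z y + g y z).
  rewrite /level_dissipation; under [RHS]eq_bigr do rewrite big_split /=.
  rewrite big_split /= [X in _ = _ + X]exchange_big /= -big_split /=.
  apply: eq_bigr => z _.
  rewrite (_ : \sum_y g z y + \sum_y g z y = 2 * \sum_y g z y); last by ring.
  (* At a killed vertex w vanishes and the level is non-negative, so the truncation is 0 and both
     sides are 0 there. *)
  case: ifPn => zi; last first.
    rewrite !mulr0 big1 ?mulr0 // => y _.
    by rewrite /g (level_supp s k0 zi) mul0r.
  have -> : \sum_y g z y = level k s z * (expR (psi z) * \sum_y wc G z y * (w s y - w s z)).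
    rewrite !mulr_sumr; apply: eq_bigr => y _.
    rewrite /g /tilted expRD expRN; field; rewrite gt_eqF // expR_gt0 //.
  have := wtheta_gt0 G z; move: (wtheta G z) => t t0; field.
  by rewrite gt_eqF.
pose U z := level k s z ^+ 2 + level_ind k s z.
have gle z y : g z y + g y z <= wc G z y * (- 2^-1 * (level k s z - level k s y) ^+ 2)
   + 2 * K * (wc G z y * tilt (psi y - psi z) * U z + wc G z y * tilt (psi y - psi z) * U y)
   + 2 * e * (wc G z y * level_ind k s z + wc G z y * level_ind k s y).
  rewrite /g [wc G y z]wc_sym.
  have [->|cn] := eqVneq (wc G z y) 0; first by rewrite !(mul0r, mulr0, addr0).
  have cp : 0 < wc G z y by rewrite lt_def cn wc_ge0.
  have cp' : 0 < wc G y z by rewrite wc_sym.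
  have := @level_edge_le R K e (tilted s z) (tilted s y) (k * Phi z) (k * Phi y)
    (psi z - psi y) K1.
  rewrite !mulr_ge0 ?(ltW (Phi_gt0 _)) // !exprMn -!mulrBr !exprMn.
  rewrite !(mulrCA _ (k ^+ 2)) !ler_wpM2l ?sqr_ge0 ?Phi_cmp ?Phi_lip //; last first.
    by rewrite -[(_ - _) ^+ 2]sqrrN opprB Phi_lip.
  move=> /(_ isT isT isT isT isT isT) /(ler_wpM2l (ltW cp)) h.
  rewrite [leLHS](_ : _ = wc G z y * (level k s z * (expR (psi z - psi y) * tilted s y - tilted s z)
    + level k s y * (expR (- (psi z - psi y)) * tilted s z - tilted s y))); last first.
    by rewrite opprB; ring.
  apply: (le_trans h); rewrite -tiltN opprB /U /level_ind !exprMn.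
  by apply: eq_ler; rewrite -/(level k s z) -/(level k s y); ring.
apply: (le_trans (ler_sum _ (fun z _ => ler_sum _ (fun y _ => gle z y)))).
have tsym z y : tilt (psi y - psi z) = tilt (psi z - psi y) by rewrite -tiltN opprB.
have U0 z : 0 <= U z by rewrite addr_ge0 ?sqr_ge0 ?level_ind_ge0.
have S1 : \sum_z \sum_y wc G z y * tilt (psi y - psi z) * U z <= H * \sum_z wtheta G z * U z.
  rewrite mulr_sumr; apply: ler_sum => z _; rewrite -mulr_suml mulrA.
  by rewrite ler_wpM2r.
have S2 : \sum_z \sum_y wc G z y * tilt (psi y - psi z) * U y <= H * \sum_z wtheta G z * U z.
  rewrite exchange_big /= mulr_sumr; apply: ler_sum => z _; rewrite -mulr_suml mulrA.
  rewrite ler_wpM2r //; apply: le_trans (psi_lip z); apply: ler_sum => y _.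
  by rewrite wc_sym tsym.
have S3 : \sum_z \sum_y wc G z y * level_ind k s z <= \sum_z wweight G z * level_ind k s z.
  apply: ler_sum => z _; rewrite -mulr_suml ler_wpM2r ?level_ind_ge0 //.
  exact: sum_wc_le_weight.
have S4 : \sum_z \sum_y wc G z y * level_ind k s y <= \sum_z wweight G z * level_ind k s z.
  rewrite exchange_big /=; apply: ler_sum => z _; rewrite -mulr_suml ler_wpM2r ?level_ind_ge0 //.
  by apply: le_trans (sum_wc_le_weight G z); apply: ler_sum => y _; rewrite wc_sym.
have -> : \sum_z \sum_y (wc G z y * (- 2^-1 * (level k s z - level k s y) ^+ 2)
   + 2 * K * (wc G z y * tilt (psi y - psi z) * U z + wc G z y * tilt (psi y - psi z) * U y)
   + 2 * e * (wc G z y * level_ind k s z + wc G z y * level_ind k s y)) =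
   - 2^-1 * energy G (level k s)
   + 2 * K * (\sum_z \sum_y wc G z y * tilt (psi y - psi z) * U z
      + \sum_z \sum_y wc G z y * tilt (psi y - psi z) * U y)
   + 2 * e * (\sum_z \sum_y wc G z y * level_ind k s z
      + \sum_z \sum_y wc G z y * level_ind k s y).
  rewrite /energy /dirichlet -!big_split /= !mulr_sumr -!big_split /=.
  apply: eq_bigr => z _; rewrite -!big_split /= !mulr_sumr -!big_split /=.
  by apply: eq_bigr => y _; ring.
have K0 : 0 <= 2 * K by rewrite mulr_ge0 // (le_trans _ K1).
have e20 : 0 <= 2 * e by rewrite mulr_ge0.
have := ler_wpM2l K0 (lerD S1 S2); have := ler_wpM2l e20 (lerD S3 S4).
rewrite /U; lra.
Qed.

End TruncatedEnergy.

(** * One step of the De Giorgi iteration *)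

Section DeGiorgiStep.
Context {R : realType} {I : finType} (G : weighted_graph R I).
Variables (psi Phi : I -> R) (w : R -> I -> R) (H K e : R).
Hypothesis wP : killed_solution G w.
Hypothesis K1 : 1 <= K.
Hypothesis Phi_gt0 : forall y, 0 < Phi y.
Hypothesis Phi_cmp : forall y z, 0 < wc G y z -> Phi y ^+ 2 <= K * Phi z ^+ 2.
Hypothesis Phi_lip : forall y z, 0 < wc G y z -> (Phi y - Phi z) ^+ 2 <= e * Phi z ^+ 2.
Hypothesis psi_lip : forall z,
  \sum_y wc G z y * tilt (psi y - psi z) <= H * wtheta G z.
Hypothesis e0 : 0 <= e.
Hypothesis H0 : 0 <= H.
Variables (A sg tau : R).
Hypothesis A0 : 0 <= A.
Hypothesis sg0 : 0 < sg.
Hypothesis tau0 : 0 < tau.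
Hypothesis interp : forall f : I -> R, (forall y, 0 <= f y) -> supported G f ->
  \sum_y wweight G y * f y `^ (2 + 2 * sg) / Phi y `^ (2 * sg)
    <= A * (l2norm2 G f `^ sg * (tau * energy G f + l2norm2 G f)).

Local Notation lev := (level psi Phi w).

Definition mass (k s : R) : R := \sum_z wweight G z * lev k s z ^+ 2.

Lemma mass_ge0 k s : 0 <= mass k s.
Proof. by apply: sumr_ge0 => z _; rewrite mulr_ge0 ?sqr_ge0 ?wweight_ge0. Qed.

Lemma mass_continuous k : continuous (mass k).
Proof. exact: level_sum_continuous wP _ _. Qed.

Lemma level_anti k k' s z : k <= k' -> lev k' s z <= lev k s z.
Proof.
move=> kk; rewrite /level /excess ge_max le_max lexx /= le_max.
by apply/orP; right; rewrite lerB // ler_wpM2r // ltW.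
Qed.

Lemma level_gap k g s z : 0 < g -> (k + g) * Phi z < tilted psi w s z ->
  g * Phi z <= lev k s z.
Proof.
move=> g0 h; rewrite /level excess_gt; first by move: h; lra.
by apply: lt_trans h; rewrite ltr_pM2r // ltrDl.
Qed.

(** Where the solution exceeds (k+g) Phi, its excess F over k Phi is at least g Phi, so (F / (g
    Phi))^(2 sg) is at least 1. Inserting this factor turns the interpolation inequality at level k
    into a bound for squares at level k+g. *)
Lemma mass_gain k g s : 0 <= k -> 0 < g ->
  mass (k + g) s <= (g `^ (2 * sg))^-1 * A *
    (l2norm2 G (lev k s) `^ sg * (tau * energy G (lev k s) + l2norm2 G (lev k s))).
Proof.
move=> k0 g0; have gp : 0 < g `^ (2 * sg) by rewrite powR_gt0.
have h := interp (level_ge0 psi Phi w k s) (level_supp psi wP Phi_gt0 s k0).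
rewrite -mulrA; apply: le_trans (ler_wpM2l _ h); last by rewrite invr_ge0 ltW.
rewrite mulr_sumr; apply: ler_sum => z _.
rewrite (_ : (g `^ _)^-1 * _ = wweight G z *
  ((g `^ (2 * sg))^-1 * (lev k s z `^ (2 + 2 * sg) / Phi z `^ (2 * sg)))); last by ring.
rewrite ler_wpM2l ?wweight_ge0 //.
have [vl|lv] := leP (tilted psi w s z) ((k + g) * Phi z).
  rewrite /level excess_le // expr0n /=.
  by rewrite mulr_ge0 ?divr_ge0 ?invr_ge0 ?powR_ge0 // ltW.
have Fg := level_gap g0 lv.
have gPhi : 0 < g * Phi z by rewrite mulr_gt0.
have Fp : 0 < lev k s z by exact: lt_le_trans Fg.
apply: (@le_trans _ _ (lev k s z ^+ 2)).
  apply: ler_sqr_base; first exact: level_ge0.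
  by apply: level_anti; rewrite lerDl ltW.
rewrite powR_addr // powR_mulrn ?(ltW Fp) //.
rewrite [leRHS](_ : _ = lev k s z ^+ 2 *
  (lev k s z `^ (2 * sg) / (g `^ (2 * sg) * Phi z `^ (2 * sg)))); last first.
  by rewrite invfM; ring.
rewrite ler_peMr ?sqr_ge0 // -powRM ?(ltW g0) ?(ltW (Phi_gt0 z)) //.
rewrite ler_pdivlMr ?powR_gt0 // mul1r.
by apply: ler_powR_base => //; rewrite ?mulr_ge0 ?(ltW sg0) // ltW.
Qed.

(** Where the higher level is exceeded, the excess over the lower one is at least g Phi, whereas the
    higher level itself is at most Phi because k + g <= 1. *)
Lemma level_ind_le k g s z : 0 <= k -> 0 < g -> k + g <= 1 ->
  level_ind psi Phi w (k + g) s z <= (g ^+ 2)^-1 * lev k s z ^+ 2.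
Proof.
move=> k0 g0 kg1; rewrite /level_ind /on_excess; case: ifPn => [lv|_]; last first.
  by rewrite mulr_ge0 ?sqr_ge0 // invr_ge0 sqr_ge0.
rewrite [leRHS]mulrC ler_pdivlMr ?exprn_gt0 // -exprMn; apply: ler_sqr_base.
  by rewrite mulr_ge0 ?(ltW g0) // mulr_ge0 ?addr_ge0 ?(ltW g0) // ltW.
apply: le_trans (level_gap g0 lv); rewrite [leLHS]mulrC ler_pM2l //.
by rewrite ler_piMl // ltW.
Qed.

Lemma l2_le_mass k s : l2norm2 G (lev k s) <= mass k s.
Proof. by apply: ler_sum => z _; rewrite ler_wpM2r ?sqr_ge0 ?wtheta_le_weight. Qed.

Definition step_rate (g : R) : R := (4 * K * H + 4 * e) * (1 + (g ^+ 2)^-1).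

Lemma step_rate_ge0 g : 0 <= step_rate g.
Proof.
rewrite mulr_ge0 //; last by rewrite addr_ge0 // invr_ge0 sqr_ge0.
by rewrite addr_ge0 ?mulr_ge0 // (le_trans _ K1).
Qed.

Lemma dissipation_step k g s : 0 <= k -> 0 < g -> k + g <= 1 ->
  level_dissipation G psi Phi w (k + g) s
    <= - 2^-1 * energy G (lev (k + g) s) + step_rate g * mass k s.
Proof.
move=> k0 g0 kg1; have kg0 : 0 <= k + g by rewrite addr_ge0 // ltW.
apply: (le_trans (level_dissipation_le wP K1 Phi_gt0 Phi_cmp Phi_lip psi_lip e0 s kg0)).
have gi : 0 <= (g ^+ 2)^-1 by rewrite invr_ge0 sqr_ge0.
have S1 : \sum_z wtheta G z * (lev (k + g) s z ^+ 2 + level_ind psi Phi w (k + g) s z)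
   <= (1 + (g ^+ 2)^-1) * mass k s.
  rewrite mulr_sumr; apply: ler_sum => z _; rewrite mulrCA ler_pM ?wtheta_le_weight //.
  - by rewrite ltW ?wtheta_gt0.
  - by rewrite addr_ge0 ?sqr_ge0 ?level_ind_ge0.
  rewrite mulrDl mul1r lerD ?level_ind_le //.
  by apply: ler_sqr_base; rewrite ?level_ge0 // level_anti // lerDl ltW.
have S2 : \sum_z wweight G z * level_ind psi Phi w (k + g) s z
   <= (1 + (g ^+ 2)^-1) * mass k s.
  rewrite mulr_sumr; apply: ler_sum => z _; rewrite mulrCA ler_wpM2l ?wweight_ge0 //.
  apply: (le_trans (level_ind_le s z k0 g0 kg1)).
  by rewrite mulrDl mul1r lerDr sqr_ge0.
have KH : 0 <= 4 * K * H by rewrite !mulr_ge0 // (le_trans _ K1).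
have e4 : 0 <= 4 * e by rewrite mulr_ge0.
have := ler_wpM2l KH S1; have := ler_wpM2l e4 S2; rewrite /step_rate.
by move: (mass k s) => m; lra.
Qed.

(* P and P2 are antiderivatives in time, so that their increments stand for the
   time integrals of the mass. *)
Lemma degiorgi_step k g t h P P2 : 0 <= k -> 0 < g -> k + g + g <= 1 ->
  0 <= t -> 0 < h -> t + h <= tau ->
  (forall s, 0 <= s <= tau -> is_derive s 1 P (mass k s)) ->
  (forall s, 0 <= s <= tau -> is_derive s 1 P2 (mass (k + g + g) s)) ->
  forall c Y, c = h^-1 + step_rate g -> Y = P tau - P t ->
  P2 tau - P2 (t + h) <=
    (g `^ (2 * sg))^-1 * A * ((c * Y) `^ sg * (tau * (2 * (c * Y)) + Y)).
Proof.
move=> k0 g0 kg1 t0 h0 th dP dP2 c Y cE YE.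
have kg0 : 0 <= k + g by rewrite addr_ge0 // ltW.
have kg1' : k + g <= 1 by lra.
have c0 : 0 <= c by rewrite cE addr_ge0 ?step_rate_ge0 // invr_ge0 ltW.
have dX s := level_l2_derive psi Phi wP (k + g) s.
set X := fun s => l2norm2 G (lev (k + g) s).
have X0 s : 0 <= X s by exact: l2norm2_ge0.
have Xm s : X s <= mass k s.
  apply: (le_trans (l2_le_mass _ _)); apply: ler_sum => z _.
  rewrite ler_wpM2l ?wweight_ge0 //; apply: ler_sqr_base; first exact: level_ge0.
  by apply: level_anti; rewrite lerDl ltW.
(* The level is raised twice: from k to k+g, where the indicator terms of the dissipation are paid
   for by the mass at k, and from k+g to k+2g, where integrability is gained. *)
have D s := dissipation_step s k0 g0 kg1'.
have E0 s : 0 <= energy G (lev (k + g) s) by exact: energy_ge0.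
have Pmono a b : 0 <= a -> a <= b -> b <= tau -> P a <= P b.
  move=> a0 ab bt; apply: (@nondecreasing_of_derive R P (mass k)) => // s.
    by move=> /andP[as_ sb]; apply: dP; rewrite (le_trans a0) //= (le_trans sb).
  by move=> _; exact: mass_ge0.
have Y0 : 0 <= Y by rewrite YE subr_ge0 Pmono //; lra.
(* The ramp (s - t)/h vanishes at t and equals 1 at t + h, so that no information at time t is
   needed; its derivative accounts for the summand 1/h of c. *)
have step1 : X (t + h) <= c * (P (t + h) - P t).
  have := @increment_le R (fun s => h^-1 * (s - t) * X s)
    (fun s => h^-1 * X s + h^-1 * (s - t) * level_dissipation G psi Phi w (k + g) s)
    (fun s => c * P s) (fun s => c * mass k s) t (t + h).
  rewrite subrr mulr0 mul0r subr0 addrAC subrr add0r mulVf ?gt_eqF // mul1r -mulrBr; apply.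
  - by rewrite lerDl ltW.
  - move=> s _; have h1 := dX s.
    have h2 : is_derive s 1 (fun s : R => h^-1 * (s - t)) h^-1.
      apply: is_derive_eq; rewrite /GRing.scale /=; ring.
    exact: is_derive_mul.
  - move=> s /andP[ts sh]; have s01 : 0 <= s <= tau by lra.
    exact: is_derive_scale (dP s s01).
  - move=> s /andP[ts sh]; rewrite cE mulrDl lerD //.
      by rewrite ler_wpM2l // invr_ge0 ltW.
    have z1 : 0 <= h^-1 * (s - t) by rewrite mulr_ge0 ?subr_ge0 // invr_ge0 ltW.
    have z2 : h^-1 * (s - t) <= 1 by rewrite mulrC ler_pdivrMr // mul1r; lra.
    apply: (le_trans (ler_wpM2l z1 (D s))).
    have m0 := mulr_ge0 (step_rate_ge0 g) (mass_ge0 k s).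
    apply: (@le_trans _ _ (h^-1 * (s - t) * (step_rate g * mass k s))).
      by rewrite ler_wpM2l //; move: (E0 s); lra.
    by rewrite ler_piMl.
have [Q dQ] := exists_antiderivative (@level_energy_continuous _ _ G psi Phi w wP (k + g)) tau0.
have step2 s : t + h <= s <= tau -> X s + 2^-1 * (Q s - Q (t + h)) <= c * Y.
  move=> /andP[ths st].
  have hh : (X s + 2^-1 * Q s) - (X (t + h) + 2^-1 * Q (t + h)) <= c * P s - c * P (t + h).
    apply: (@increment_le R (fun s => X s + 2^-1 * Q s)
      (fun s => level_dissipation G psi Phi w (k + g) s + 2^-1 * energy G (lev (k + g) s))
      (fun s => c * P s) (fun s => c * mass k s) (t + h) s ths).
  - move=> u /andP[hu us]; have u01 : 0 <= u <= tau by lra.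
    exact: is_derive_add (dX u) (is_derive_scale _ (dQ u u01)).
  - move=> u /andP[hu us]; have u01 : 0 <= u <= tau by lra.
    exact: is_derive_scale (dP u u01).
  - move=> u _; have := D u.
    have : 0 <= h^-1 * mass k u by rewrite mulr_ge0 ?mass_ge0 // invr_ge0 ltW.
    by rewrite cE mulrDl; lra.
  have Ps : P s <= P tau by apply: Pmono => //; lra.
  have := ler_wpM2l c0 (lerB Ps (lexx (P t))); move: hh step1; rewrite YE.
  by move: (X s) (X (t + h)) => a b; lra.
have Qmono a b : t + h <= a -> a <= b -> b <= tau -> Q a <= Q b.
  move=> a0 ab bt; apply: (@nondecreasing_of_derive R Q (fun s => energy G (lev (k + g) s))) => // s.
  by move=> /andP[as_ sb]; apply: dQ; lra.
have XY s : t + h <= s <= tau -> X s <= c * Y.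
  move=> /andP[s1 s2]; have := step2 s; rewrite s1 s2 => /(_ isT).
  by have := Qmono (t + h) s (lexx _) s1 s2; lra.
have QY : Q tau - Q (t + h) <= 2 * (c * Y).
  by have := step2 tau; rewrite th lexx => /(_ isT); move: (X0 tau); lra.
set B := (g `^ (2 * sg))^-1 * A * (c * Y) `^ sg.
have B0 : 0 <= B by rewrite mulr_ge0 ?powR_ge0 // mulr_ge0 // invr_ge0 powR_ge0.
(* The factor X^sg of [mass_gain] is replaced by its bound (c Y)^sg, uniform in time; the remaining
   integrand is linear in energy and mass. *)
have hh : P2 tau - P2 (t + h) <= B * (tau * Q tau + P tau) - B * (tau * Q (t + h) + P (t + h)).
apply: (@increment_le R P2 (mass (k + g + g)) (fun s => B * (tau * Q s + P s))
   (fun s => B * (tau * energy G (lev (k + g) s) + mass k s)) (t + h) tau th).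
- by move=> u /andP[hu us]; apply: dP2; lra.
- move=> u /andP[hu us]; have u01 : 0 <= u <= tau by lra.
  exact: is_derive_scale (is_derive_add (is_derive_scale _ (dQ u u01)) (dP u u01)).
- move=> u hu; apply: (le_trans (mass_gain u kg0 g0)).
  rewrite /B -!mulrA; rewrite ler_wpM2l ?invr_ge0 ?powR_ge0 // ler_wpM2l //.
  apply: ler_pM; rewrite ?powR_ge0 //.
  + by rewrite addr_ge0 ?mulr_ge0 ?(ltW tau0) ?energy_ge0 ?l2norm2_ge0.
  + by apply: ler_powR_base; [exact: ltW|exact: X0|exact: XY].
  + by rewrite lerD2l; exact: Xm.
apply: (le_trans hh); rewrite -mulrBr [leRHS]mulrA -/B ler_wpM2l //.
have Pth : P t <= P (t + h) by apply: Pmono => //; rewrite lerDl ltW.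
by have := ler_wpM2l (ltW tau0) QY; rewrite YE; lra.
Qed.

(** At level 0 nothing is truncated, so the indicator terms vanish and only the tilt error, of rate
    4 K H, remains: Gronwall's inequality then starts from the initial L^2 norm, at the price of a
    factor exponential in H tau. *)
Lemma degiorgi_base g P N t : 0 < g -> 0 <= t <= tau ->
  (forall s, 0 <= s <= tau -> is_derive s 1 P (mass g s)) ->
  l2norm2 G (tilted psi w 0) <= N ->
  P tau - P t <= (g `^ (2 * sg))^-1 * A *
    (3 * tau * (expR (4 * K * H * tau) * N) `^ (1 + sg)).
Proof.
move=> g0 /andP[t0 tt] dP hN.
have [l lE] : exists l, l = 4 * K * H by eexists.
rewrite -lE; have [N' N'E] : exists x, x = expR (l * tau) * N by eexists.
rewrite -N'E; have l0 : 0 <= l by rewrite lE !mulr_ge0 // (le_trans _ K1).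
have lev0 s z : 0 <= s -> lev 0 s z = tilted psi w s z.
  move=> s0; rewrite /level /excess mul0r subr0 (max_idPr _) //.
  by rewrite mulr_ge0 ?expR_ge0 // (killed_ge0 wP).
set X := fun s => l2norm2 G (lev 0 s).
have X0 s : 0 <= X s by exact: l2norm2_ge0.
have XN : X 0 <= N.
  by apply: le_trans hN; apply: eq_ler; apply: eq_bigr => z _; rewrite lev0.
have N0 : 0 <= N by exact: le_trans XN.
have dX s := level_l2_derive psi Phi wP 0 s.
have D s : level_dissipation G psi Phi w 0 s <= - 2^-1 * energy G (lev 0 s) + l * X s.
  rewrite lE; apply: (le_trans (level_dissipation_le wP K1 Phi_gt0 Phi_cmp Phi_lip psi_lip e0 s (lexx 0))).
  have i0 z : level_ind psi Phi w 0 s z = 0.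
    by rewrite /level_ind /on_excess mul0r expr0n /= if_same.
  rewrite [X in _ + _ + _ * X]big1 => [|z _]; last by rewrite i0 mulr0.
  rewrite mulr0 addr0 lerD2l; apply: eq_ler; congr (_ * _).
  by apply: eq_bigr => z _; rewrite i0 addr0.
have [Q dQ] := exists_antiderivative (@level_energy_continuous _ _ G psi Phi w wP 0) tau0.
have E0 s : 0 <= energy G (lev 0 s) by exact: energy_ge0.
have Qmono s : 0 <= s <= tau -> Q 0 <= Q s.
  move=> /andP[s0 st]; apply: (@nondecreasing_of_derive R Q (fun s => energy G (lev 0 s))) => // u.
  by move=> /andP[u0 us]; apply: dQ; rewrite u0 (le_trans us).
(* The accumulated energy gets the constant factor exp(- l tau), smaller than exp(- l s) for s <=
   tau, so that an antiderivative of the bare energy suffices. *)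
have key s : 0 <= s <= tau ->
    expR (- l * s) * X s + 2^-1 * expR (- l * tau) * (Q s - Q 0) <= N.
  move=> /andP[s0 st]; apply: le_trans XN.
  have := @increment_le R (fun u => expR (- l * u) * X u + 2^-1 * expR (- l * tau) * Q u)
    (fun u => ((- l * expR (- l * u)) * X u + expR (- l * u) * level_dissipation G psi Phi w 0 u)
       + 2^-1 * expR (- l * tau) * energy G (lev 0 u)) (fun=> 0) (fun=> 0) 0 s s0.
  rewrite mulr0 expR0 mul1r subrr => hh.
  suff : expR (- l * s) * X s + 2^-1 * expR (- l * tau) * Q s -
       (X 0 + 2^-1 * expR (- l * tau) * Q 0) <= 0 by lra.
  apply: hh.
  - move=> u /andP[u0 us]; have u01 : 0 <= u <= tau by rewrite u0 (le_trans us).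
    apply: is_derive_add; last exact: is_derive_scale (dQ u u01).
    have h1 : is_derive u 1 (fun u : R => - l * u) (- l).
      by have := is_derive_scale (- l) (is_derive_id u (1 : R)); rewrite mulr1.
    have h2 := @is_derive1_comp R expR _ u _ _ (is_derive_expR (- l * u)) h1.
    have h3 := is_derive_mul h2 (dX u).
    apply: (is_derive_eq h3); rewrite /= /X; ring.
  - move=> u /andP[u0 us]; have el : expR (- l * tau) <= expR (- l * u).
      by rewrite ler_expR !mulNr lerN2 ler_wpM2l //; exact: le_trans st.
    have e1 := ler_wpM2l (expR_ge0 (- l * u)) (D u).
    have e2 := ler_wpM2r (E0 u) el.
    move: e1 e2; move: (expR (- l * u)) (expR (- l * tau)) (energy _ _) (X u) => a b c x.
    by lra.
have XN' s : 0 <= s <= tau -> X s <= N'.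
  move=> /andP[s0 st].
  have h1 := key s; rewrite s0 st in h1.
  have h2 := Qmono s; rewrite s0 st in h2.
  have h3 : expR (- l * s) * X s <= N.
    apply: le_trans (h1 isT); rewrite lerDl; apply: mulr_ge0.
      by rewrite mulr_ge0 ?expR_ge0.
    by rewrite subr_ge0; exact: h2.
  have h4 := ler_wpM2l (expR_ge0 (l * s)) h3.
  rewrite mulrA mulNr expRxMexpNx_1 mul1r in h4.
  apply: (le_trans h4); rewrite N'E ler_wpM2r // ler_expR ler_wpM2l //.
have QN : Q tau - Q 0 <= 2 * N'.
  have h1 := key tau; rewrite (ltW tau0) lexx in h1.
  have h3 : expR (- l * tau) * (2^-1 * (Q tau - Q 0)) <= N.
    apply: le_trans (h1 isT); rewrite mulrCA mulrA lerDr.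
    by rewrite mulr_ge0 ?expR_ge0.
  have h4 := ler_wpM2l (expR_ge0 (l * tau)) h3.
  rewrite mulrA mulNr expRxMexpNx_1 mul1r -N'E in h4; lra.
have N'0 : 0 <= N' by rewrite N'E mulr_ge0 ?expR_ge0.
set B := (g `^ (2 * sg))^-1 * A * N' `^ sg.
have B0 : 0 <= B by rewrite mulr_ge0 ?powR_ge0 // mulr_ge0 // invr_ge0 powR_ge0.
have hh : P tau - P 0 <= B * (tau * Q tau + N' * tau) - B * (tau * Q 0 + N' * 0).
  apply: (@increment_le R P (mass g) (fun s => B * (tau * Q s + N' * s))
   (fun s => B * (tau * energy G (lev 0 s) + N' * 1)) 0 tau (ltW tau0)).
    move=> s s01; apply: is_derive_scale; apply: is_derive_add.
      exact: is_derive_scale (dQ s s01).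
  move=> u hu; have := mass_gain u (lexx 0) g0; rewrite add0r => /le_trans; apply.
  rewrite /B -!mulrA; rewrite ler_wpM2l ?invr_ge0 ?powR_ge0 // ler_wpM2l //.
  apply: ler_pM; rewrite ?powR_ge0 //.
  + by rewrite addr_ge0 ?mulr_ge0 ?(ltW tau0) ?energy_ge0 ?l2norm2_ge0.
  + by apply: ler_powR_base; [exact: ltW|exact: X0|exact: XN'].
  + by rewrite lerD2l mulr1; exact: XN'.
have Pmono : P 0 <= P t.
  apply: (@nondecreasing_of_derive R P (mass g)) => // s; last by move=> _; exact: mass_ge0.
  by move=> /andP[u0 us]; apply: dP; rewrite u0 (le_trans us).
apply: (le_trans (lerB (lexx _) Pmono)); apply: (le_trans hh).
have -> : N' `^ (1 + sg) = N' `^ sg * N'.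
  have [->|Nn] := eqVneq N' 0; first by rewrite mulr0 powR0 // gt_eqF // addr_gt0.
  by rewrite powR_addr ?lt_def ?Nn // powRr1 // mulrC.
rewrite (_ : _ * (3 * tau * _) = B * (tau * (3 * N'))); last by rewrite /B; ring.
rewrite -mulrBr ler_wpM2l // mulr0 addr0.
by have := ler_wpM2l (ltW tau0) QN; lra.
Qed.

End DeGiorgiStep.

(** * Convergence of the De Giorgi iteration *)

Section LocalBoundedness.
Context {R : realType}.

(** The ratio [kap / tau] expresses that Phi varies on the spatial scale sqrt tau, so that the level
    errors accumulated over a time tau stay bounded. *)
Record degiorgi_setting {I : finType} (G : weighted_graph R I) (psi Phi : I -> R)
    (w : R -> I -> R) (H K kap A sg tau : R) : Prop := DeGiorgiSetting {
  dg_solution : killed_solution G w;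
  dg_Phi_gt0 : forall y, 0 < Phi y;
  dg_Phi_cmp : forall y z, 0 < wc G y z -> Phi y ^+ 2 <= K * Phi z ^+ 2;
  dg_Phi_lip : forall y z, 0 < wc G y z ->
    (Phi y - Phi z) ^+ 2 <= kap / tau * Phi z ^+ 2;
  dg_psi_lip : forall z,
    \sum_y wc G z y * tilt (psi y - psi z) <= H * wtheta G z;
  dg_H_ge0 : 0 <= H;
  dg_A_ge0 : 0 <= A;
  dg_tau_gt0 : 0 < tau;
  dg_interp : forall f : I -> R, (forall y, 0 <= f y) -> supported G f ->
    \sum_y wweight G y * f y `^ (2 + 2 * sg) / Phi y `^ (2 * sg)
      <= A * (l2norm2 G f `^ sg * (tau * energy G f + l2norm2 G f)) }.

Lemma inv_powR_double (x r : R) : 0 < x -> (x `^ (2 * r))^-1 = ((x ^+ 2)^-1) `^ r.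
Proof.
move=> x0; rewrite powRrM (powR_mulrn 2) ?(ltW x0) //.
have : 0 < x ^+ 2 by rewrite exprn_gt0.
move: (x ^+ 2) => y y0; rewrite /powR invr_eq0 (gt_eqF y0) -expRN.
by rewrite lnV ?posrE // mulrN.
Qed.

Lemma powR_1D (x r : R) : 0 <= x -> 0 <= r -> x `^ (1 + r) = x * x `^ r.
Proof.
move=> x0 r0; have [->|xn] := eqVneq x 0.
  by rewrite mul0r powR0 // gt_eqF // ltr_pwDl.
by rewrite powR_addr ?lt_def ?xn // powRr1.
Qed.

Lemma exprn_powR (x r : R) n : 0 <= x -> (x ^+ n) `^ r = (x `^ r) ^+ n.
Proof.
by move=> x0; rewrite -powR_mulrn // powRAC powR_mulrn // powR_ge0.
Qed.

Lemma powR_invr (x r : R) : 0 <= x -> x^-1 `^ r = (x `^ r)^-1.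
Proof.
move=> x0; rewrite -(powR_inv1 x0) -(powR_inv1 (powR_ge0 x r)).
exact: powRAC.
Qed.

Lemma tripled_bound (u a b y : R) : 0 <= u -> a <= b -> y <= u * a ->
  u * (2 * a) + y <= 3 * u * b.
Proof. by move=> u0 /(ler_wpM2l u0); lra. Qed.

Lemma step_rate_bound (K kap a g : R) : 0 <= K -> 0 <= kap -> 0 <= a -> 0 < g <= 1 ->
  g^-1 + (4 * K * a + 4 * kap) * (1 + (g ^+ 2)^-1)
    <= (1 + 2 * (4 * K + 4 * kap)) * (g ^+ 2)^-1 * (1 + a).
Proof.
move=> K0 kap0 a0 /andP[g0 g1].
have q1 : 1 <= (g ^+ 2)^-1 by rewrite invf_ge1 ?exprn_gt0 // exprn_ile1 // ltW.
have gq : g^-1 <= (g ^+ 2)^-1.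
  by rewrite lef_pV2 ?posrE ?exprn_gt0 // expr2 ler_piMl // ltW.
move: (g^-1) (g ^+ 2)^-1 q1 gq => u q q1 uq.
have q0 : 0 <= q by exact: le_trans q1.
have h1 := mulr_ge0 q0 a0; have h2 := mulr_ge0 kap0 a0; have h3 := mulr_ge0 K0 a0.
have h4 : 0 <= (q - 1) * (K * a) by rewrite mulr_ge0 ?subr_ge0.
have h5 : 0 <= (q - 1) * kap by rewrite mulr_ge0 ?subr_ge0.
have h6 := mulr_ge0 q0 h2; have h7 := mulr_ge0 q0 K0.
clear g0 g1 a0 kap0 K0 q0.
lra.
Qed.

(** If the solution exceeded Phi somewhere at time tau, continuity in time would keep the mass above
    a positive constant on a short interval ending at tau, and the increment of P would be
    positive. *)
Lemma mass_eq0_bound {I : finType} (G : weighted_graph R I) (psi Phi : I -> R)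
    (w : R -> I -> R) (tau : R) (P : R -> R) :
  killed_solution G w -> 0 < tau ->
  (forall s, 0 <= s <= tau -> is_derive s 1 P (mass G psi Phi w 1 s)) ->
  P tau - P (tau / 2) <= 0 -> forall y, tilted psi w tau y <= Phi y.
Proof.
move=> wP tau0 dP PY y; rewrite leNgt; apply/negP => hlt.
have ex0 : 0 < excess (tilted psi w tau y) (1 * Phi y).
  by rewrite mul1r excess_gt // subr_gt0.
pose f s := wtheta G y * level psi Phi w 1 s y ^+ 2.
have f0 : 0 < f tau by rewrite mulr_gt0 ?wtheta_gt0 // exprn_gt0.
have cf : {for tau, continuous f}.
  apply: (@continuousM R R (fun=> wtheta G y) (fun s => level psi Phi w 1 s y ^+ 2)).
    exact: cst_continuous.
  exact: (continuousM (level_continuous wP (x := tau)) (level_continuous wP (x := tau))).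
have f2 : 0 < f tau / 2 by rewrite divr_gt0.
have [e /= e0 he] : exists2 e : R, 0 < e & forall s, `|tau - s| < e -> f tau / 2 <= f s.
  have /cvgrPdist_le/(_ _ f2)[e /= e0 he] := cf.
  exists e => // s se; have := he s se; rewrite /= ler_norml => /andP[_]; lra.
pose eps := Num.min (e / 2) (tau / 2).
have eps0 : 0 < eps by rewrite lt_min !divr_gt0.
have eps1 : eps <= e / 2 by rewrite ge_min lexx.
have eps2 : eps <= tau / 2 by rewrite ge_min lexx orbT.
have fmass s : f s <= mass G psi Phi w 1 s.
  rewrite /mass (bigD1 y) //= /f.
  apply: (@le_trans _ _ (wweight G y * level psi Phi w 1 s y ^+ 2)).
    by rewrite ler_wpM2r ?sqr_ge0 ?wtheta_le_weight.
  by rewrite lerDl sumr_ge0 // => z _; rewrite mulr_ge0 ?sqr_ge0 ?wweight_ge0.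
have h1 : P (tau / 2) <= P (tau - eps).
  apply: (@nondecreasing_of_derive R P (mass G psi Phi w 1)); first lra.
    by move=> s /andP[s1 s2]; apply: dP; lra.
  by move=> s _; exact: mass_ge0.
have h2 : f tau / 2 * tau - f tau / 2 * (tau - eps) <= P tau - P (tau - eps).
  apply: (@increment_le R (fun s => f tau / 2 * s) (fun=> f tau / 2 * 1) P
    (mass G psi Phi w 1)); first lra.
  - by move=> s /andP[s1 s2]; apply: dP; lra.
  move=> s /andP[s1 s2]; rewrite mulr1; apply: le_trans (fmass s).
  by apply: he; rewrite ger0_norm; lra.
have := mulr_gt0 f2 eps0; lra.
Qed.

(** The iteration uses levels 1 - 2^(-j) and starting times (tau/2)(1 - 2^(-j)). The mass increments
    Y j satisfy a recursion of the form Y_(j+1) <= const b^j Y_j^(1+sg); a small start then forces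
    decay like be^(-j), where be^sg = b balances the growth of the constants. *)
Lemma local_boundedness (K kap sg : R) : 1 <= K -> 0 <= kap -> 0 < sg ->
  exists del C : R, [/\ 0 < del, 0 < C &
    forall (I : finType) (G : weighted_graph R I) (psi Phi : I -> R)
      (w : R -> I -> R) (H A tau N : R),
    degiorgi_setting G psi Phi w H K kap A sg tau ->
    0 < N -> l2norm2 G (tilted psi w 0) <= N ->
    A * (expR (C * H * tau) * N) `^ sg <= del ->
    forall y, tilted psi w tau y <= Phi y].
Proof.
move=> K1 kap0 sg0.
have K0 : 0 <= K by exact: le_trans K1.
pose C1 : R := 1 + 2 * (4 * K + 4 * kap).
pose C3 : R := 3 * 16 `^ sg.
(* Halving the gap g multiplies g^(-2) by 4; this quantity enters with the power sg through
   [mass_gain] and with the power 1 + sg through the rate c. *)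
pose b : R := 4 `^ (1 + 2 * sg).
pose be := b `^ sg^-1.
pose C2 := 3 * b ^+ 2 * C1 `^ (1 + sg).
have C10 : 0 < C1 by rewrite ltr_pwDl // mulr_ge0 // addr_ge0 // mulr_ge0.
have C30 : 0 < C3 by rewrite mulr_gt0 // powR_gt0.
have b0 : 0 < b by rewrite powR_gt0.
have C20 : 0 < C2 by rewrite mulr_gt0 ?powR_gt0 // mulr_gt0 // exprn_gt0.
have b1 : 1 < b.
  have h : 0 <= 2 * sg by rewrite mulr_ge0 // ltW.
  have h4 : 1 <= 4 :> R by lra.
  have := ler_powR_base h ler01 h4; rewrite powR1 /b powR_1D //; lra.
have be0 : 0 < be by rewrite powR_gt0.
have bes : be `^ sg = b by rewrite /be -powRrM mulVf ?gt_eqF // powRr1 // ltW.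
have be1 : 1 < be.
  rewrite ltNge; apply/negP => h; have := ler_powR_base (ltW sg0) (ltW be0) h.
  by rewrite bes powR1 leNgt b1.
exists ((C2 + C3) * be)^-1, (4 * K + (1 + sg) / sg); split.
- by rewrite invr_gt0 mulr_gt0 // addr_gt0.
- by rewrite ltr_wpDl ?mulr_ge0 // divr_gt0 // addr_gt0.
move=> I G psi Phi w H A tau N [wP Phi0 Phic Phil psil H0 A0 tau0 interp] N0 hN hA.
have e0 : 0 <= kap / tau by rewrite divr_ge0 // ltW.
pose k j : R := 1 - 2^-1 ^+ j.
pose t j : R := tau / 2 * (1 - 2^-1 ^+ j).
have hpow j : 0 < (2^-1 : R) ^+ j by rewrite exprn_gt0 // invr_gt0.
have hpow1 j : (2^-1 : R) ^+ j <= 1.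
  by rewrite exprn_ile1 // ?invr_ge0 // invf_le1 // ler1n.
have k0 j : 0 <= k j by rewrite /k subr_ge0.
have t0 j : 0 <= t j <= tau.
  rewrite /t mulr_ge0 ?divr_ge0 ?subr_ge0 ?(ltW tau0) //=.
  apply: (@le_trans _ _ (tau / 2)); last lra.
  by rewrite ler_piMr ?divr_ge0 ?(ltW tau0) // gerBl ltW.
have [P dP] : exists P : nat -> R -> R, forall j s, 0 <= s <= tau ->
    is_derive s 1 (P j) (mass G psi Phi w (k j) s).
  have [P dP] := choice (fun j => exists_antiderivative
    (@mass_continuous _ _ G psi Phi w wP (k j)) tau0).
  by exists P.
pose Y j := P j tau - P j (t j).
pose G1 := 1 + H * tau.
pose N' := expR (4 * K * H * tau) * N.
have Ht0 : 0 <= H * tau by rewrite mulr_ge0 // ltW.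
have G10 : 0 < G1 by rewrite ltr_pwDl.
have N'0 : 0 < N' by rewrite mulr_gt0 // expR_gt0.
(* The polynomial factor [G1] is at most exp(H tau). Its power 1 + sg has to be moved inside a power
   sg, whence the summand (1 + sg)/sg in the constant of the exponential. *)
have small : A * N' `^ sg * G1 `^ (1 + sg) <= ((C2 + C3) * be)^-1.
  apply: le_trans hA; rewrite -mulrA ler_wpM2l //.
  apply: (@le_trans _ _ (N' `^ sg * expR (H * tau) `^ (1 + sg))).
    rewrite ler_wpM2l ?powR_ge0 //; apply: ler_powR_base => //.
    - by rewrite addr_ge0 // ltW.
    - exact: ltW.
    - exact: expR_ge1Dx.
  rewrite /N' !powRM ?expR_ge0 ?(ltW N0) // -!expRM mulrAC -expRD.
  rewrite ler_wpM2r ?powR_ge0 // ler_expR.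
  by apply: eq_ler; field; rewrite gt_eqF.
have small' : A * N' `^ sg <= ((C2 + C3) * be)^-1.
  apply: le_trans small; rewrite ler_peMr ?mulr_ge0 ?powR_ge0 //.
  have h : 0 <= 1 + sg by rewrite addr_ge0 // ltW.
  by have := ler_powR_base h ler01 (_ : 1 <= G1); rewrite powR1 lerDl; apply.
(* The iteration starts at j = 1: the level [k 0] is 0, and [degiorgi_base] raises it by the gap
   1/2. *)
have base : Y 1%N <= tau * N' * be^-1 ^+ 1.
  have g0 : 0 < 2^-1 :> R by rewrite invr_gt0.
  have kE : k 1%N = 2^-1 by rewrite /k expr1; field.
  have := degiorgi_base wP K1 Phi0 Phic Phil psil e0 H0 A0 sg0 tau0 interp g0 (t0 1%N)
    (P := P 1%N) _ hN.
  rewrite -kE => /(_ (dP 1%N)) h; apply: (le_trans h).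
  rewrite kE -/N' expr1.
  rewrite inv_powR_double // (_ : (2^-1 ^+ 2)^-1 = 4 :> R); last by field.
  have -> : N' `^ (1 + sg) = N' `^ sg * N' by rewrite powR_addr // powRr1 ?(ltW N'0) // mulrC.
  have h4 : 4 `^ sg <= 16 `^ sg :> R by apply: ler_powR_base; [exact: ltW|exact: ler0n|rewrite ler_nat].
  have C3s : C3 * (A * N' `^ sg) <= be^-1.
    apply: (le_trans (ler_wpM2l (ltW C30) small')).
    rewrite invfM mulrA ler_piMl ?invr_ge0 ?(ltW be0) //.
    by rewrite ler_pdivrMr ?mul1r ?lerDr ?(ltW C20) // addr_gt0.
  rewrite (_ : _ * (3 * tau * _) = tau * N' * (3 * 4 `^ sg * (A * N' `^ sg))); last by ring.
  have TN0 : 0 <= tau * N' by rewrite ltW // mulr_gt0.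
  rewrite ler_wpM2l //.
  apply: le_trans C3s; rewrite ler_wpM2r ?mulr_ge0 ?powR_ge0 //.
  by rewrite ler_wpM2l.
have step j : Y j.+1 <= tau * N' * be^-1 ^+ j.+1 -> Y j.+2 <= tau * N' * be^-1 ^+ j.+2.
  (* Half of the gap between consecutive levels, since [degiorgi_step] raises the level twice; h =
     tau g is then exactly the gap between consecutive times. *)
  move=> IH; set g : R := 2^-1 ^+ j.+3; set h := tau * g.
  have g0 : 0 < g by exact: hpow.
  have gE : 2^-1 ^+ j.+1 = 4 * g by rewrite /g (exprS _ j.+2) (exprS _ j.+1); field.
  have gE' : 2^-1 ^+ j.+2 = 2 * g by rewrite /g (exprS _ j.+2); field.
  have h0 : 0 < h by rewrite mulr_gt0.
  have kE : k j.+1 + g + g = k j.+2 by rewrite /k gE gE'; ring.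
  have tE : t j.+1 + h = t j.+2 by rewrite /t /h gE gE'; field.
  have k1 : k j.+1 + g + g <= 1 by rewrite kE /k gerBl ltW.
  have /andP[t1 _] := t0 j.+1; have /andP[_ t2] := t0 j.+2.
  have := degiorgi_step wP K1 Phi0 Phic Phil psil e0 H0 A0 sg0 tau0 interp
    (k0 j.+1) g0 k1 t1 h0 (P := P j.+1) (P2 := P j.+2).
  rewrite tE kE => /(_ t2 (dP j.+1) (dP j.+2) _ _ erefl erefl).
  rewrite -/(Y j.+1) -/(Y j.+2).
  set c := h^-1 + _.
  pose q : R := (g ^+ 2)^-1.
  have q0 : 0 < q by rewrite invr_gt0 exprn_gt0.
  have g1 : g <= 1 by exact: hpow1.
  have q1 : 1 <= q by rewrite invf_ge1 ?exprn_gt0 // exprn_ile1 // ltW.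
  have tc : tau * c <= C1 * q * G1.
    have -> : tau * c = g^-1 + (4 * K * (H * tau) + 4 * kap) * (1 + q).
      rewrite /c /step_rate /h -/q; field.
      by rewrite !gt_eqF.
    by apply: step_rate_bound; rewrite ?g0.
  have Y0 : 0 <= Y j.+1.
    rewrite subr_ge0; have /andP[t1' t2'] := t0 j.+1.
    apply: (@nondecreasing_of_derive R (P j.+1) (mass G psi Phi w (k j.+1))) => //.
      by move=> s /andP[s1 s2]; apply: dP; rewrite (le_trans t1').
    by move=> s _; exact: mass_ge0.
  have c0 : 0 <= c.
    by rewrite addr_ge0 ?invr_ge0 ?(ltW h0) //; exact: step_rate_ge0.
  set x := be^-1 ^+ j.+1 in IH.
  have x0 : 0 < x by rewrite exprn_gt0 // invr_gt0.
  pose U := C1 * q * G1 * N' * x.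
  have U0 : 0 <= U by rewrite !mulr_ge0 // ltW.
  have cYU : c * Y j.+1 <= U.
    apply: (le_trans (ler_wpM2l c0 IH)).
    rewrite [leLHS](_ : _ = tau * c * (N' * x)); last by ring.
    by rewrite /U -[leRHS]mulrA ler_wpM2r // mulr_ge0 ?(ltW N'0) ?(ltW x0).
  have Yc : Y j.+1 <= tau * (c * Y j.+1).
    rewrite mulrA ler_peMl //.
    have -> : tau * c = g^-1 + tau * step_rate H K (kap / tau) g.
      by rewrite /c /h; field; rewrite !gt_eqF.
    apply: (@le_trans _ _ g^-1); first by rewrite invf_ge1.
    by rewrite lerDl mulr_ge0 ?(ltW tau0) //; exact: step_rate_ge0.
  move=> hY; apply: (le_trans hY).
  rewrite inv_powR_double // -/q.
  have cY0 : 0 <= c * Y j.+1 by rewrite mulr_ge0.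
  apply: (@le_trans _ _ (q `^ sg * A * (3 * tau * U `^ (1 + sg)))).
    rewrite ler_wpM2l ?mulr_ge0 ?powR_ge0 // powR_1D // ?(ltW sg0) //.
    rewrite mulrC (_ : 3 * tau * (U * U `^ sg) = (3 * tau * U) * U `^ sg); last by ring.
    apply: ler_pM; rewrite ?powR_ge0 //.
    - by rewrite addr_ge0 // mulr_ge0 ?(ltW tau0) // mulr_ge0.
    - exact: (tripled_bound (ltW tau0) cYU Yc).
    - by apply: ler_powR_base => //; exact: ltW.
  (* The growth in j of the power of q is cancelled exactly by the decay of x^sg; the remaining b^2
     is a factor of [C2]. *)
  have qx : q `^ (1 + 2 * sg) * x `^ sg = b ^+ 2.
    have -> : q = 4 ^+ j.+3.
      rewrite /q /g -exprM mulnC exprM -exprVn; by congr (_ ^+ _); field.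
    rewrite /x !exprn_powR ?invr_ge0 ?(ltW be0) // -/b.
    have -> : be^-1 `^ sg = b^-1.
      by rewrite powR_invr ?bes // ltW.
    have -> : b ^+ j.+3 = b ^+ 2 * b ^+ j.+1 by rewrite -exprD.
    by rewrite -mulrA -exprMn divff ?gt_eqF // expr1n mulr1.
  have -> : q `^ sg * A * (3 * tau * U `^ (1 + sg)) =
     tau * N' * x * (C2 * (A * N' `^ sg * G1 `^ (1 + sg))).
    have u1 : 0 <= C1 * q by rewrite mulr_ge0 // ltW.
    have u2 : 0 <= C1 * q * G1 by rewrite mulr_ge0 // ltW.
    have u3 : 0 <= C1 * q * G1 * N' by rewrite mulr_ge0 // ltW.
    rewrite /U (powRM _ u3 (ltW x0)) (powRM _ u2 (ltW N'0)) (powRM _ u1 (ltW G10)).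
    rewrite (powRM _ (ltW C10) (ltW q0)).
    rewrite (powR_1D (ltW N'0) (ltW sg0)) (powR_1D (ltW x0) (ltW sg0)) /C2 -qx.
    have -> : q `^ (1 + 2 * sg) = q `^ sg * q `^ (1 + sg).
      by rewrite -powR_addr //; congr (_ `^ _); ring.
    move: (q `^ sg) (q `^ (1 + sg)) (C1 `^ _) (G1 `^ _) (N' `^ _) (x `^ _) => y1 y2 y3 y4 y5 y6.
    by ring.
  have -> : be^-1 ^+ j.+2 = x * be^-1 by rewrite /x -exprSr.
  have TNx : 0 <= tau * N' * x by apply/ltW/mulr_gt0 => //; exact: mulr_gt0.
  rewrite [leRHS]mulrA ler_wpM2l //.
  apply: (le_trans (ler_wpM2l (ltW C20) small)).
  rewrite invfM mulrA ler_piMl ?invr_ge0 ?(ltW be0) //.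
  by rewrite ler_pdivrMr ?mul1r ?lerDl ?(ltW C30) // addr_gt0.
have all j : Y j.+1 <= tau * N' * be^-1 ^+ j.+1.
  by elim: j => // j; exact: step.
have [Q dQ] := exists_antiderivative (@mass_continuous _ _ G psi Phi w wP 1) tau0.
apply: (mass_eq0_bound wP tau0 dQ).
have half_ge0 : 0 <= tau / 2 by rewrite divr_ge0 // ltW.
have half_le : tau / 2 <= tau by rewrite ler_pdivrMr // ler_peMr ?(ltW tau0) // ler1n.
(* Level 1 and the time interval [tau/2, tau] are dominated by every stage of the iteration, so the
   increment of Q lies below all the Y j.+1. *)
have QY j : Q tau - Q (tau / 2) <= Y j.+1.
  have /andP[t1 t2] := t0 j.+1.
  have tj : t j.+1 <= tau / 2.
    by rewrite /t ler_piMr ?divr_ge0 ?(ltW tau0) // gerBl ltW.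
  apply: (@le_trans _ _ (P j.+1 tau - P j.+1 (tau / 2))).
    apply: (@increment_le R Q (mass G psi Phi w 1) (P j.+1) (mass G psi Phi w (k j.+1))).
    - exact: half_le.
    - by move=> s /andP[s1 s2]; apply: dQ; rewrite s2 (le_trans half_ge0).
    - by move=> s /andP[s1 s2]; apply: dP; rewrite s2 (le_trans half_ge0).
    move=> s _; apply: ler_sum => z _; rewrite ler_wpM2l ?wweight_ge0 //.
    apply: ler_sqr_base; first exact: level_ge0.
    by apply: level_anti => //; rewrite /k gerBl ltW.
  rewrite lerD2l lerN2.
  apply: (@nondecreasing_of_derive R (P j.+1) (mass G psi Phi w (k j.+1))) => //.
    by move=> s /andP[s1 s2]; apply: dP; rewrite (le_trans t1 s1) (le_trans s2 half_le).
  by move=> s _; exact: mass_ge0.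
rewrite leNgt; apply/negP => pos.
have bei : `|be^-1| < 1 by rewrite ger0_norm ?invr_ge0 ?(ltW be0) // invf_lt1.
have TN : 0 < tau * N' by rewrite mulr_gt0.
have := cvg_expr bei => /cvgrPdist_lt /(_ ((Q tau - Q (tau / 2)) / (tau * N'))).
rewrite divr_gt0 // => /(_ isT)[m _ /(_ m.+1)]; rewrite /= leqnSn => /(_ isT).
rewrite sub0r normrN ger0_norm ?exprn_ge0 ?invr_ge0 ?(ltW be0) //.
rewrite ltr_pdivlMr // mulrC ltNge => /negP; apply.
exact: le_trans (QY m) (all m).
Qed.

End LocalBoundedness.

(** * Killed heat flow on a finite graph *)

Section ExpSeries.
Context {R : realType}.

(** Exponential generating function of a. Differentiation shifts the sequence, so with a k = T^k f
    this is the flow exp(x T) f. *)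
Definition exp_gen (a : nat -> R) (x : R) : R :=
  limn (pseries (fun k => a k / k`!%:R) x).

Lemma is_cvg_exp_gen (a : nat -> R) (B x : R) : (forall k, `|a k| <= B) ->
  cvgn (pseries (fun k => a k / k`!%:R) x).
Proof.
move=> aB; apply: normed_cvg.
have B0 : 0 <= B by exact: le_trans (aB 0%N).
apply: (@series_le_cvg R _ (fun k => B * (exp_coeff `|x| k))).
- by move=> k; exact: normr_ge0.
- by move=> k; rewrite mulr_ge0 // /exp_coeff /= divr_ge0 ?exprn_ge0.
- move=> k; rewrite /exp_coeff /= !normrM normrX normfV normr_nat.
  by rewrite -mulrA (mulrC _^-1) ler_wpM2r ?divr_ge0 ?exprn_ge0.
- rewrite (_ : (fun k => _) = B *: exp_coeff `|x|); last by apply/funext.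
  exact: is_cvg_seriesZ (is_cvg_series_exp_coeff `|x|).
Qed.

Lemma exp_gen_diffs (a : nat -> R) :
  pseries_diffs (fun k => a k / k`!%:R) = (fun k => a k.+1 / k`!%:R).
Proof.
apply/funext => k; rewrite /pseries_diffs factS natrM.
have k1 : k.+1%:R != 0 :> R by rewrite pnatr_eq0.
by rewrite invfM mulrCA; congr (_ * _); rewrite mulrA divff // mul1r.
Qed.

Lemma is_derive_exp_gen (a : nat -> R) (B x : R) : (forall k, `|a k| <= B) ->
  is_derive x 1 (exp_gen a) (exp_gen (fun k => a k.+1) x).
Proof.
move=> aB.
have := @pseries_snd_diffs R (fun k => a k / k`!%:R) (`|x| + 1) x.
rewrite !exp_gen_diffs; apply.
- exact: is_cvg_exp_gen aB.
- by apply: (@is_cvg_exp_gen _ B) => k.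
- by apply: (@is_cvg_exp_gen _ B) => k.
- by rewrite [ltRHS]ger0_norm ?addr_ge0 // ltrDl.
Qed.

Lemma exp_gen0 (a : nat -> R) : exp_gen a 0 = a 0%N.
Proof.
apply: lim_near_cst => //; near=> n.
have [m ->] : exists m, n = m.+1.
  by exists n.-1; rewrite prednK //; near: n; exists 1%N.
rewrite /pseries /series /= big_nat_recl // expr0 mulr1 fact0 divr1 big1 ?addr0 //.
by move=> i _; rewrite expr0n mulr0.
Unshelve. all: by end_near.
Qed.

Lemma exp_gen_ge0 (a : nat -> R) (B x : R) : (forall k, 0 <= a k <= B) -> 0 <= x ->
  0 <= exp_gen a x.
Proof.
move=> aB x0; apply: limr_ge.
  by apply: (@is_cvg_exp_gen _ B) => k; have /andP[a0 ?] := aB k; rewrite ger0_norm.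
apply: nearW => n; rewrite /pseries /series /=; apply: sumr_ge0 => k _.
by have /andP[a0 _] := aB k; rewrite mulr_ge0 ?exprn_ge0 // divr_ge0.
Qed.

Lemma exp_gen_lin (J : finType) (m : J -> R) (a : J -> nat -> R) (B x : R) :
  (forall j k, `|a j k| <= B) ->
  exp_gen (fun k => \sum_j m j * a j k) x = \sum_j m j * exp_gen (a j) x.
Proof.
move=> aB; apply: cvg_lim => //.
have -> : pseries (fun k => (\sum_j m j * a j k) / k`!%:R) x =
   (fun n => \sum_j m j * pseries (fun k => a j k / k`!%:R) x n).
  apply/funext => n; rewrite /pseries /series /=.
  under eq_bigr do rewrite !mulr_suml.
  rewrite exchange_big /=; apply: eq_bigr => j _.
  by rewrite mulr_sumr; apply: eq_bigr => k _; rewrite !mulrA.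
elim: (index_enum J) => [|j r IH].
  under eq_cvg do rewrite big_nil.
  by rewrite big_nil; exact: cvg_cst.
under eq_cvg do rewrite big_cons.
rewrite big_cons; apply: cvgD => //.
apply: cvgMl_tmp; exact: (is_cvg_exp_gen (aB j)).
Qed.

(** Uniformisation: the flow is exp(- lam s) times the exponential series of lam s m applied to f.
    All terms are non-negative for s >= 0, so positivity needs no maximum principle, and the
    coefficients are bounded because m is substochastic. The last clause serves killed vertices,
    whose row of m is diagonal. *)
Lemma exists_linear_flow (I : finType) (m : I -> I -> R) (lam : R) (f : I -> R) :
  0 < lam -> (forall z y, 0 <= m z y) -> (forall z, \sum_y m z y <= 1) ->
  (forall z, 0 <= f z) ->
  exists w : R -> I -> R,
    [/\ forall (s : R) z, is_derive s 1 (fun t : R => w t z)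
          (lam * (\sum_y m z y * w s y - w s z)),
        forall z, w 0 z = f z,
        forall s z, 0 <= s -> 0 <= w s z &
        forall s z, f z = 0 -> (forall y, y != z -> m z y = 0) -> w s z = 0].
Proof.
move=> lam0 m0 m1 f0.
pose T (g : I -> R) z := \sum_y m z y * g y.
pose a z k := iter k T f z.
pose B := \sum_z f z.
have aB z k : 0 <= a z k <= B.
  rewrite /a; elim: k z => [|k IH] z /=.
    by rewrite f0 /B (bigD1 z) //= lerDl sumr_ge0.
  apply/andP; split.
    by apply: sumr_ge0 => y _; rewrite mulr_ge0 //; case/andP: (IH y).
  apply: (@le_trans _ _ (\sum_y m z y * B)).
    by apply: ler_sum => y _; rewrite ler_wpM2l //; case/andP: (IH y).
  by rewrite -mulr_suml ler_piMl // sumr_ge0.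
have aN z k : `|a z k| <= B by have /andP[a0 ?] := aB z k; rewrite ger0_norm.
exists (fun s z => expR (- lam * s) * exp_gen (a z) (lam * s)); split.
- move=> s z.
  have l1 (c : R) : is_derive s 1 (fun u : R => c * u) c.
    by have := is_derive_scale c (is_derive_id s (1 : R)); rewrite mulr1.
  have h1 := @is_derive1_comp R expR _ s _ _ (is_derive_expR (- lam * s)) (l1 (- lam)).
  have h2 := @is_derive1_comp R (exp_gen (a z)) _ s _ _
    (is_derive_exp_gen (lam * s) (aN z)) (l1 lam).
  have h3 := is_derive_mul h1 h2.
  apply: (is_derive_eq h3); rewrite /=.
  have -> : exp_gen (fun k => a z k.+1) (lam * s) =
      \sum_y m z y * exp_gen (a y) (lam * s).
    by rewrite -(@exp_gen_lin _ (m z) a B).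
  under [X in _ = lam * (X - _)]eq_bigr do rewrite mulrCA.
  by rewrite -mulr_sumr; ring.
- by move=> z; rewrite !mulr0 expR0 mul1r exp_gen0.
- move=> s z s0; rewrite mulr_ge0 ?expR_ge0 //.
  by apply: exp_gen_ge0 (aB z) _; rewrite mulr_ge0 // ltW.
- move=> s z fz mz; rewrite (_ : a z = fun=> 0).
    rewrite /exp_gen (_ : pseries _ _ = cst 0) ?lim_cst ?mulr0 //.
    by apply/funext => n; rewrite /pseries /series /= big1 // => i _; rewrite !mul0r.
  apply/funext => k; elim: k => [|k IH]; first by rewrite /a.
  rewrite /a /= {1}/T (bigD1 z) //= -/(a z k) IH mulr0 add0r big1 // => y yz.
  by rewrite mz // mul0r.
Qed.

End ExpSeries.

(** * Existence and symmetry of the killed flow *)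

Section KilledFlow.
Context {R : realType} {I : finType} (G : weighted_graph R I).

Lemma exists_killed_solution (f : I -> R) : (forall z, 0 <= f z) -> supported G f ->
  exists w, killed_solution G w /\ forall z, w 0 z = f z.
Proof.
move=> f0 fs.
pose q z := (wtheta G z)^-1 * \sum_y wc G z y.
have th0 z : 0 <= (wtheta G z)^-1 by rewrite invr_ge0 ltW ?wtheta_gt0.
have q0 z : 0 <= q z.
  by rewrite mulr_ge0 // sumr_ge0 // => y _; exact: wc_ge0.
(* At least every exit rate, which makes the diagonal of m below non-negative; the summand 1 keeps
   it positive even without edges. *)
pose lam := 1 + \sum_z q z.
have lam0 : 0 < lam by rewrite ltr_pwDl // sumr_ge0.
have qlam z : q z <= lam.
  rewrite /lam (bigD1 z) //= addrCA lerDl addr_ge0 // sumr_ge0 //.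
pose m z y := (z == y)%:R + (winn G z)%:R * lam^-1 *
  ((wtheta G z)^-1 * wc G z y - (z == y)%:R * q z).
have dsum z (g : I -> R) : \sum_y (z == y)%:R * g y = g z.
  rewrite (bigD1 z) //= eqxx mul1r big1 ?addr0 // => y yz.
  by rewrite eq_sym (negPf yz) mul0r.
have m0 z y : 0 <= m z y.
  have h : 0 <= (winn G z)%:R * lam^-1 * ((wtheta G z)^-1 * wc G z y).
    by rewrite !mulr_ge0 ?wc_ge0 // invr_ge0 ltW.
  rewrite /m mulrBr; case: (z == y) => /=; last by rewrite mul0r mulr0 subr0 add0r.
  rewrite mul1r; have : (winn G z)%:R * lam^-1 * q z <= 1.
    rewrite -mulrA; case: (winn G z); rewrite ?mul0r ?mul1r //.
    by rewrite mulrC ler_pdivrMr // mul1r.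
  lra.
have msum z (g : I -> R) : \sum_y m z y * g y = g z + (winn G z)%:R * lam^-1 *
    ((wtheta G z)^-1 * \sum_y wc G z y * (g y - g z)).
  have -> : \sum_y m z y * g y = \sum_y ((z == y)%:R * g y) + (winn G z)%:R * lam^-1 *
     ((wtheta G z)^-1 * \sum_y (wc G z y * g y) - \sum_y (z == y)%:R * (q z * g y)).
    rewrite mulr_sumr -sumrB mulr_sumr -big_split /=; apply: eq_bigr => y _.
    by rewrite /m; ring.
  rewrite !dsum; congr (_ + _ * _); rewrite /q.
  under [X in _ = _ * X]eq_bigr do rewrite mulrBr.
  by rewrite sumrB -mulr_suml; ring.
have m1 z : \sum_y m z y <= 1.
  have := msum z (fun=> 1); under eq_bigr do rewrite mulr1.
  move=> ->; rewrite [X in _ * (_ * X)]big1 ?mulr0 ?addr0 // => y _.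
  by rewrite subrr mulr0.
have [w [dw w0 wge wz]] := exists_linear_flow lam0 m0 m1 f0.
exists w; split => //; split => //.
- move=> s z; apply: (is_derive_eq (dw s z)).
  rewrite msum addrAC subrr add0r; case: (winn G z) => /=; last by rewrite !mul0r mulr0.
  by rewrite mul1r [LHS]mulrA divff ?mul1r ?gt_eqF.
- move=> s z zn; apply: wz; first exact: fs.
  move=> y yz; rewrite /m eq_sym (negPf yz) (negPf zn) !mul0r addr0 //.
Qed.

Lemma killed_scale (w : R -> I -> R) (c : R) : 0 <= c -> killed_solution G w ->
  killed_solution G (fun s z => c * w s z).
Proof.
move=> c0 [dw w0 ws]; split.
- move=> s z; apply: (is_derive_eq (is_derive_scale c (dw s z))).
  case: ifP => _; last by rewrite mulr0.
  rewrite mulrCA; congr (_ * _); rewrite mulr_sumr; apply: eq_bigr => y _; ring.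
- by move=> s z s0; rewrite mulr_ge0 // w0.
- by move=> s z zn; rewrite ws // mulr0.
Qed.

(** By symmetry of the conductances, the derivative in s of the pairing of u(s) with h(T - s) is a
    sum of an expression antisymmetric in the two endpoints of an edge, hence 0. *)
Lemma killed_pairing (u h : R -> I -> R) (T s : R) : killed_solution G u ->
  killed_solution G h -> 0 <= s ->
  \sum_z wtheta G z * (u s z * h (T - s) z) = \sum_z wtheta G z * (u 0 z * h T z).
Proof.
move=> uP hP s0.
pose F t := \sum_z wtheta G z * (u t z * h (T - t) z).
pose du (w : R -> I -> R) (t : R) z :=
  if winn G z then (wtheta G z)^-1 * \sum_y wc G z y * (w t y - w t z) else 0.
have dF (t : R) : is_derive t 1 F (\sum_z wtheta G z *
    (du u t z * h (T - t) z - u t z * du h (T - t) z)).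
  apply: is_derive_bigsum => z _; apply: is_derive_scale.
  have h1 : is_derive t 1 (fun v : R => T - v) (-1).
    rewrite (_ : (fun v => T - v) = (fun v => T + -1 * v)); last first.
      by apply/funext => v; rewrite mulN1r.
    have := is_derive_add (is_derive_cst T t (1 : R))
      (is_derive_scale (-1) (is_derive_id t (1 : R))).
    by rewrite mulr1 add0r.
  have h2 := @is_derive1_comp R (fun v => h v z) _ t _ _ (killed_derive hP (T - t) z) h1.
  apply: (is_derive_eq (is_derive_mul (killed_derive uP t z) h2)).
  by rewrite /= mulrN1 mulrN.
have z0 t : \sum_z wtheta G z * (du u t z * h (T - t) z - u t z * du h (T - t) z) = 0.
  pose g z y := wc G z y * (u t y * h (T - t) z - u t z * h (T - t) y).
  transitivity (\sum_z \sum_y g z y).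
    apply: eq_bigr => z _; rewrite /du; case: ifPn => zi.
      rewrite (_ : \sum_y g z y = (\sum_y wc G z y * (u t y - u t z)) * h (T - t) z
        - u t z * \sum_y wc G z y * (h (T - t) y - h (T - t) z)).
        have := wtheta_gt0 G z; move: (wtheta G z) => th th0; field.
        by rewrite gt_eqF.
      rewrite mulr_suml mulr_sumr -sumrB; apply: eq_bigr => y _; rewrite /g; ring.
    rewrite (killed_supp uP t zi) !mul0r subrr mulr0 big1 // => y _.
    by rewrite /g (killed_supp uP t zi) (killed_supp hP (T - t) zi) mulr0 mul0r subrr mulr0.
  have : \sum_z \sum_y g z y = - \sum_z \sum_y g z y.
    rewrite [LHS]exchange_big /= -sumrN; apply: eq_bigr => z _.
    by rewrite -sumrN; apply: eq_bigr => y _; rewrite /g wc_sym; ring.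
  lra.
have E : F s = F 0.
  have dF0 (t : R) : 0 <= t <= s -> is_derive t 1 F 0 by move=> _; rewrite -(z0 t).
  have d0 (t : R) : 0 <= t <= s -> is_derive t 1 (fun=> 0 : R) 0.
    by move=> _; exact: is_derive_cst.
  have := increment_le s0 dF0 d0 (fun _ _ => lexx _).
  have := increment_le s0 d0 dF0 (fun _ _ => lexx _).
  by rewrite subrr; lra.
by move: E; rewrite /F subr0.
Qed.

Lemma killed_symmetric (u h : R -> I -> R) (T : R) : killed_solution G u ->
  killed_solution G h -> 0 <= T ->
  \sum_z wtheta G z * (u T z * h 0 z) = \sum_z wtheta G z * (u 0 z * h T z).
Proof. by move=> uP hP T0; rewrite -(killed_pairing T uP hP T0) subrr. Qed.

End KilledFlow.

(** * From boundedness of solutions to a bound on the killed heat kernel *)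

Section FiniteHeatKernel.
Context {R : realType}.

Record tilt_setting {I : finType} (G : weighted_graph R I) (psi Phi : I -> R)
    (H K kap A sg tau : R) : Prop := TiltSetting {
  ts_Phi_gt0 : forall y, 0 < Phi y;
  ts_Phi_cmp : forall y z, 0 < wc G y z -> Phi y ^+ 2 <= K * Phi z ^+ 2;
  ts_Phi_lip : forall y z, 0 < wc G y z ->
    (Phi y - Phi z) ^+ 2 <= kap / tau * Phi z ^+ 2;
  ts_psi_lip : forall z,
    \sum_y wc G z y * tilt (psi y - psi z) <= H * wtheta G z;
  ts_H_ge0 : 0 <= H;
  ts_A_gt0 : 0 < A;
  ts_tau_gt0 : 0 < tau;
  ts_interp : forall f : I -> R, (forall y, 0 <= f y) -> supported G f ->
    \sum_y wweight G y * f y `^ (2 + 2 * sg) / Phi y `^ (2 * sg)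
      <= A * (l2norm2 G f `^ sg * (tau * energy G f + l2norm2 G f)) }.

Lemma tilt_settingN {I : finType} (G : weighted_graph R I) psi Phi H K kap A sg tau :
  tilt_setting G psi Phi H K kap A sg tau ->
  tilt_setting G (fun z => - psi z) Phi H K kap A sg tau.
Proof.
case=> h1 h2 h3 h4 h5 h6 h7 h8; split=> // z; apply: le_trans (h4 z).
by apply: ler_sum => y _; rewrite -opprD tiltN.
Qed.

(** [local_boundedness] assumes smallness and concludes a fixed bound. The equation being linear, w
    is multiplied by M^(-1/2), with M chosen to make the smallness condition an equality; solving
    for M produces the power 1/sg of A. *)
Lemma mean_value (K kap sg : R) : 1 <= K -> 0 <= kap -> 0 < sg ->
  exists Q C : R, [/\ 0 < Q, 0 < C &
    forall (I : finType) (G : weighted_graph R I) (psi Phi : I -> R)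
      (w : R -> I -> R) (H A tau N : R),
    tilt_setting G psi Phi H K kap A sg tau -> killed_solution G w ->
    0 < N -> l2norm2 G (tilted psi w 0) <= N ->
    forall z, tilted psi w tau z ^+ 2 <=
      Phi z ^+ 2 * (Q * A `^ sg^-1 * expR (C * H * tau) * N)].
Proof.
move=> K1 kap0 sg0; have [del [C [del0 C0 LB]]] := local_boundedness K1 kap0 sg0.
exists (del `^ sg^-1)^-1, C; split => //; first by rewrite invr_gt0 powR_gt0.
move=> I G psi Phi w H A tau N [h1 h2 h3 h4 h5 h6 h7 h8] wP N0 hN z.
set M := _ * N; have M0 : 0 < M.
  by rewrite !mulr_gt0 ?invr_gt0 ?powR_gt0 ?expR_gt0.
pose c := (Num.sqrt M)^-1; have c0 : 0 < c by rewrite invr_gt0 sqrtr_gt0.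
have c2 : c ^+ 2 = M^-1 by rewrite exprVn sqr_sqrtr // ltW.
have wP' := killed_scale (ltW c0) wP.
have NM : 0 < N / M by rewrite divr_gt0.
have hN' : l2norm2 G (tilted psi (fun s z => c * w s z) 0) <= N / M.
  rewrite mulrC -c2; apply: le_trans (ler_wpM2l (sqr_ge0 c) hN).
  by rewrite /l2norm2 mulr_sumr; apply: ler_sum => y _; rewrite /tilted; apply: eq_ler; ring.
have hA : A * (expR (C * H * tau) * (N / M)) `^ sg <= del.
  have -> : expR (C * H * tau) * (N / M) = del `^ sg^-1 * (A `^ sg^-1)^-1.
    have e1 : expR (C * H * tau) != 0 by rewrite gt_eqF ?expR_gt0.
    have e2 : A `^ sg^-1 != 0 by rewrite gt_eqF ?powR_gt0.
    have e3 : del `^ sg^-1 != 0 by rewrite gt_eqF ?powR_gt0.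
    have e4 : N != 0 by rewrite gt_eqF.
    rewrite /M; move: e1 e2 e3 e4.
    move: (expR _) (A `^ _) (del `^ _) => a b d a0 b0 d0 n0.
    by field; rewrite a0 b0 d0 n0.
  rewrite powRM ?powR_ge0 ?invr_ge0 ?powR_ge0 // -powRrM mulVf ?gt_eqF //.
  rewrite powRr1 ?(ltW del0) // -powRN -powRrM mulNr mulVf ?gt_eqF //.
  by rewrite powR_inv1 ?(ltW h6) // mulrCA divff ?mulr1 // gt_eqF.
have st : degiorgi_setting G psi Phi (fun s z => c * w s z) H K kap A sg tau.
  by split => //; exact: ltW.
have := LB I G psi Phi _ H A tau _ st NM hN' hA z.
have -> : tilted psi (fun s z => c * w s z) tau z = tilted psi w tau z * c.
  by rewrite /tilted; ring.
rewrite /c ler_pdivrMr ?sqrtr_gt0 // => hh.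
have t0 : 0 <= tilted psi w tau z.
  by rewrite mulr_ge0 ?expR_ge0 // (killed_ge0 wP) // ltW.
by have := ler_sqr_base t0 hh; rewrite [(Phi z * _) ^+ 2]exprMn sqr_sqrtr // ltW.
Qed.

Section Duality.
Context {I : finType} (G : weighted_graph R I).

Definition delta_density (x z : I) : R := (z == x)%:R / wtheta G x.

Lemma delta_density_ge0 x z : 0 <= delta_density x z.
Proof. by rewrite divr_ge0 // ltW ?wtheta_gt0. Qed.

Lemma delta_density_supported x : winn G x -> supported G (delta_density x).
Proof.
move=> xi z zn; rewrite /delta_density; case: eqP => [e|_]; last by rewrite mul0r.
by move: zn; rewrite e xi.
Qed.

Lemma delta_pairing x (g : I -> R) :
  \sum_z wtheta G z * (delta_density x z * g z) = g x.
Proof.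
rewrite (bigD1 x) //= big1 ?addr0 => [|z zx]; last first.
  by rewrite /delta_density (negPf zx) !mul0r mulr0.
by rewrite /delta_density eqxx mul1r mulrA divff ?mul1r // gt_eqF ?wtheta_gt0.
Qed.

(* Duality: the L^2 norm of the flow out of a point mass is the value at that point
   of another solution, to which the L^2 to L^oo bound applies. *)
Lemma tilted_density_le (psi Phi : I -> R) (u : R -> I -> R) (x : I) (tau B : R) :
  0 <= tau -> 0 <= B -> killed_solution G u -> (forall z, u 0 z = delta_density x z) ->
  (forall (w : R -> I -> R) (N : R), killed_solution G w -> 0 < N ->
     l2norm2 G (tilted (fun z => - psi z) w 0) <= N ->
     tilted (fun z => - psi z) w tau x ^+ 2 <= Phi x ^+ 2 * (B * N)) ->
  l2norm2 G (tilted psi u tau) <= expR (psi x) ^+ 2 * Phi x ^+ 2 * B.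
Proof.
move=> tau0 B0 uP u0 mv.
set S := l2norm2 G (tilted psi u tau).
have S0 : 0 <= S by exact: l2norm2_ge0.
have [Sz|Sn] := eqVneq S 0; first by rewrite Sz mulr_ge0 // mulr_ge0 ?sqr_ge0.
have Sp : 0 < S by rewrite lt_def Sn.
(* f = exp(2 psi) u(tau): its pairing with u(tau) is S, and exp(- psi) f is the tilted solution
   itself, of squared norm S. *)
pose f z := expR (psi z) * tilted psi u tau z.
have f0 z : 0 <= f z by rewrite !mulr_ge0 ?expR_ge0 // (killed_ge0 uP).
have fs : supported G f by move=> z zn; rewrite /f /tilted (killed_supp uP) // !mulr0.
have [Z [ZP Z0]] := exists_killed_solution f0 fs.
have hS : l2norm2 G (tilted (fun z => - psi z) Z 0) <= S.
  apply: ler_sum => z _; rewrite /tilted Z0 /f mulrA expRN mulVf ?mul1r //.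
  by rewrite gt_eqF ?expR_gt0.
have SE : S = Z tau x.
  rewrite -(delta_pairing x (Z tau)).
  under eq_bigr do rewrite -u0.
  rewrite -(killed_symmetric uP ZP tau0); apply: eq_bigr => z _.
  by rewrite Z0 /f /tilted; ring.
have := mv Z S ZP Sp hS; rewrite /tilted -SE expRN.
have p0 : 0 < expR (psi x) by exact: expR_gt0.
rewrite exprMn exprVn mulrC ler_pdivrMr ?exprn_gt0 // => h.
by rewrite -(ler_pM2r Sp) -expr2; apply: (le_trans h); apply: eq_ler; ring.
Qed.

(* With u and h started from the densities of x and y, symmetry gives
   h (2 tau) x = sum theta (exp psi u tau) (exp (- psi) h tau). *)
Lemma heat_kernel_finite (psi Phi : I -> R) (x y : I) (h : R -> I -> R) (tau B : R) :
  0 <= tau -> 0 <= B -> (forall z, 0 < Phi z) ->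
  killed_solution G h -> winn G x -> winn G y ->
  (forall z, h 0 z = delta_density y z) ->
  (forall (w : R -> I -> R) (N : R) z, killed_solution G w -> 0 < N ->
     l2norm2 G (tilted psi w 0) <= N ->
     tilted psi w tau z ^+ 2 <= Phi z ^+ 2 * (B * N)) ->
  (forall (w : R -> I -> R) (N : R) z, killed_solution G w -> 0 < N ->
     l2norm2 G (tilted (fun z => - psi z) w 0) <= N ->
     tilted (fun z => - psi z) w tau z ^+ 2 <= Phi z ^+ 2 * (B * N)) ->
  h (2 * tau) x <= Phi x * Phi y * expR (psi x - psi y) * B.
Proof.
move=> tau0 B0 Phi0 hP xi yi h0 mv mvN.
have [u [uP u0]] := exists_killed_solution (delta_density_ge0 x) (delta_density_supported xi).
have S1 := tilted_density_le (psi := psi) (Phi := Phi) tau0 B0 uP u0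
  (fun w N wP => mvN w N x wP).
have S2 : l2norm2 G (tilted (fun z => - psi z) h tau) <=
    expR (- psi y) ^+ 2 * Phi y ^+ 2 * B.
  apply: (tilted_density_le tau0 B0 hP h0) => w N wP N0.
  have -> : (fun z => - - psi z) = psi by apply/funext => z; rewrite opprK.
  exact: mv.
have E : h (2 * tau) x = \sum_z wtheta G z * (u tau z * h tau z).
  have t2 : 2 * tau - tau = tau by ring.
  have := killed_pairing (2 * tau) uP hP tau0; rewrite t2 => ->.
  under eq_bigr do rewrite u0.
  by rewrite delta_pairing.
have CS := cauchy_schwarz_sum predT (fun z => Num.sqrt (wtheta G z) * tilted psi u tau z)
  (fun z => Num.sqrt (wtheta G z) * tilted (fun z => - psi z) h tau z).
have sq w : \sum_z (Num.sqrt (wtheta G z) * w z) ^+ 2 = l2norm2 G w.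
  by apply: eq_bigr => z _; rewrite exprMn sqr_sqrtr // ltW ?wtheta_gt0.
have cross : \sum_z (Num.sqrt (wtheta G z) * tilted psi u tau z) *
    (Num.sqrt (wtheta G z) * tilted (fun z => - psi z) h tau z) = h (2 * tau) x.
  rewrite E; apply: eq_bigr => z _.
  rewrite mulrACA -expr2 sqr_sqrtr ?(ltW (wtheta_gt0 _ _)) // /tilted expRN mulrACA divff ?mul1r //.
  by rewrite gt_eqF ?expR_gt0.
rewrite !sq cross in CS.
have h0' : 0 <= h (2 * tau) x by rewrite (killed_ge0 hP) // mulr_ge0.
have P0 : 0 <= Phi x * Phi y * expR (psi x - psi y) * B.
  by rewrite mulr_ge0 // mulr_ge0 ?expR_ge0 // mulr_ge0 ?ltW.
rewrite -(@ler_pXn2r R 2) ?nnegrE //; apply: (le_trans CS).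
apply: (le_trans (ler_pM (l2norm2_ge0 _ _) (l2norm2_ge0 _ _) S1 S2)).
by apply: eq_ler; rewrite expRD; ring.
Qed.

End Duality.
End FiniteHeatKernel.

Section FiniteBound.
Context {R : realType}.

Lemma exprn_diff_le M (a b : R) : 1 <= b <= a -> a ^+ M - b ^+ M <= M%:R * a ^+ M * (a - b).
Proof.
move=> /andP[b1 ba]; have b0 : 0 <= b by exact: le_trans b1.
have a1 : 1 <= a by exact: le_trans ba.
case: M => [|M]; first by rewrite !expr0 subrr !mul0r.
have ab : 0 <= b <= a by rewrite b0.
apply: (le_trans (exprS_diff_le M ab)); rewrite ler_wpM2r ?subr_ge0 //.
by rewrite ler_wpM2l // exprS ler_peMl ?exprn_ge0 // (le_trans b0).
Qed.

Lemma growth_lip M (a b n : R) : 1 <= a -> 1 <= b -> 1 <= n -> `|a - b| <= n^-1 ->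
  a ^+ M <= 2 ^+ M * b ^+ M /\
  `|a ^+ M - b ^+ M| <= M%:R * 2 ^+ M / n * b ^+ M.
Proof.
move=> a1 b1 n1 ab; have n0 : 0 < n by exact: lt_le_trans n1.
have ni1 : n^-1 <= 1 by rewrite invf_le1.
have a0 : 0 <= a by exact: le_trans a1.
have b0 : 0 <= b by exact: le_trans b1.
have a2b : a <= 2 * b.
  have := ler_norm (a - b); lra.
have aM : a ^+ M <= 2 ^+ M * b ^+ M by rewrite -exprMn; apply: lerXn2r; rewrite ?nnegrE ?mulr_ge0.
have bM : 0 <= b ^+ M by rewrite exprn_ge0.
have b2 : b ^+ M <= 2 ^+ M * b ^+ M by rewrite ler_peMl // exprn_ege1 // ler1n.
split => //.
have [le|lt] := leP b a.
  rewrite ger0_norm; last by rewrite subr_ge0; apply: lerXn2r.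
  apply: (@le_trans _ _ (M%:R * a ^+ M * (a - b))).
    by apply: exprn_diff_le; rewrite b1.
  rewrite [leRHS](_ : _ = M%:R * (2 ^+ M * b ^+ M) * n^-1); last by ring.
  apply: ler_pM; rewrite ?subr_ge0 ?mulr_ge0 ?exprn_ge0 //.
    by rewrite ler_wpM2l.
  exact: le_trans (ler_norm _) ab.
rewrite distrC ger0_norm; last by rewrite subr_ge0; apply: lerXn2r => //; exact: ltW.
apply: (@le_trans _ _ (M%:R * b ^+ M * (b - a))).
  by apply: exprn_diff_le; rewrite a1 ltW.
rewrite [leRHS](_ : _ = M%:R * (2 ^+ M * b ^+ M) * n^-1); last by ring.
apply: ler_pM; rewrite ?subr_ge0 ?mulr_ge0 ?exprn_ge0 ?(ltW lt) //.
  by rewrite ler_wpM2l.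
by apply: le_trans ab; rewrite distrC ler_norm.
Qed.

(** The time T is split into two halves, one for each use of the L^2 to L^oo bound. The level
    function equals 1 at the base point x, so that only its value at y survives. *)
Lemma finite_heat_bound (d d' p q r C : R) :
  2 <= d -> 2 <= d' -> 1 < p -> 1 < q -> 1 < r ->
  r^-1 + p^-1 * (1 - r^-1) + q^-1 < 2 / d' -> 0 < C ->
  exists (Q C2 : R) (M : nat), [/\ 0 < Q, 0 < C2 &
    forall (I : finType) (G : weighted_graph R I) (n T H : R) (psi : I -> R)
      (x y : I) (h : R -> I -> R),
    1 <= n -> 1 <= T -> T <= n ^+ 2 <= 4 * T -> 0 <= H ->
    (forall i, regular_scale G d d' p q r C (2 ^+ i * n)) ->
    (forall z, \sum_y wc G z y * tilt (psi y - psi z) <= H * wtheta G z) ->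
    killed_solution G h -> winn G x -> winn G y -> wdist G x = 0 ->
    (forall z, h 0 z = delta_density G y z) ->
    h T x <= Q * T `^ (- (d / 2)) * growth G M n y
      * expR (psi x - psi y + C2 * H * T)].
Proof.
move=> hd hd' hp hq hr hcond C0.
have [[_ sg0 _ _] _] := gain_exponents hd' hp hq hr hcond.
have [K0 [M [K00 HK0]]] := global_interpolation hd hd' hp hq hr hcond C0.
set sg := gain d' p q r in sg0 HK0.
(* [K] and [kap] are the constants of [growth_lip], squared: along an edge the base [1 + dist / n]
   changes by at most 1/n, hence at most by a factor 2. *)
pose K : R := 4 ^+ M.
pose kap : R := (M%:R * 2 ^+ M) ^+ 2.
have K1 : 1 <= K by rewrite exprn_ege1 // ler1n.
have kap0 : 0 <= kap by exact: sqr_ge0.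
have [Qm [Cm [Qm0 Cm0 MV]]] := mean_value K1 kap0 sg0.
exists (Qm * (8 * K0) `^ sg^-1), Cm, M; split => //.
  by rewrite mulr_gt0 // powR_gt0 // mulr_gt0.
move=> I G n T H psi x y h n1 T1 /andP[Tn nT] H0 Hreg Hpsi hP xi yi dx hy.
have n0 : 0 < n by exact: lt_le_trans n1.
have T0 : 0 < T by exact: lt_le_trans T1.
pose tau := T / 2.
have tau0 : 0 < tau by rewrite divr_gt0.
pose Phi := growth G M n.
have base z : 1 <= 1 + wdist G z / n by rewrite lerDl divr_ge0 ?wdist_ge0 ?ltW.
have Phi0 z : 0 < Phi z by rewrite exprn_gt0 // (lt_le_trans ltr01).
(* The 8 comes from n^2 <= 4 T = 8 tau. *)
pose A := 8 * K0 * n `^ (- (d * sg)).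
have A0 : 0 < A by rewrite mulr_gt0 ?powR_gt0 // mulr_gt0.
have lip y' z : 0 < wc G y' z -> Phi y' <= 2 ^+ M * Phi z /\
    `|Phi y' - Phi z| <= M%:R * 2 ^+ M / n * Phi z.
  move=> cyz; apply: growth_lip => //.
  rewrite opprD addrACA subrr add0r -mulrBl normrM [X in _ * X]gtr0_norm ?invr_gt0 //.
  by rewrite ler_piMl ?invr_ge0 ?(ltW n0) // wdist_adj.
have st : tilt_setting G psi Phi H K kap A sg tau.
  split => //.
  - move=> y' z /lip[h1 _]; rewrite /K (_ : 4 = 2 ^+ 2); last by ring.
    rewrite -exprM mulnC exprM -exprMn; apply: ler_sqr_base h1.
    exact: ltW.
  - move=> y' z /lip[_ h1].
    rewrite -real_normK ?num_real //; apply: (le_trans (ler_sqr_base (normr_ge0 _) h1)).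
    rewrite !exprMn ler_wpM2r ?sqr_ge0 // /kap exprMn ler_wpM2l ?mulr_ge0 ?sqr_ge0 //.
    rewrite exprVn lef_pV2 ?posrE ?exprn_gt0 //; apply: le_trans Tn.
    by rewrite /tau; lra.
  - move=> f f0 fs; apply: (le_trans (HK0 I G n n1 Hreg f f0 fs)).
    rewrite [leRHS](_ : _ = K0 * n `^ (- (d * sg)) *
      (l2norm2 G f `^ sg * (8 * (tau * energy G f + l2norm2 G f)))); last by rewrite /A; ring.
    rewrite ler_wpM2l ?mulr_ge0 ?powR_ge0 ?(ltW K00) // ler_wpM2l ?powR_ge0 //.
    have E0 := energy_ge0 G f; have X0 := l2norm2_ge0 G f.
    have h1 : n ^+ 2 * energy G f <= 8 * tau * energy G f.
      by rewrite ler_wpM2r //; move: nT; rewrite /tau; lra.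
    move: h1 X0; move: (energy G f) (l2norm2 G f) => E X; lra.
have st' := tilt_settingN st.
pose B := Qm * A `^ sg^-1 * expR (Cm * H * tau).
have B0 : 0 <= B by rewrite !mulr_ge0 ?powR_ge0 ?expR_ge0 ?(ltW Qm0).
have := @heat_kernel_finite R I G psi Phi x y h tau B (ltW tau0) B0 Phi0 hP xi yi hy
  (fun w N z wP N0 hN => MV I G psi Phi w H A tau N st wP N0 hN z)
  (fun w N z wP N0 hN => MV I G _ Phi w H A tau N st' wP N0 hN z).
have -> : 2 * tau = T by rewrite /tau; field.
move=> hh; apply: (le_trans hh).
have -> : Phi x = 1 by rewrite /Phi /growth dx mul0r addr0 expr1n.
rewrite mul1r /B /A -/(Phi y) (expRD (psi x - psi y)).
have -> : (8 * K0 * n `^ (- (d * sg))) `^ sg^-1 = (8 * K0) `^ sg^-1 * n `^ (- d).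
  rewrite powRM ?powR_ge0 ?mulr_ge0 ?(ltW K00) // -powRrM; congr (_ * _ `^ _).
  by rewrite mulNr mulfK // gt_eqF.
have nd : n `^ (- d) <= T `^ (- (d / 2)).
  have -> : n `^ (- d) = (n ^+ 2) `^ (- (d / 2)).
    by rewrite -powR_mulrn ?(ltW n0) // -powRrM; congr (_ `^ _); field.
  have d2 : 0 <= d / 2 by lra.
  rewrite !powRN lef_pV2 ?posrE ?powR_gt0 ?exprn_gt0 //.
  by apply: ler_powR_base => //; exact: ltW.
have e2 : expR (Cm * H * tau) <= expR (Cm * H * T).
  rewrite ler_expR ler_wpM2l ?mulr_ge0 ?(ltW Cm0) // /tau; lra.
have c0 : 0 <= Phi y * expR (psi x - psi y) * Qm * (8 * K0) `^ sg^-1.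
  by rewrite !mulr_ge0 ?expR_ge0 ?powR_ge0 ?(ltW (Phi0 _)) ?(ltW Qm0).
have := ler_wpM2l c0 (ler_pM (powR_ge0 _ _) (expR_ge0 _) nd e2).
move: (n `^ _) (T `^ _) (expR (Cm * H * tau)) (expR (Cm * H * T)) ((8 * K0) `^ _) => u v e f g hle.
rewrite [leLHS](_ : _ = Phi y * expR (psi x - psi y) * Qm * g * (u * e)); last by ring.
by apply: (le_trans hle); apply: eq_ler; ring.
Qed.

End FiniteBound.

(** * Finite pieces of the infinite graph *)

Section GraphMetric.
Context {R : realType} {V : choiceType} (E : rel V).
Hypothesis Gr : infinite_graph E.

Local Notation dist := (@graph_dist R V E).

Lemma graph_dist_attained (x y : V) : exists p, [/\ path E x p, last x p = y,
  dist x y = (size p)%:R & forall p', path E x p' -> last x p' = y -> (size p <= size p')%N].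
Proof.
pose P n := `[< exists p, [/\ path E x p, last x p = y & size p = n] >].
have exP : exists n, P n.
  have [p [h1 h2]] := graph_connected Gr x y.
  by exists (size p); apply/asboolP; exists p.
case: (ex_minnP exP) => n /asboolP[p [h1 h2 h3]] nmin.
have pmin p' : path E x p' -> last x p' = y -> (size p <= size p')%N.
  by move=> h1' h2'; rewrite h3; apply: nmin; apply/asboolP; exists p'.
exists p; split => //.
apply/eqP; rewrite eq_le; apply/andP; split.
  apply: ge_inf; last by exists p.
  by exists 0 => _ [p' _ <-].
apply: lb_le_inf; first by exists (size p)%:R, p.
by move=> _ [p' [h1' h2'] <-]; rewrite ler_nat pmin.
Qed.

Lemma graph_dist_le_path (x : V) p : path E x p -> dist x (last x p) <= (size p)%:R.
Proof.
move=> h; have [p' [_ _ -> pm]] := graph_dist_attained x (last x p).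
by rewrite ler_nat pm.
Qed.

Lemma graph_dist_ge0 (x y : V) : 0 <= dist x y.
Proof. by have [p [_ _ -> _]] := graph_dist_attained x y. Qed.

Lemma graph_dist_refl (x : V) : dist x x = 0.
Proof.
by apply/eqP; rewrite eq_le graph_dist_ge0 andbT; exact: (@graph_dist_le_path x [::]).
Qed.

Lemma graph_dist_step (x y z : V) : E y z -> dist x z <= dist x y + 1.
Proof.
move=> yz; have [p [h1 h2 -> _]] := graph_dist_attained x y.
have := @graph_dist_le_path x (rcons p z).
by rewrite rcons_path h1 h2 yz last_rcons size_rcons natr1 => /(_ isT).
Qed.

Lemma graph_dist_adj (x y z : V) : E y z -> `|dist x y - dist x z| <= 1.
Proof.
move=> yz; have zy : E z y by rewrite (edge_sym Gr).
have := graph_dist_step x yz; have := graph_dist_step x zy.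
by rewrite ler_norml => h1 h2; apply/andP; split; lra.
Qed.

Lemma gballP (x y : V) n : gball (R := R) E x n y <->
  exists p, [/\ path E x p, last x p = y & (size p <= n)%N].
Proof.
rewrite /gball /=; have [p [h1 h2 -> pm]] := graph_dist_attained x y.
rewrite ler_nat; split => [pn|[p' [h1' h2' pn]]]; first by exists p.
exact: leq_trans (pm _ h1' h2') pn.
Qed.

Lemma gball_center (x : V) n : gball (R := R) E x n x.
Proof. by rewrite /gball /= graph_dist_refl. Qed.

Lemma gball_step (x y z : V) n : gball (R := R) E x n y -> E y z -> gball (R := R) E x n.+1 z.
Proof.
rewrite /gball /= => h yz; apply: (le_trans (graph_dist_step x yz)).
by rewrite -natr1 lerD2r.
Qed.

Lemma gball_mono (x : V) m n : (m <= n)%N -> gball (R := R) E x m `<=` gball (R := R) E x n.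
Proof. by move=> mn y; rewrite /gball /= => /le_trans; apply; rewrite ler_nat. Qed.

Lemma gball_finite (x : V) n : finite_set (gball (R := R) E x n).
Proof.
elim: n => [|n IH].
  apply: (@sub_finite_set _ _ [set x]); last exact: finite_set1.
  by move=> y /gballP[[|z p] [_ /= <- //]].
apply: (@sub_finite_set _ _ (gball (R := R) E x n `|`
   \bigcup_(y in gball (R := R) E x n) [set z | E y z])).
  move=> z /gballP[p [hp hl hs]].
  case/lastP: p hp hl hs => [|p w] hp hl hs.
    by left; apply/gballP; exists [::].
  move: hp hl hs; rewrite rcons_path last_rcons size_rcons ltnS => /andP[hp hw] <- hs.
  by right; exists (last x p) => //; apply/gballP; exists p.
rewrite finite_setU; split => //.
apply: bigcup_finite => // y _; exact: (graph_locally_finite Gr).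
Qed.

Lemma exists_neighbor (x : V) : exists y, E x y.
Proof.
apply: contrapT => h.
have sub : [set: V] `<=` [set x].
  move=> y _; have [p [hp hl]] := graph_connected Gr x y.
  case: p hp hl => [_ /= -> //|z p /= /andP[xz _]].
  by exfalso; apply: h; exists z.
apply: (graph_infinite Gr); exact: sub_finite_set sub (finite_set1 x).
Qed.

End GraphMetric.

Section FsumFintype.
Context {R : realType}.

Lemma fsum_fintype (V : choiceType) (J : finType) (e : J -> V) (A : set V) (g : V -> R) :
  injective e -> finite_set A ->
  (forall z, A z -> (forall j, e j <> z) -> g z = 0) ->
  \sum_(z \in A) g z = \sum_(j | `[< A (e j) >]) g (e j).
Proof.
move=> einj fA g0; rewrite fsbig_finite //=.
pose L := [seq e j | j <- enum J & `[< A (e j) >]].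
have LA z : z \in L -> A z.
  by move=> /mapP[j]; rewrite mem_filter => /andP[/asboolP + _] ->.
have uL : uniq L by rewrite map_inj_uniq // filter_uniq // enum_uniq.
rewrite (bigID (fun z => z \in L)) /= [X in _ + X]big1_seq ?addr0; last first.
  move=> z /andP[zL]; rewrite in_fset_set // inE => Az; apply: g0 => // j ej.
  move: zL; rewrite -ej => /negP; apply; apply: map_f.
  by rewrite mem_filter mem_enum andbT; apply/asboolP; rewrite ej.
rewrite -big_filter (perm_big L) /=; last first.
  apply: uniq_perm => //; first by rewrite filter_uniq // fset_uniq.
  move=> z; rewrite mem_filter; case: (boolP (z \in L)) => // zL /=.
  by rewrite in_fset_set //; apply/mem_set/LA.
by rewrite /L big_map big_filter big_enum_cond.
Qed.

Lemma fsum_fintype_le (V : choiceType) (J : finType) (e : J -> V) (A : set V) (g : V -> R) :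
  injective e -> finite_set A -> (forall z, A z -> 0 <= g z) ->
  \sum_(j | `[< A (e j) >]) g (e j) <= \sum_(z \in A) g z.
Proof.
move=> einj fA g0.
pose g' z := if `[< exists j, e j = z >] then g z else 0.
have <- : \sum_(z \in A) g' z = \sum_(j | `[< A (e j) >]) g (e j).
  rewrite (fsum_fintype einj fA) => [|z Az h]; last first.
    by rewrite /g'; case: asboolP => // -[j ej]; exfalso; exact: (h j).
  apply: eq_bigr => j _; rewrite /g'; case: asboolP => // h; exfalso; apply: h.
  by exists j.
rewrite !fsbig_finite //= big_seq [leRHS]big_seq; apply: ler_sum => z.
rewrite in_fset_set // inE => Az; rewrite /g'; case: ifP => // _; exact: g0.
Qed.

Lemma ncardE (V : choiceType) (A : set V) : finite_set A ->
  ncard A = \sum_(z \in A) (1 : R).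
Proof.
by move=> fA; rewrite fsbig_finite //= big_const_seq count_predT iter_addr_0.
Qed.

End FsumFintype.

(** * Restriction of the infinite graph to a ball *)

Section Restriction.
Context {R : realType} {V : choiceType} (E : rel V).
Hypothesis Gr : infinite_graph E.
Variables (omega : V -> V -> R) (theta : V -> R).
Hypothesis th0 : forall x, 0 < theta x.
Hypothesis om : conductances E omega.
Variables (x : V) (K : nat).

(** The radius is K+1 whereas the walk is killed outside radius K: all neighbours of a surviving
    vertex are present, so that the finite generator agrees with the infinite one there. *)
Definition verts : {fset V} := fset_set (gball (R := R) E x K.+1).

Lemma in_verts z : gball (R := R) E x K.+1 z -> z \in verts.
Proof. by move=> h; rewrite /verts in_fset_set ?inE //; exact: gball_finite. Qed.

Definition cond (y z : V) : R := if E y z then omega y z else 0.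

Lemma cond_ge0 y z : 0 <= cond y z.
Proof. by rewrite /cond; case: ifP => // /om[/ltW]. Qed.

Lemma cond_sym y z : cond y z = cond z y.
Proof. by rewrite /cond (edge_sym Gr z y); case: ifP => // /om[]. Qed.

Lemma cond_gt0 y z : (0 < cond y z) = E y z.
Proof.
by rewrite /cond; case: ifP => [/om[]|_] //; rewrite ltxx.
Qed.

Lemma neighbors_finite y : finite_set [set z | E y z].
Proof. exact: (graph_locally_finite Gr). Qed.

Lemma cond_sum_le (y : V) : \sum_(z : verts) cond y (val z) <= mu E omega y.
Proof.
apply: le_trans (fsum_fintype_le (e := val : verts -> V) val_inj (neighbors_finite y) _).
  rewrite [leRHS]big_mkcond /=; apply: ler_sum => z _; rewrite /cond.
  by case: asboolP => /= h; [rewrite h|rewrite ifF //; apply/negP].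
by move=> z /= /om[/ltW].
Qed.

Lemma nu_sum_le (y : V) :
  \sum_(z : verts | 0 < cond y (val z)) (cond y (val z))^-1 <= nu E omega y.
Proof.
apply: le_trans (fsum_fintype_le (e := val : verts -> V) val_inj (neighbors_finite y) _).
  rewrite [leLHS]big_mkcond [leRHS]big_mkcond /=; apply: ler_sum => z _.
  rewrite cond_gt0 /cond; case: asboolP => /= h; first by rewrite h.
  by rewrite ifF //; apply/negP.
by move=> z /= /om[/ltW h _]; rewrite invr_ge0.
Qed.

Lemma dist_cond_adj (y z : V) : 0 < cond y z ->
  `|graph_dist E x y - graph_dist E x z| <= 1 :> R.
Proof. by rewrite cond_gt0; exact: graph_dist_adj. Qed.

Definition restriction : weighted_graph R verts :=
  @WeightedGraph R verts
    (fun y z => cond (val y) (val z)) (fun y => theta (val y))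
    (fun y => mu E omega (val y)) (fun y => nu E omega (val y))
    (fun y => graph_dist E x (val y)) (fun y => `[< gball (R := R) E x K (val y) >])
    (fun y z => cond_ge0 (val y) (val z)) (fun y z => cond_sym (val y) (val z))
    (fun y => th0 (val y)) (fun y => cond_sum_le (val y)) (fun y => nu_sum_le (val y))
    (fun y => graph_dist_ge0 Gr x (val y))
    (fun y z => @dist_cond_adj (val y) (val z)).

Lemma ball_sum_le (g : V -> R) n : (forall z, 0 <= g z) ->
  \sum_(y : verts | graph_dist E x (val y) <= n%:R :> R) g (val y)
    <= \sum_(z \in gball (R := R) E x n) g z.
Proof.
move=> g0; apply: le_trans (fsum_fintype_le (e := val : verts -> V) val_inj (gball_finite Gr x n) _).
  by apply: eq_ler; apply: eq_bigl => y; apply/idP/asboolP.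
by move=> z _.
Qed.

(** u is extended by 0 to the infinite graph. Its support lies within radius K, so every edge along
    which the extension varies has both endpoints within radius K+1 and is counted in the finite
    sum. *)
Lemma restriction_sobolev (d d' CS : R) (N2 : V -> nat) n (u : verts -> R) :
  local_sobolev E d d' CS N2 -> (N2 x <= n)%N -> 0 < CS -> 1 < d' ->
  (forall y, 0 <= u y) -> supported restriction u ->
  (forall y, ~~ (graph_dist E x (val y) <= n%:R :> R) -> u y = 0) ->
  (\sum_y u y `^ (d' / (d' - 1))) `^ ((d' - 1) / d')
    <= CS * n%:R `^ (1 - d / d') *
       \sum_y \sum_(z | 0 < wc restriction y z) `|u y - u z|.
Proof.
move=> hS hn CS0 hd' u0 us uB.
pose u' (z : V) : R := if insub z is Some y then u y else 0.
have u'E (y : verts) : u' (val y) = u y by rewrite /u' valK.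
have u'0 z : z \notin verts -> u' z = 0 by move=> zn; rewrite /u' insubN.
have u's z : u' z != 0 -> exists2 y : verts, val y = z & u y != 0.
  by rewrite /u'; case: insubP => [y _ yz uy|_]; [exists y|rewrite eqxx].
have u'K z : u' z != 0 -> gball (R := R) E x K z.
  move=> /u's[y <- uy]; apply/asboolP; apply: contraNT uy => yn; apply/eqP; exact: us.
have supp : [set y | u' y != 0] `<=` gball (R := R) E x n.
  move=> z /= /u's[y <- uy]; rewrite /gball /=.
  by apply: contraNT uy => yn; apply/eqP; exact: uB.
have := hS x n hn u' supp.
have -> : \sum_(y \in gball (R := R) E x n) `|u' y| `^ (d' / (d' - 1)) =
    \sum_y u y `^ (d' / (d' - 1)).
  have dd : d' / (d' - 1) != 0.
    by rewrite gt_eqF // divr_gt0 ?subr_gt0 // (lt_trans ltr01).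
  rewrite (@fsum_fintype R V verts val _ _ val_inj (gball_finite Gr x n)) => [|z _ h]; last first.
    rewrite u'0 ?normr0 ?powR0 //; apply/negP => zv.
    by apply: (h [` zv]%fset).
  rewrite big_mkcond /=; apply: eq_bigr => y _; rewrite u'E ger0_norm //.
  case: asboolP => // yn; rewrite uB ?powR0 //; apply/negP => h; apply: yn; exact: h.
move=> /le_trans; apply; rewrite ler_wpM2l ?mulr_ge0 ?powR_ge0 ?(ltW CS0) //.
rewrite /edge_variation.
set A := [set yz : V * V | _].
have fA : finite_set A.
  pose B := gball (R := R) E x n.
  apply: (@sub_finite_set _ _ (gball (R := R) E x n.+1 `*` gball (R := R) E x n.+1)); last first.
    by apply: finite_setX; exact: gball_finite.
  move=> [y z] /= [yz [h|h]]; split => /=.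
  - exact: gball_mono h.
  - exact: gball_step yz.
  - by apply: gball_step h _ => //; rewrite (edge_sym Gr).
  - exact: gball_mono h.
pose e (yz : verts * verts) := (val yz.1, val yz.2).
have einj : injective e by move=> [a b] [a' b'] [/val_inj -> /val_inj ->].
rewrite (fsum_fintype einj fA) => [|[y z] [/= yz _] h]; last first.
  suff : u' y = 0 /\ u' z = 0 by move=> [-> ->]; rewrite subrr normr0.
  have zy : E z y by rewrite (edge_sym Gr).
  have notin : ~ (y \in verts /\ z \in verts).
    by move=> [yv zv]; apply: (h ([` yv]%fset, [` zv]%fset)).
  split; apply/eqP; apply: contraPT notin => /u'K hK; apply; split; apply: in_verts.
  - exact: gball_mono hK.
  - exact: gball_step hK _.
  - exact: gball_step hK _.
  - exact: gball_mono hK.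
have T0 : 0 <= \sum_(j | `[< A (e j) >]) `|u' (e j).1 - u' (e j).2| by exact: sumr_ge0.
apply: (@le_trans _ _ (\sum_(j | `[< A (e j) >]) `|u' (e j).1 - u' (e j).2|)).
  by rewrite ler_piMl // invf_le1 // ler1n.
rewrite pair_big_dep /= big_mkcond [leRHS]big_mkcond /=; apply: ler_sum => -[y z] _ /=.
rewrite !u'E cond_gt0; case: asboolP => [[/= -> _] //|_].
by case: ifP.
Qed.

End Restriction.

(** * Averaged norms and separation of the factors in (I) *)

Section AveragedNorms.
Context {R : realType} {V : choiceType}.
Implicit Types (B : set V) (f phi : V -> R).

(** Lets the analytic part work with real exponents only; 1/eps is large when eps is small. *)
Definition finite_exponent (eps : R) (p : \bar R) : R :=
  if p is s%:E then s else eps^-1.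

Lemma fsum_fset B f : finite_set B ->
  \sum_(z \in B) f z = \sum_(j : fset_set B) f (val j).
Proof. by move=> fB; rewrite fsbig_finite // big_seq_fsetE. Qed.

Lemma val_fset_set B (j : fset_set B) : finite_set B -> B (val j).
Proof. by move=> fB; have := valP j; rewrite in_fset_set // inE. Qed.

Lemma ncard_sum B : finite_set B -> ncard B = \sum_(j : fset_set B) (1 : R).
Proof. by move=> fB; rewrite ncardE // fsum_fset. Qed.

Lemma ncard_gt0 B : finite_set B -> B !=set0 -> 0 < ncard B :> R.
Proof.
move=> fB [z Bz]; rewrite /ncard ltr0n cardfs_gt0; apply/fset0Pn.
by exists z; rewrite in_fset_set ?inE.
Qed.

Lemma ler_fsum B f phi : finite_set B -> (forall z, B z -> f z <= phi z) ->
  \sum_(z \in B) f z <= \sum_(z \in B) phi z.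
Proof.
move=> fB h; rewrite !fsum_fset //; apply: ler_sum => j _.
by apply: h; exact: val_fset_set.
Qed.

Lemma fsum_ge0 B f : finite_set B -> (forall z, B z -> 0 <= f z) ->
  0 <= \sum_(z \in B) f z.
Proof.
move=> fB h; rewrite fsum_fset //; apply: sumr_ge0 => j _.
by apply: h; exact: val_fset_set.
Qed.

Lemma fsum_scale B (c : R) f : finite_set B ->
  \sum_(z \in B) c * f z = c * \sum_(z \in B) f z.
Proof. by move=> fB; rewrite !fsum_fset // mulr_sumr. Qed.

Lemma bigmax_seq_ge (s : seq V) f z : z \in s -> f z <= \big[Num.max/0]_(y <- s) f y.
Proof.
elim: s => // y s IH; rewrite inE big_cons le_max => /orP[/eqP ->|/IH ->].
  by rewrite lexx.
by rewrite orbT.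
Qed.

Lemma avg_norm_ge0 p B phi f : 0 <= avg_norm p B phi f.
Proof.
case: p => [s||] //=; first exact: powR_ge0.
by elim/big_ind: _ => // a b a0 b0; rewrite le_max a0.
Qed.

Lemma avg_norm_oo B phi f z (c : R) : finite_set B -> B z ->
  avg_norm +oo B phi f <= c -> `|f z| <= c.
Proof.
move=> fB Bz h; apply: le_trans h => /=.
by apply: (@bigmax_seq_ge _ (fun y => `|f y|)); rewrite in_fset_set ?inE.
Qed.

Lemma avg_norm_fin (s c : R) B phi f : finite_set B -> B !=set0 -> 0 < s -> 0 <= c ->
  (forall z, 0 <= phi z) -> avg_norm s%:E B phi f <= c ->
  \sum_(z \in B) `|f z| `^ s * phi z <= c `^ s * ncard B.
Proof.
move=> fB B0 s0 c0 phi0 /= h; have n0 := ncard_gt0 fB B0.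
have S0 : 0 <= \sum_(z \in B) `|f z| `^ s * phi z.
  by apply: fsum_ge0 => // z _; rewrite mulr_ge0 ?powR_ge0.
have := ler_powR_base (ltW s0) (powR_ge0 _ _) h.
rewrite -powRrM mulVf ?gt_eqF // powRr1 ?mulr_ge0 ?invr_ge0 ?(ltW n0) //.
by rewrite mulrC ler_pdivrMr.
Qed.

(** For p = +oo the norm ignores the weight, so the sum of the weighted powers of f is compared with
    the total weight of B instead of its cardinality; hence the two alternatives. *)
Lemma avg_norm_sum (eps c : R) p B phi f : finite_set B -> B !=set0 -> (1 < p)%E ->
  0 < eps -> 0 <= c -> (forall z, 0 <= phi z) -> avg_norm p B phi f <= c ->
  let s := finite_exponent eps p in
  \sum_(z \in B) `|f z| `^ s * phi z <= c `^ s * ncard B \/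
  \sum_(z \in B) `|f z| `^ s * phi z <= c `^ s * \sum_(z \in B) phi z.
Proof.
move=> fB B0 p1 eps0 c0 phi0 h; case: p p1 h => [s||] p1 h //=.
  left; apply: avg_norm_fin => //; move: p1; rewrite lte_fin; exact: lt_trans.
right; rewrite -fsum_scale //; apply: ler_fsum => // z Bz.
rewrite ler_wpM2r //; apply: ler_powR_base => //; first by rewrite invr_ge0 ltW.
exact: avg_norm_oo h.
Qed.

Lemma avg_norm_sum1 (eps c : R) p B f : finite_set B -> B !=set0 -> (1 < p)%E ->
  0 < eps -> 0 <= c -> avg_norm p B (fun=> 1) f <= c ->
  \sum_(z \in B) `|f z| `^ finite_exponent eps p <= c `^ finite_exponent eps p * ncard B.
Proof.
move=> fB B0 p1 eps0 c0 h.
have := avg_norm_sum fB B0 p1 eps0 c0 (fun=> ler01) h => /=.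
by rewrite -ncardE //; under eq_fsbigr do rewrite mulr1; case.
Qed.

Lemma avg_norm_ge1 p B f : finite_set B -> B !=set0 -> (1 < p)%E ->
  (forall z, 1 <= f z) -> 1 <= avg_norm p B (fun=> 1) f.
Proof.
move=> fB B0 p1 f1; have n0 := ncard_gt0 fB B0.
case: p p1 => [s||] //=.
  rewrite lte_fin => s1; have s0 : 0 < s by exact: lt_trans s1.
  have h : 1 <= (ncard B)^-1 * \sum_(z \in B) `|f z| `^ s * 1.
    rewrite mulrC ler_pdivlMr // mul1r ncardE //; apply: ler_fsum => // z _.
    have si : 0 <= s by exact: ltW.
    have := ler_powR_base si ler01 (le_trans (f1 z) (ler_norm _)).
    by rewrite powR1 mulr1.
  have si : 0 <= s^-1 by rewrite invr_ge0 ltW.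
  by have := ler_powR_base si ler01 h; rewrite powR1.
move=> _; have [z Bz] := B0; apply: le_trans (f1 z) _; apply: le_trans (ler_norm _) _.
exact: avg_norm_oo Bz (lexx _).
Qed.

(** Hoelder applied to 1 = theta^a (theta^(-s))^(1-a) with a = s/(1+s), where s is the exponent q:
    the mean of theta cannot be small when a moment of 1/theta is bounded. *)
Lemma avg_weight_inv (q : \bar R) B (theta : V -> R) :
  finite_set B -> B !=set0 -> (1 < q)%E -> (forall z, 0 < theta z) ->
  1 <= (ncard B)^-1 * (\sum_(z \in B) theta z) *
    avg_norm q B (fun=> 1) (fun z => Num.max 1 (theta z)^-1).
Proof.
move=> fB B0 q1 th0; have n0 := ncard_gt0 fB B0.
set M := avg_norm _ _ _ _.
have M1 : 1 <= M by apply: avg_norm_ge1 => // z; rewrite le_max lexx.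
have M0 : 0 < M by exact: lt_le_trans M1.
have S0 : 0 < \sum_(z \in B) theta z.
  have [z Bz] := B0; rewrite fsbig_finite //= (big_fsetD1 z) ?in_fset_set ?inE //=.
  by rewrite ltr_pwDl // big_seq sumr_ge0 // => y _; exact: ltW.
rewrite -mulrA mulrC ler_pdivlMr // mul1r.
case: q q1 @M M1 M0 => [s||] //; last first.
  move=> _ M M1 M0; rewrite ncardE // mulrC -fsum_scale //; apply: ler_fsum => // z Bz.
  have h : `|Num.max 1 (theta z)^-1| <= M by apply: (@avg_norm_oo B (fun=> 1) (fun z => Num.max 1 (theta z)^-1)).
  rewrite -ler_pdivrMr // mul1r; apply: le_trans h.
  by rewrite (le_trans _ (ler_norm _)) // le_max lexx orbT.
rewrite lte_fin => s1 M M1 M0; have s0 : 0 < s by exact: lt_trans s1.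
pose a := s / (1 + s).
have s10 : 0 < 1 + s by rewrite addr_gt0.
have a01 : 0 <= a <= 1.
  by rewrite /a divr_ge0 ?(ltW s0) ?(ltW s10) //= ler_pdivrMr // mul1r lerDr.
have a0 : 0 < a by rewrite divr_gt0.
have hM : \sum_(z \in B) ((theta z)^-1) `^ s <= M `^ s * ncard B.
  have := @avg_norm_fin s M B (fun=> 1) _ fB B0 s0 (ltW M0) (fun=> ler01) (lexx _).
  apply: le_trans; apply: ler_fsum => // z _; rewrite mulr1.
  apply: ler_powR_base; rewrite ?(ltW s0) ?invr_ge0 ?(ltW (th0 z)) //.
  by rewrite (le_trans _ (ler_norm _)) // le_max lexx orbT.
have h1 : ncard B <= (\sum_(z \in B) theta z) `^ a *
    (\sum_(z \in B) ((theta z)^-1) `^ s) `^ (1 - a).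
  rewrite ncard_sum // !fsum_fset //.
  have := @holder2 R (fset_set B) predT a (fun j => theta (val j))
    (fun j => ((theta (val j))^-1) `^ s) a01 (fun j _ => ltW (th0 _)) (fun j _ => powR_ge0 _ _).
  apply: le_trans; apply: ler_sum => j _; apply: eq_ler.
  have t0 := th0 (val j); rewrite -powRrM.
  have -> : s * (1 - a) = a by rewrite /a; field; rewrite gt_eqF.
  by rewrite -powRM ?invr_ge0 ?(ltW t0) // divff ?powR1 // gt_eqF.
have h2 : ncard B <= (\sum_(z \in B) theta z) `^ a * (M `^ s * ncard B) `^ (1 - a).
  apply: (le_trans h1); rewrite ler_wpM2l ?powR_ge0 //; apply: ler_powR_base => //.
    by case/andP: a01 => _; rewrite subr_ge0.
  by apply: fsum_ge0 => // z _; rewrite powR_ge0.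
have {}h2 : ncard B `^ a <= (M * \sum_(z \in B) theta z) `^ a.
  rewrite mulrC powRM ?(ltW M0) ?(ltW S0) //.
  rewrite -(ler_pM2r (powR_gt0 (1 - a) n0)) -powR_addr // addrCA subrr addr0.
  rewrite powRr1 ?(ltW n0) //; apply: (le_trans h2).
  rewrite powRM ?powR_ge0 ?(ltW n0) // -powRrM.
  have -> : s * (1 - a) = a by rewrite /a; field; rewrite gt_eqF.
  by rewrite mulrA.
have ai : 0 <= a^-1 by rewrite invr_ge0 ltW.
have := ler_powR_base ai (powR_ge0 _ _) h2.
rewrite -!powRrM divff ?gt_eqF // !powRr1 ?(ltW n0) ?mulr_ge0 ?(ltW M0) ?(ltW S0) //.
by rewrite mulrC.
Qed.

(** The theta-weighted norm is the one factor in (I) that may drop below 1, since theta may be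
    small. Multiplication by the norm of 1/theta repairs this, so that the bound on the whole
    product bounds the factors separately. *)
Lemma avg_norm_ratio_ge (p q : \bar R) B (theta f : V -> R) :
  finite_set B -> B !=set0 -> (1 < p)%E -> (1 < q)%E -> (forall z, 0 < theta z) ->
  (forall z, 1 <= f z) ->
  1 <= avg_norm p B theta f * avg_norm q B (fun=> 1) (fun z => Num.max 1 (theta z)^-1).
Proof.
move=> fB B0 p1 q1 th0 f1.
have := avg_weight_inv fB B0 q1 th0.
set M := avg_norm q _ _ _.
have M1 : 1 <= M by apply: avg_norm_ge1 => // z; rewrite le_max lexx.
have M0 : 0 < M by exact: lt_le_trans M1.
have n0 := ncard_gt0 fB B0.
set W := _ * \sum_(z \in B) theta z => hW.
case: p p1 => [s||] //; last first.
  move=> _; have [z Bz] := B0.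
  have h : 1 <= avg_norm +oo B theta f.
    apply: le_trans (f1 z) _; apply: le_trans (ler_norm _) _.
    exact: avg_norm_oo Bz (lexx _).
  by rewrite -[leLHS]mulr1 ler_pM.
rewrite lte_fin => s1; have s0 : 0 < s by exact: lt_trans s1.
have si : 0 <= s^-1 by rewrite invr_ge0 ltW.
have W0 : M^-1 <= W by rewrite -[leLHS]mul1r ler_pdivrMr.
have h : M^-1 `^ s^-1 <= avg_norm s%:E B theta f.
  apply: ler_powR_base => //; first by rewrite invr_ge0 ltW.
  apply: (le_trans W0); rewrite ler_wpM2l ?invr_ge0 ?(ltW n0) //.
  apply: ler_fsum => // z _; rewrite ler_peMl ?(ltW (th0 z)) //.
  have := ler_powR_base (ltW s0) ler01 (le_trans (f1 z) (ler_norm _)).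
  by rewrite powR1.
have h' : M^-1 <= M^-1 `^ s^-1.
  rewrite -[leLHS]powRr1 ?invr_ge0 ?(ltW M0) //; apply: ger_powR.
    by rewrite invr_gt0 M0 invf_le1.
  by rewrite invf_le1 // ltW.
by rewrite -ler_pdivrMr // mul1r (le_trans h').
Qed.

End AveragedNorms.

Section RegularScale.
Context {R : realType}.

Lemma finite_exponents (p q r : \bar R) (D : R) :
  (1 < p)%E -> (1 < q)%E -> (1 < r)%E ->
  (r^-1 + p^-1 * (1 - r^-1) + q^-1 < D%:E)%E ->
  exists eps : R, [/\ 0 < eps,
    [/\ 1 < finite_exponent eps p, 1 < finite_exponent eps q & 1 < finite_exponent eps r] &
    (finite_exponent eps r)^-1 + (finite_exponent eps p)^-1 * (1 - (finite_exponent eps r)^-1)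
      + (finite_exponent eps q)^-1 < D].
Proof.
move=> p1 q1 r1 h.
pose inv (s : \bar R) : R := if s is s'%:E then s'^-1 else 0.
have invE s : (1 < s)%E -> (s^-1 = (inv s)%:E)%E.
  case: s => [s|_|//]; last exact: invey.
  by rewrite lte_fin => s1; rewrite inver gt_eqF // (lt_trans ltr01).
have inv01 s : (1 < s)%E -> 0 <= inv s < 1.
  case: s => [s||] //=; rewrite ?lexx ?ltr01 // lte_fin => s1.
  by rewrite invr_ge0 invf_lt1 ?(lt_trans ltr01) // (le_trans ler01 (ltW s1)).
move: h; rewrite !invE // -EFinB -EFinM -!EFinD lte_fin => h.
set a := inv p in h; set b := inv r in h; set c := inv q in h.
have /andP[a0 a1] : 0 <= a < 1 by exact: inv01.
have /andP[b0 b1] : 0 <= b < 1 by exact: inv01.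
have /andP[c0 c1] : 0 <= c < 1 by exact: inv01.
(* Each reciprocal exponent grows by at most eps and the left-hand side by at most 3 eps, so a
   quarter of the gap suffices; eps <= 1/2 keeps 1/eps above 1. *)
pose eps := Num.min 2^-1 ((D - (b + a * (1 - b) + c)) / 4).
have gap : 0 < (D - (b + a * (1 - b) + c)) / 4 by rewrite divr_gt0 // subr_gt0.
have eps0 : 0 < eps by rewrite lt_min gap andbT invr_gt0.
have eps1 : eps <= 2^-1 by rewrite ge_min lexx.
have eps2 : eps <= (D - (b + a * (1 - b) + c)) / 4 by rewrite ge_min lexx orbT.
have fe s : (1 < s)%E -> 1 < finite_exponent eps s.
  case: s => [s||] //= _; rewrite -[ltLHS]invr1 ltf_pV2 ?posrE //.
  by apply: le_lt_trans eps1 _; rewrite invf_lt1 // ltr1n.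
have fi s : (1 < s)%E -> inv s <= (finite_exponent eps s)^-1 <= inv s + eps.
  case: s => [s||] //= _; first by rewrite lexx lerDl ltW.
  by rewrite invrK add0r lexx ltW.
exists eps; split => //; first by split; exact: fe.
have := fi _ p1; have := fi _ q1; have := fi _ r1; rewrite -/a -/b -/c.
have := fe _ p1; have := fe _ r1.
move: (finite_exponent eps p) (finite_exponent eps q) (finite_exponent eps r) => P Q S S1 P1.
have Pi1 : P^-1 < 1 by rewrite invf_lt1 // (lt_trans ltr01).
have Si1 : S^-1 < 1 by rewrite invf_lt1 // (lt_trans ltr01).
move=> /andP[s1 s2] /andP[q1' q2] /andP[p1' p2].
have h1 : 0 <= (b + eps - S^-1) * (1 - P^-1) by rewrite mulr_ge0 // subr_ge0 // ltW.
have h2 : 0 <= (a + eps - P^-1) * (1 - b) by rewrite mulr_ge0 // subr_ge0 // ltW.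
have h3 : 0 <= eps * P^-1 by rewrite mulr_ge0 ?(ltW eps0) //; lra.
have h4 : 0 <= eps * b by rewrite mulr_ge0 ?(ltW eps0).
move: h1 h2 h3 h4 q2 eps2 eps0; clear.
move: (P^-1) (S^-1) (Q^-1) eps => u v w e; lra.
Qed.

Lemma three_factors_le (Am An At M C : R) : 0 <= Am -> 1 <= An -> 1 <= At -> 1 <= M ->
  1 <= Am * M -> Am * An * At * M <= C -> [/\ Am <= C, An <= C & At <= C].
Proof.
move=> m0 n1 t1 M1 mM h.
have n0 : 0 <= An by lra. have t0 : 0 <= At by lra. have M0 : 0 <= M by lra.
have e1 : Am <= Am * An * At * M.
  rewrite -!mulrA ler_peMr // -[leLHS]mulr1 ler_pM // -[leLHS]mulr1 ler_pM //.
have e2 : An <= Am * M * An * At.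
  rewrite -[leLHS]mulr1 ler_pM // -[leLHS]mul1r ler_pM //.
have e3 : At <= Am * M * An * At.
  rewrite -[leLHS]mul1r ler_pM // -[leLHS]mulr1 ler_pM //.
have e : Am * M * An * At = Am * An * At * M by ring.
split; [exact: le_trans h|rewrite e in e2; exact: le_trans h|rewrite e in e3; exact: le_trans h].
Qed.

(** The scale is n/2 so that the doubled radius is the integer n, for which the hypotheses on the
    infinite graph are stated. *)
Lemma restriction_regular_scale (d d' Creg CS Cint : R) (p q r : \bar R) (eps : R) :
  2 <= d -> d <= d' -> 0 < Creg -> 0 < CS -> 1 <= Cint ->
  (1 < p)%E -> (1 < q)%E -> (1 < r)%E -> 0 < eps ->
  1 < finite_exponent eps p -> 1 < finite_exponent eps r ->
  exists C : R, 0 < C /\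
  forall (V : choiceType) (E : rel V) (N1 N2 N4 : V -> nat)
    (Gr : infinite_graph E) (theta : V -> R) (omega : V -> V -> R)
    (th0 : forall x, 0 < theta x) (om : conductances E omega) (x : V) (K n : nat),
  volume_regular E d Creg N1 -> local_sobolev E d d' CS N2 ->
  integrability E omega theta p q r Cint N4 ->
  (0 < n)%N -> (maxn (maxn (N1 x) (N2 x)) (N4 x) <= n)%N ->
  regular_scale (restriction Gr th0 om x K) d d' (finite_exponent eps p)
    (finite_exponent eps q) (finite_exponent eps r) C (n%:R / 2).
Proof.
move=> hd hd' hCreg hCS hCint p1 q1 r1 eps0 P1 S1.
set P := finite_exponent eps p; set Q := finite_exponent eps q; set S := finite_exponent eps r.
have I0 : 0 <= Cint by exact: le_trans hCint.
have [W WE] : exists W, W = Creg * 2 `^ d by eexists.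
have W0 : 0 < W by rewrite WE mulr_gt0 ?powR_gt0.
(* The summands serve the different estimates of [regular_scale]. The product of the powers P and S
   is for p = +oo, where the total theta-weight of the ball has to be bounded through a moment of
   theta. *)
pose C := Cint `^ Q * W + Cint `^ S * W + (Cint `^ P + Cint `^ P * Cint `^ S) * W
  + CS * 2 `^ (1 - d / d').
have c1 : 0 <= Cint `^ Q * W by rewrite mulr_ge0 ?powR_ge0 // ltW.
have c2 : 0 <= Cint `^ S * W by rewrite mulr_ge0 ?powR_ge0 // ltW.
have c3 : 0 <= Cint `^ P * W by rewrite mulr_ge0 ?powR_ge0 // ltW.
have c4 : 0 <= Cint `^ P * Cint `^ S * W by rewrite mulr_ge0 ?mulr_ge0 ?powR_ge0 // ltW.
have c5 : 0 < CS * 2 `^ (1 - d / d') by rewrite mulr_gt0 ?powR_gt0.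
have C0 : 0 < C by rewrite /C mulrDl; lra.
exists C; split => //.
move=> V E N1 N2 N4 Gr theta omega th0 om x K n hvol hsob hint n0 hn.
have [hn1 hn2 hn4] : [/\ (N1 x <= n)%N, (N2 x <= n)%N & (N4 x <= n)%N].
  by move: hn; rewrite !geq_max => /andP[/andP[]].
have m2 : 2 * (n%:R / 2) = n%:R :> R by field.
set B := gball (R := R) E x n.
have fB : finite_set B by exact: gball_finite.
have B0 : B !=set0 by exists x; exact: gball_center.
have n0' : 0 < n%:R :> R by rewrite ltr0n.
have md : 0 <= (n%:R / 2) `^ d :> R by exact: powR_ge0.
have NB : ncard B <= W * (n%:R / 2) `^ d.
  have /andP[_ h] := hvol x n hn1; apply: (le_trans h).
  rewrite WE -mulrA -powRM ?divr_ge0 ?ler0n // m2 //.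
have mu0 z : 0 <= mu E omega z.
  by apply: fsum_ge0 => [|y /= /om[/ltW]//]; exact: (graph_locally_finite Gr).
have nu0 z : 0 <= nu E omega z.
  apply: fsum_ge0 => [|y /= /om[/ltW h _]]; first exact: (graph_locally_finite Gr).
  by rewrite invr_ge0.
have th0' z : 0 <= theta z by exact: ltW.
have f1 (g : V -> R) z : 1 <= Num.max 1 (g z) by rewrite le_max lexx.
have [hm hnu hth] := three_factors_le (avg_norm_ge0 _ _ _ _)
  (avg_norm_ge1 fB B0 q1 (f1 (nu E omega))) (avg_norm_ge1 fB B0 r1 (f1 theta))
  (avg_norm_ge1 fB B0 q1 (f1 (fun z => (theta z)^-1)))
  (avg_norm_ratio_ge fB B0 p1 q1 th0 (f1 (fun z => mu E omega z / theta z)))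
  (hint x n hn4).
have n1' (g : V -> R) z : `|Num.max 1 (g z)| = Num.max 1 (g z).
  by rewrite ger0_norm // (le_trans ler01) // f1.
have le1 (g : V -> R) z : g z <= Num.max 1 (g z) by rewrite le_max lexx orbT.
have Q0 : 0 <= Q.
  rewrite /Q; case: (q) q1 => [s||] //=; last by rewrite invr_ge0 ltW.
  by rewrite lte_fin => s1; apply: le_trans (ltW s1).
have S0 : 0 <= S by exact: le_trans (ltW S1).
have P0 : 0 <= P by exact: le_trans (ltW P1).
have cP : 0 <= Cint `^ P by exact: powR_ge0.
have hnu' := avg_norm_sum1 fB B0 q1 eps0 I0 hnu.
have hth' := avg_norm_sum1 fB B0 r1 eps0 I0 hth.
have sumth : \sum_(z \in B) theta z `^ S <= Cint `^ S * ncard B.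
  apply: le_trans hth'; apply: ler_fsum => // z _; rewrite n1'.
  exact: ler_powR_base.
have sumth1 : \sum_(z \in B) theta z <= Cint `^ S * ncard B.
  apply: le_trans hth'; apply: ler_fsum => // z _; rewrite n1'.
  apply: (le_trans (le1 theta z)); apply: le1r_powR; [exact: f1|exact: ltW].
have NS : Cint `^ S * ncard B <= Cint `^ S * (W * (n%:R / 2) `^ d).
  by rewrite ler_wpM2l ?powR_ge0.
split; rewrite ?m2.
- apply: (@le_trans _ _ (\sum_(z \in B) nu E omega z `^ Q)).
    exact: (@ball_sum_le R V E Gr x K (fun z => nu E omega z `^ Q) n (fun z => powR_ge0 _ _)).
  apply: (@le_trans _ _ (Cint `^ Q * ncard B)).
    apply: le_trans hnu'; apply: ler_fsum => // z _; rewrite n1'.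
    exact: ler_powR_base.
  apply: (@le_trans _ _ (Cint `^ Q * (W * (n%:R / 2) `^ d))).
    by rewrite ler_wpM2l ?powR_ge0.
  rewrite mulrA ler_wpM2r // /C mulrDl; lra.
- apply: (@le_trans _ _ (\sum_(z \in B) `|Num.max 1 (mu E omega z / theta z)| `^ P * theta z)).
    have := @ball_sum_le R V E Gr x K
      (fun z => `|Num.max 1 (mu E omega z / theta z)| `^ P * theta z) n.
    move=> /(_ (fun z => mulr_ge0 (powR_ge0 _ _) (th0' z))); apply: le_trans.
    apply: eq_ler; apply: eq_bigr => y _.
    by rewrite /= (n1' (fun z => mu E omega z / theta z)).
  have := avg_norm_sum fB B0 p1 eps0 I0 th0' hm => /=; rewrite -/P; case=> h; apply: (le_trans h).
    apply: (@le_trans _ _ (Cint `^ P * (W * (n%:R / 2) `^ d))).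
      by rewrite ler_wpM2l.
    by rewrite mulrA ler_wpM2r // /C mulrDl; lra.
  apply: (@le_trans _ _ (Cint `^ P * (Cint `^ S * (W * (n%:R / 2) `^ d)))).
    by rewrite ler_wpM2l // (le_trans sumth1).
  by rewrite !mulrA ler_wpM2r // /C mulrDl; lra.
- apply: (@le_trans _ _ (\sum_(z \in B) theta z `^ S)).
    exact: (@ball_sum_le R V E Gr x K (fun z => theta z `^ S) n (fun z => powR_ge0 _ _)).
  apply: (le_trans sumth); apply: (le_trans NS).
  by rewrite mulrA ler_wpM2r // /C mulrDl; lra.
- move=> u u0 us uB.
  have d1 : 1 < d' by lra.
  have h := restriction_sobolev hsob hn2 hCS d1 u0 us uB.
  apply: (le_trans h).
  have T0 : 0 <= \sum_y \sum_(z | 0 < wc (restriction Gr th0 om x K) y z) `|u y - u z|.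
    by apply: sumr_ge0 => y _; exact: sumr_ge0.
  rewrite ler_wpM2r //.
  have -> : n%:R `^ (1 - d / d') = 2 `^ (1 - d / d') * (n%:R / 2) `^ (1 - d / d') :> R.
    by rewrite -powRM ?divr_ge0 ?ler0n // m2.
  by rewrite mulrA ler_wpM2r ?powR_ge0 // /C mulrDl; lra.
Qed.

End RegularScale.

(** * The intrinsic metric and the choice of the tilt *)

Section IntrinsicMetric.
Context {R : realType}.

Lemma expR_sub1_sqr_le (x : R) : (expR x - 1) ^+ 2 <= x ^+ 2 * expR (2 * `|x|).
Proof.
have h : `|expR x - 1| <= `|x| * expR `|x|.
  have [x0|x0] := leP 0 x.
    rewrite !ger0_norm //; last by rewrite subr_ge0; have := expR_ge1Dx x; lra.
    have := expR_ge1Dx (- x); move=> /(ler_wpM2r (expR_ge0 x)).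
    rewrite mulrC [X in _ <= X]mulrC expRxMexpNx_1; lra.
  rewrite [X in _ <= X * _]ltr0_norm // ler0_norm; last first.
    by rewrite subr_le0 expR_le1 ltW.
  apply: (@le_trans _ _ (- x * 1)); first by have := expR_ge1Dx x; lra.
  rewrite ler_wpM2l ?oppr_ge0 ?(ltW x0) //.
  by have := expR_ge1Dx `|x|; have := normr_ge0 x; lra.
rewrite -real_normK ?num_real //; apply: (le_trans (ler_sqr_base (normr_ge0 _) h)).
rewrite exprMn real_normK ?num_real // ler_wpM2l ?sqr_ge0 //.
by rewrite (_ : 2 * `|x| = `|x| * 2%:R) ?expRM_natr // mulrC.
Qed.

Lemma tilt_le (x u : R) : `|x| <= u -> tilt x <= 2 * u ^+ 2 * expR (2 * u).
Proof.
move=> xu; have u0 : 0 <= u by exact: le_trans xu.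
have h (y : R) : `|y| = `|x| -> (expR y - 1) ^+ 2 <= u ^+ 2 * expR (2 * u).
  move=> yx; apply: (le_trans (expR_sub1_sqr_le y)).
  rewrite -(real_normK (num_real y)) yx; apply: ler_pM; rewrite ?sqr_ge0 ?expR_ge0 //.
    exact: ler_sqr_base.
  by rewrite ler_expR ler_pM2l.
have h1 := h x erefl; have h2 := h (- x) (normrN x).
by rewrite /tilt; lra.
Qed.

Section Metric.
Context {V : choiceType} (E : rel V).
Hypothesis Gr : infinite_graph E.
Variables (omega : V -> V -> R) (theta : V -> R).
Hypothesis th0 : forall x, 0 < theta x.
Hypothesis om : conductances E omega.

Definition edge_length (y z : V) : R :=
  Num.sqrt (Num.min 1 (Num.min (theta y) (theta z) / omega y z)).

Definition path_length (x : V) (p : seq V) : R :=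
  \sum_(i < size p) edge_length (nth x (x :: p) i) (nth x (x :: p) i.+1).

Local Notation D := (intrinsic_dist E omega theta).

Lemma path_length_rcons x p z :
  path_length x (rcons p z) = path_length x p + edge_length (last x p) z.
Proof.
rewrite /path_length size_rcons big_ord_recr /=; congr (_ + edge_length _ _).
- apply: eq_bigr => i _; rewrite -rcons_cons !nth_rcons /= ltnS (ltnW (ltn_ord i)).
  by rewrite ltn_ord.
- by rewrite -rcons_cons nth_rcons /= ltnS leqnn -last_nth.
- by rewrite nth_rcons ltnn eqxx.
Qed.

Lemma path_length_ge0 x p : 0 <= path_length x p.
Proof. by apply: sumr_ge0 => i _; exact: sqrtr_ge0. Qed.

Lemma intrinsic_distE x y : D x y = inf [set path_length x p | p in paths E x y].
Proof. by []. Qed.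

Lemma intrinsic_dist_le x p : path E x p -> D x (last x p) <= path_length x p.
Proof.
move=> h; rewrite intrinsic_distE; apply: ge_inf; last by exists p.
by exists 0 => _ [q _ <-]; exact: path_length_ge0.
Qed.

Lemma intrinsic_dist_ge0 x y : 0 <= D x y.
Proof.
have [p [hp hl]] := graph_connected Gr x y.
rewrite intrinsic_distE; apply: lb_le_inf; first by exists (path_length x p), p.
by move=> _ [q _ <-]; exact: path_length_ge0.
Qed.

Lemma intrinsic_dist_refl x : D x x = 0.
Proof.
apply/eqP; rewrite eq_le intrinsic_dist_ge0 andbT.
have := @intrinsic_dist_le x [::] isT; rewrite /path_length big_ord0; exact.
Qed.

Lemma intrinsic_dist_step x y z : E y z -> D x z <= D x y + edge_length y z.
Proof.
move=> yz; rewrite -lerBlDr [leRHS]intrinsic_distE.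
have [p [hp hl]] := graph_connected Gr x y.
apply: lb_le_inf; first by exists (path_length x p), p.
move=> _ [q [hq lq] <-]; rewrite lerBlDr -[y]lq -path_length_rcons.
have := @intrinsic_dist_le x (rcons q z); rewrite last_rcons; apply.
by rewrite rcons_path hq lq yz.
Qed.

Lemma edge_length_sym y z : E y z -> edge_length z y = edge_length y z.
Proof.
by move=> /om[_ e]; rewrite /edge_length e (minC (theta z)).
Qed.

Lemma intrinsic_dist_adj x y z : E y z -> `|D x y - D x z| <= edge_length y z.
Proof.
move=> yz; have zy : E z y by rewrite (edge_sym Gr).
have := intrinsic_dist_step x yz; have := intrinsic_dist_step x zy.
by rewrite edge_length_sym // ler_norml => h1 h2; apply/andP; split; lra.
Qed.

Lemma edge_length_le1 y z : edge_length y z <= 1.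
Proof.
rewrite /edge_length -[leRHS]sqrtr1 ler_wsqrtr // ge_min lexx //.
Qed.

(** The property that makes the metric intrinsic: the rate omega/theta of a jump times its squared
    length is at most 1. *)
Lemma edge_length_sqr y z : E y z -> omega y z * edge_length y z ^+ 2 <= theta y.
Proof.
move=> /om[] o0 _; have m0 : 0 <= Num.min (theta y) (theta z) / omega y z.
  by rewrite divr_ge0 ?(ltW o0) // le_min !ltW.
rewrite /edge_length sqr_sqrtr; last by rewrite le_min ler01.
apply: (@le_trans _ _ (omega y z * (Num.min (theta y) (theta z) / omega y z))).
  by rewrite ler_pM2l // ge_min lexx orbT.
by rewrite mulrCA divff ?gt_eqF // mulr1 ge_min lexx.
Qed.

(** Each of the at most [Cdeg] neighbours contributes omega l^2 <= theta times 2 lam^2 exp(2 lam l),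
    where l is the edge length, and the cap l <= 1 controls the exponential. *)
Lemma restriction_tilt (Cdeg lam : R) (x : V) (K : nat) (z : verts (R := R) E x K) :
  bounded_degree E Cdeg -> 0 <= lam ->
  \sum_y wc (restriction Gr th0 om x K) z y * tilt (lam * D x (val y) - lam * D x (val z))
    <= (Cdeg * (2 * lam ^+ 2 * expR (2 * lam))) * wtheta (restriction Gr th0 om x K) z.
Proof.
move=> hdeg lam0; set c := 2 * lam ^+ 2 * expR (2 * lam).
have c0 : 0 <= c by rewrite mulr_ge0 ?expR_ge0 // mulr_ge0 ?sqr_ge0.
have fN := neighbors_finite Gr (val z).
apply: (@le_trans _ _ (\sum_(y \in [set y | E (val z) y]) (theta (val z) * c))); last first.
  have -> : \sum_(y \in [set y | E (val z) y]) (theta (val z) * c) =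
      theta (val z) * c * ncard [set y | E (val z) y].
    by rewrite ncardE // -fsum_scale //; apply: eq_fsbigr => y _; rewrite mulr1.
  rewrite [leRHS](_ : _ = theta (val z) * c * Cdeg); last by rewrite /=; ring.
  by rewrite ler_wpM2l ?hdeg // mulr_ge0 // ltW.
apply: le_trans (fsum_fintype_le (e := val : verts (R := R) E x K -> V) val_inj fN _); last first.
  by move=> y _; rewrite mulr_ge0 // ltW.
rewrite [leRHS]big_mkcond /=; apply: ler_sum => y _; rewrite /cond.
case: asboolP => /= h; last by rewrite ifF ?mul0r //; apply/negP.
rewrite h -mulrBr; have zy : E (val y) (val z) by rewrite (edge_sym Gr).
have hl : `|lam * (D x (val y) - D x (val z))| <= lam * edge_length (val z) (val y).
  rewrite normrM (ger0_norm lam0) ler_wpM2l // -(edge_length_sym h).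
  exact: intrinsic_dist_adj.
have [om0 _] := om h.
apply: (le_trans (ler_wpM2l (ltW om0) (tilt_le hl))).
set l := edge_length _ _; have l1 : l <= 1 by exact: edge_length_le1.
have l0 : 0 <= l by exact: sqrtr_ge0.
have lsq : omega (val z) (val y) * l ^+ 2 <= theta (val z) by exact: edge_length_sqr.
rewrite [leLHS](_ : _ = (omega (val z) (val y) * l ^+ 2) *
  (2 * lam ^+ 2 * expR (2 * (lam * l)))); last by ring.
apply: ler_pM => //.
- by rewrite mulr_ge0 ?sqr_ge0 // ltW.
- by rewrite mulr_ge0 ?expR_ge0 // mulr_ge0 ?sqr_ge0.
rewrite ler_wpM2l ?mulr_ge0 ?sqr_ge0 // ler_expR ler_pM2l //.
by rewrite ler_piMr.
Qed.

End Metric.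

(* lam is a small multiple of D / T in the first regime, and ln (D / T) / 8 in the
   second. *)
Lemma optimal_tilt (C : R) : 0 < C ->
  exists c1 c3 c4 c5 : R, [/\ 0 < c1, 0 < c3, 0 < c4, 0 < c5 &
  forall T D : R, 1 <= T -> 0 <= D ->
  (D <= c1 * T -> exists2 lam, 0 <= lam &
     - (lam * D) + C * lam ^+ 2 * expR (2 * lam) * T <= - (c3 * (D ^+ 2 / T))) /\
  (c5 * T <= D -> exists2 lam, 0 <= lam &
     - (lam * D) + C * lam ^+ 2 * expR (2 * lam) * T
       <= - (c4 * (D * Num.max 1 (ln (D / T)))))].
Proof.
move=> C0.
(* Chosen so that C exp(2) e <= 1/2: with lam = e D / T the error is at most half of the gain lam D,
   and e/2 is left for the third constant. *)
pose e := Num.min 1 (2 * C * expR 2)^-1.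
have e0 : 0 < e by rewrite lt_min ltr01 invr_gt0 !mulr_gt0 ?expR_gt0.
have e1 : e <= 1 by rewrite ge_min lexx.
have e2 : C * expR 2 * e <= 2^-1.
  have : e <= (2 * C * expR 2)^-1 by rewrite ge_min lexx orbT.
  rewrite -[leRHS]mul1r ler_pdivlMr ?mulr_gt0 ?expR_gt0 // => h; lra.
(* [expR 1] makes ln (D / T) at least 1, and (16 C)^2 makes 16 C at most sqrt (D / T). *)
pose c5 := Num.max (expR 1) ((16 * C) ^+ 2).
have c5e : expR 1 <= c5 by rewrite le_max lexx.
have c5C : (16 * C) ^+ 2 <= c5 by rewrite le_max lexx orbT.
have c50 : 0 < c5 by apply: lt_le_trans c5e; exact: expR_gt0.
exists 1, (e / 2), 16^-1, c5; split => //; first by rewrite divr_gt0.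
move=> T D T1 D0; have T0 : 0 < T by exact: lt_le_trans T1.
split.
  rewrite mul1r => DT; pose lam := e * (D / T).
  have DT0 : 0 <= D / T by rewrite divr_ge0 // ltW.
  have lam0 : 0 <= lam by rewrite mulr_ge0 // ltW.
  have DT1 : D / T <= 1 by rewrite ler_pdivrMr // mul1r.
  have lam1 : lam <= 1 by rewrite /lam -[leRHS]mulr1 ler_pM // ltW.
  exists lam => //.
  have h1 : C * lam ^+ 2 * expR (2 * lam) * T <= C * lam ^+ 2 * expR 2 * T.
    have CL : 0 <= C * lam ^+ 2 by apply: mulr_ge0; [exact: ltW|exact: sqr_ge0].
    by rewrite ler_pM2r // ler_wpM2l // ler_expR; lra.
  have h2 : C * lam ^+ 2 * expR 2 * T = (C * expR 2 * e) * (e * (D ^+ 2 / T)).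
    by rewrite /lam; field; rewrite gt_eqF.
  have h3 : lam * D = e * (D ^+ 2 / T) by rewrite /lam; field; rewrite gt_eqF.
  have h4 : 0 <= e * (D ^+ 2 / T) by rewrite mulr_ge0 ?divr_ge0 ?sqr_ge0 // ltW.
  have := ler_wpM2r h4 e2; rewrite h3; move: h1; rewrite h2; lra.
move=> DT.
have DT5 : c5 <= D / T by rewrite ler_pdivlMr.
have DTp : 0 < D / T by exact: lt_le_trans DT5.
pose L := ln (D / T).
have eL : expR L = D / T by rewrite lnK // posrE.
have L1 : 1 <= L by rewrite -ler_expR eL (le_trans c5e).
rewrite (max_idPr L1); exists (L / 8); first lra.
have hl : (L / 8) ^+ 2 * expR (2 * (L / 8)) <= expR (L / 2).
  have h : L / 8 <= expR (L / 8) by have := expR_ge1Dx (L / 8); lra.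
  have h8 : 0 <= L / 8 by lra.
  have := ler_wpM2r (expR_ge0 (2 * (L / 8))) (ler_sqr_base h8 h).
  move=> /le_trans; apply; apply: eq_ler; rewrite -expRM_natr -expRD.
  by congr expR; field.
have eL2 : expR (L / 2) * expR (L / 2) = D / T.
  by rewrite -expRD -eL; congr expR; field.
have hC : 16 * C <= expR (L / 2).
  rewrite -(@ler_pXn2r R 2) ?nnegrE ?expR_ge0 ?mulr_ge0 ?(ltW C0) //.
  by apply: (le_trans c5C); rewrite expr2 eL2.
have TE : T * expR (L / 2) * expR (L / 2) = D.
  by rewrite -mulrA eL2 mulrCA divff ?mulr1 // gt_eqF.
have h1 : 16 * (C * (T * expR (L / 2))) <= D.
  rewrite -TE (_ : 16 * _ = (T * expR (L / 2)) * (16 * C)); last by ring.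
  by rewrite ler_wpM2l // mulr_ge0 ?expR_ge0 // ltW.
have h2 : C * (L / 8) ^+ 2 * expR (2 * (L / 8)) * T <= C * (T * expR (L / 2)).
  rewrite -[_ * _ ^+ 2 * _]mulrA -mulrA ler_pM2l // mulrC ler_pM2l //.
have h3 : D <= D * L by rewrite ler_peMr.
lra.
Qed.

End IntrinsicMetric.

(** * The two regimes of the bound for the killed walk *)

Section KilledHeatBound.
Context {R : realType}.

(** The ball of radius 0 contains its centre while 0^d = 0, so volume regularity excludes the
    threshold 0. This is how t >= 1 follows from the hypothesis on sqrt t. *)
Lemma volume_radius_gt0 (V : choiceType) (E : rel V) (d Creg : R) (N1 : V -> nat) x :
  infinite_graph E -> 0 < d -> volume_regular E d Creg N1 -> (0 < N1 x)%N.
Proof.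
move=> Gr d0 hvol; rewrite lt0n; apply/eqP => Nx.
have /andP[_] := hvol x 0%N (eq_leq Nx).
rewrite powR0 ?gt_eqF // mulr0 leNgt => /negP; apply.
by apply: ncard_gt0; [exact: gball_finite|exists x; exact: gball_center].
Qed.

Lemma killed_heat_bound (d d' Cdeg Creg CS Cint : R) (p q r : \bar R) :
  2 <= d -> d <= d' -> 1 <= Cdeg -> 0 < Creg -> 0 < CS -> 1 <= Cint ->
  (1 < p)%E -> (1 < q)%E -> (1 < r)%E ->
  (r^-1 + p^-1 * (1 - r^-1) + q^-1 < (2 / d')%:E)%E ->
  exists c1 c2 c3 c4 c5 gamma : R,
    [/\ 0 < c1, 0 < c2, 0 < c3, 0 < c4 & 0 < c5] /\
  forall (V : choiceType) (E : rel V) (N1 N2 N4 : V -> nat)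
    (Gr : infinite_graph E) (theta : V -> R) (omega : V -> V -> R)
    (th0 : forall x, 0 < theta x) (om : conductances E omega),
  bounded_degree E Cdeg -> volume_regular E d Creg N1 ->
  local_sobolev E d d' CS N2 -> integrability E omega theta p q r Cint N4 ->
  forall (x : V) (K : nat) (t : R) (x' y : verts (R := R) E x K)
    (h : R -> verts (R := R) E x K -> R),
  let G := restriction Gr th0 om x K in
  0 < t -> (maxn (maxn (N1 x) (N2 x)) (N4 x))%:R <= Num.sqrt t ->
  val x' = x -> winn G y -> killed_solution G h ->
  (forall z, h 0 z = delta_density G y z) ->
  let D := intrinsic_dist E omega theta x (val y) in
  let prefactor :=
    c2 * t `^ (- (d / 2)) * (1 + graph_dist E x (val y) / Num.sqrt t) `^ gamma in
  (D <= c1 * t -> h t x' <= prefactor * expR (- (c3 * (D ^+ 2 / t)))) /\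
  (c5 * t <= D ->
     h t x' <= prefactor * expR (- (c4 * (D * Num.max 1 (ln (D / t)))))).
Proof.
move=> hd hdd' hCdeg hCreg hCS hCint p1 q1 r1 hpqr.
have [eps [eps0 [P1 Q1 S1] hcond]] := finite_exponents p1 q1 r1 hpqr.
have hd' : 2 <= d' by exact: le_trans hdd'.
have [C [C0 hscale]] := restriction_regular_scale hd hdd' hCreg hCS hCint p1 q1 r1 eps0 P1 S1.
have [Q [C2 [M [Q0 C20 hfin]]]] := finite_heat_bound hd hd' P1 Q1 S1 hcond C0.
have CC0 : 0 < C2 * (Cdeg * 2).
  by rewrite mulr_gt0 // mulr_gt0 // (lt_le_trans ltr01).
have [c1 [c3 [c4 [c5 [c10 c30 c40 c50 hopt]]]]] := optimal_tilt CC0.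
exists c1, Q, c3, c4, c5, M%:R; split => //.
move=> V E N1 N2 N4 Gr theta omega th0 om hdeg hvol hsob hint x K t x' y h G t0 hN xx yi hP h0.
set D := intrinsic_dist E omega theta x (val y); cbv zeta.
have s0 : 0 < Num.sqrt t by rewrite sqrtr_gt0.
have d0 : 0 < d by lra.
have s1 : 1 <= Num.sqrt t.
  apply: le_trans hN; rewrite ler1n; apply: leq_trans (volume_radius_gt0 x Gr d0 hvol) _.
  by rewrite !leq_max leqnn.
have ss : Num.sqrt t ^+ 2 = t by rewrite sqr_sqrtr // ltW.
have t1 : 1 <= t by rewrite -ss -(expr1n _ 2); apply: ler_sqr_base.
pose n := (Num.trunc (Num.sqrt t)).+1.
have sn : Num.sqrt t < n%:R by exact: Num.Theory.truncnS_gt.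
have ns : n%:R <= 2 * Num.sqrt t.
  have : (Num.trunc (Num.sqrt t))%:R <= Num.sqrt t by rewrite Num.Theory.truncn_le // ltW.
  by rewrite /n -natr1; lra.
have nN : (maxn (maxn (N1 x) (N2 x)) (N4 x) <= n)%N.
  by rewrite -(ler_nat R); apply: le_trans hN _; exact: ltW.
have n1 : 1 <= n%:R :> R by rewrite ler1n.
have hn2 : t <= n%:R ^+ 2 <= 4 * t.
  rewrite -ss; apply/andP; split; first by apply: ler_sqr_base; exact: ltW.
  apply: (le_trans (ler_sqr_base _ ns)) => //.
  by rewrite exprMn; apply: eq_ler; ring.
have hreg i : regular_scale G d d' (finite_exponent eps p) (finite_exponent eps q)
    (finite_exponent eps r) C (2 ^+ i * n%:R).
  have -> : 2 ^+ i * n%:R = (2 ^ i.+1 * n)%:R / 2 :> R.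
    by rewrite natrM natrX exprS; field.
  apply: (hscale V E N1 N2 N4) => //; first by rewrite muln_gt0 expn_gt0.
  by apply: leq_trans nN _; rewrite leq_pmull // expn_gt0.
have xi : winn G x' by apply/asboolP; rewrite xx; exact: gball_center.
have dx : wdist G x' = 0 by rewrite /= xx; exact: graph_dist_refl.
have key lam : 0 <= lam -> h t x' <= Q * t `^ (- (d / 2)) *
    (1 + graph_dist E x (val y) / Num.sqrt t) `^ M%:R *
    expR (- (lam * D) + C2 * (Cdeg * 2) * lam ^+ 2 * expR (2 * lam) * t).
  move=> lam0; set H := Cdeg * (2 * lam ^+ 2 * expR (2 * lam)).
  have H0 : 0 <= H.
    apply: mulr_ge0; first exact: le_trans hCdeg.
    by rewrite mulr_ge0 ?expR_ge0 // mulr_ge0 ?sqr_ge0.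
  have htilt (z : verts (R := R) E x K) := restriction_tilt Gr th0 om z hdeg lam0.
  have := hfin _ G n%:R t H (fun z => lam * intrinsic_dist E omega theta x (val z))
    x' y h n1 t1 hn2 H0 hreg htilt hP xi yi dx h0.
  rewrite xx intrinsic_dist_refl // mulr0 sub0r -/D => hh; apply: (le_trans hh).
  have -> : - (lam * D) + C2 * (Cdeg * 2) * lam ^+ 2 * expR (2 * lam) * t =
     - (lam * D) + C2 * H * t by rewrite /H; ring.
  rewrite ler_wpM2r ?expR_ge0 // ler_wpM2l ?mulr_ge0 ?powR_ge0 ?(ltW Q0) //.
  have dd : 0 <= graph_dist E x (val y) :> R by exact: graph_dist_ge0.
  rewrite powR_mulrn; last by rewrite addr_ge0 // divr_ge0 // ltW.
  apply: lerXn2r; rewrite ?nnegrE ?addr_ge0 ?divr_ge0 ?(ltW s0) //.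
  have n0 : 0 < n%:R :> R by exact: lt_trans sn.
  by rewrite lerD2l ler_wpM2l // lef_pV2 ?posrE // ltW.
have D0 : 0 <= D by exact: intrinsic_dist_ge0.
have P0 : 0 <= Q * t `^ (- (d / 2)) * (1 + graph_dist E x (val y) / Num.sqrt t) `^ M%:R.
  by rewrite mulr_ge0 ?powR_ge0 // mulr_ge0 ?powR_ge0 // ltW.
have [small large] := hopt t D t1 D0.
split => [/small|/large] [lam lam0 hlam]; apply: (le_trans (key lam lam0)).
  by rewrite ler_wpM2l // ler_expR.
by rewrite ler_wpM2l // ler_expR.
Qed.

End KilledHeatBound.

(** * The jump chain *)

Section BoxLaw.
Context {R : realType} {V : choiceType} {disp : measure_display} {T : measurableType disp}.
Variables (L : (V -> R) -> V -> R) (P : V -> probability T R)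
  (Y : nat -> T -> V) (S : nat -> T -> R).
Hypothesis chain : jump_chain_holding_times L P Y S.
Variable x : V.

Definition pr (A : set T) : R := fine (P x A).

Lemma pr_EFin A : measurable A -> P x A = (pr A)%:E.
Proof. by move=> mA; rewrite /pr fineK // fin_num_measure. Qed.

Lemma pr_ge0 A : 0 <= pr A.
Proof. by rewrite /pr fine_ge0. Qed.

Lemma pr_le A B : measurable A -> measurable B -> A `<=` B -> pr A <= pr B.
Proof.
by move=> mA mB AB; rewrite -lee_fin -!pr_EFin // le_measure // inE.
Qed.

Lemma prU A B : measurable A -> measurable B -> pr (A `|` B) <= pr A + pr B.
Proof.
move=> mA mB; rewrite -lee_fin EFinD -!pr_EFin //; last exact: measurableU.
exact: measureU2.
Qed.

Lemma prD A B : measurable A -> measurable B -> pr (A `\` B) = pr A - pr (A `&` B).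
Proof.
move=> mA mB; apply: EFin_inj; rewrite EFinB -!pr_EFin //.
- by rewrite measureD // -ge0_fin_numE // fin_num_measure.
- exact: measurableI.
- exact: measurableD.
Qed.

Lemma pr_bigU (J : eqType) (s : seq J) (A : J -> set T) : (forall j, measurable (A j)) ->
  pr (\big[setU/set0]_(j <- s) A j) <= \sum_(j <- s) pr (A j).
Proof.
move=> mA; elim: s => [|j s IH].
  by rewrite !big_nil /pr measure0.
rewrite !big_cons; apply: le_trans (prU _ _) _ => //.
  by apply: bigsetU_measurable.
by rewrite lerD2l.
Qed.

Definition jump_prob (v z : V) : R := jump_rate L v z / exit_rate L v.

(** The first m holding times are confined to intervals, the others only bounded below: the shape
    interpolates between the events of [jump_holding_law], with m = 0, and cylinders. *)
Definition box (n m : nat) (y : nat -> V) (a b s : nat -> R) : set T :=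
  [set w | forall i, (i <= n)%N -> Y i w = y i /\
    (if (i < m)%N then a i < S i w <= b i else s i < S i w)].

Lemma measurable_S_gt i c : measurable [set w | c < S i w].
Proof.
have -> : [set w | c < S i w] = S i @^-1` `]c, +oo[.
  by apply/seteqP; split => w /=; rewrite in_itv /= andbT.
by rewrite -[X in measurable X]setTI; exact: (holding_time_measurable chain).
Qed.

Lemma measurable_S_le i c : measurable [set w | S i w <= c].
Proof.
have -> : [set w | S i w <= c] = S i @^-1` `]-oo, c].
  by apply/seteqP; split => w /=; rewrite in_itv.
by rewrite -[X in measurable X]setTI; exact: (holding_time_measurable chain).
Qed.

Lemma measurable_Y i v : measurable [set w | Y i w = v].
Proof. exact: (jump_chain_measurable chain). Qed.

Lemma measurable_forall_le n (Q : nat -> set T) : (forall i, measurable (Q i)) ->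
  measurable [set w | forall i, (i <= n)%N -> Q i w].
Proof.
move=> mQ; have -> : [set w | forall i, (i <= n)%N -> Q i w] =
    \bigcap_i (if (i <= n)%N then Q i else setT).
  apply/seteqP; split => w /= h i; first by move=> _; case: ifP => // /h.
  by move=> ni; have := h i Logic.I; rewrite ni.
by apply: bigcap_measurable => // i _; case: ifP.
Qed.

Lemma measurable_box n m y a b s : measurable (box n m y a b s).
Proof.
apply: (@measurable_forall_le n (fun i => [set w | Y i w = y i /\
    (if (i < m)%N then a i < S i w <= b i else s i < S i w)])) => i.
have -> : [set w | Y i w = y i /\ (if (i < m)%N then a i < S i w <= b i else s i < S i w)] =
  [set w | Y i w = y i] `&`
  (if (i < m)%N then [set w | a i < S i w] `&` [set w | S i w <= b i] else [set w | s i < S i w]).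
  apply/seteqP; split => w /=; case: ifP => _ [h1 h2]; split => //.
    by case/andP: h2.
  by case: h2 => /= -> ->.
apply: measurableI; first exact: measurable_Y.
case: ifP => _; last exact: measurable_S_gt.
by apply: measurableI; [exact: measurable_S_gt|exact: measurable_S_le].
Qed.

Definition factor (m : nat) (y : nat -> V) (a b s : nat -> R) (i : nat) : R :=
  if (i < m)%N then expR (- (exit_rate L (y i) * a i)) - expR (- (exit_rate L (y i) * b i))
  else expR (- (exit_rate L (y i) * s i)).

(** Induction on m: confining S m to (a, b] means removing the event S m > b from the event S m > a,
    and both are boxes with one interval less. *)
Lemma box_law n m y a b s : (forall i, 0 <= a i <= b i) -> (forall i, 0 <= s i) ->
  pr (box n m y a b s) = (y 0%N == x)%:R * \prod_(i < n) jump_prob (y i) (y i.+1)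
    * \prod_(i < n.+1) factor m y a b s i.
Proof.
move=> ab; elim: m s => [|m IH] s s0.
  rewrite /pr (_ : box n 0 y a b s = [set w | forall i, (i <= n)%N -> Y i w = y i /\ s i < S i w]) //.
  by rewrite (jump_holding_law chain).
have [nm|mn] := ltnP n m.
  have -> : box n m.+1 y a b s = box n m y a b s.
    apply/seteqP; split => w h i ni; have := h i ni;
      by rewrite (leq_ltn_trans ni nm) (leq_ltn_trans ni (ltnW nm : n < m.+1)%N).
  rewrite IH //; congr (_ * _); apply: eq_bigr => i _; rewrite /factor.
  have im : (i < m)%N by apply: leq_trans nm; exact: ltn_ord.
  by rewrite im (ltnW im : (i < m.+1)%N).
pose upd c i := if i == m then c else s i.
have u0 c : 0 <= c -> forall i, 0 <= upd c i by move=> c0 i; rewrite /upd; case: ifP.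
have /andP[am bm] := ab m.
have b0 : 0 <= b m by exact: le_trans bm.
have setE : box n m.+1 y a b s = box n m y a b (upd (a m)) `\` box n m y a b (upd (b m)).
  apply/seteqP; split => w.
    move=> h; split.
      move=> i ni; have [h1 h2] := h i ni; split => //; move: h2.
      rewrite /upd; case: eqP => [->|/eqP im]; first by rewrite ltnn ltnSn => /andP[].
      by rewrite ltnS leq_eqVlt (negPf im).
    move=> h'; have [_ /=] := h' m mn; have [_ /=] := h m mn.
    by rewrite ltnn ltnSn /upd eqxx => /andP[_ /le_lt_trans h1 /h1]; rewrite ltxx.
  move=> [h1 h2] i ni; have [e1 e2] := h1 i ni; split => //.
  move: e2; rewrite /upd; case: eqP => [im|/eqP im]; last first.
    by rewrite ltnS [(i <= m)%N]leq_eqVlt (negPf im).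
  rewrite im ltnn ltnSn => e2; apply/andP; split; first exact: e2.
  rewrite leNgt; apply/negP => e3; apply: h2 => j nj; have [f1 f2] := h1 j nj.
  split => //; move: f2; rewrite /upd; case: eqP => [->|_] //.
  by rewrite ltnn.
have sub : box n m y a b (upd (b m)) `<=` box n m y a b (upd (a m)).
  move=> w h i ni; have [h1 h2] := h i ni; split => //; move: h2; rewrite /upd.
  case: eqP => [->|//]; rewrite ltnn; exact: le_lt_trans.
rewrite setE prD; [|exact: measurable_box|exact: measurable_box].
rewrite (setIidr sub) (IH _ (u0 _ am)) (IH _ (u0 _ b0)) -mulrBr; congr (_ * _).
have mo : (m < n.+1)%N by [].
rewrite (bigD1 (Ordinal mo)) //= [X in _ - X](bigD1 (Ordinal mo)) //=.
rewrite [RHS](bigD1 (Ordinal mo)) //=.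
have E c : \prod_(i < n.+1 | i != Ordinal mo) factor m y a b (upd c) i =
    \prod_(i < n.+1 | i != Ordinal mo) factor m.+1 y a b s i.
  apply: eq_bigr => i im; have im' : (i : nat) != m by rewrite -val_eqE in im.
  by rewrite /factor ltnS [(i <= m)%N]leq_eqVlt (negPf im') /= /upd (negPf im').
rewrite !E -mulrBl; congr (_ * _).
by rewrite /factor ltnn ltnSn /upd eqxx.
Qed.

End BoxLaw.

(** * Probabilities of discretised trajectories *)

Section Cylinder.
Context {R : realType} {V : choiceType} {disp : measure_display} {T : measurableType disp}.
Variables (L : (V -> R) -> V -> R) (P : V -> probability T R)
  (Y : nat -> T -> V) (S : nat -> T -> R).
Hypothesis chain : jump_chain_holding_times L P Y S.
Variable x : V.

Let prx := pr P x.
Let q := exit_rate L.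
Let jp := jump_prob L.

(* Time is cut into slots (k eps, (k + 1) eps]; the cylinder fixes the first n + 1
   states and the slots of the first n holding times. *)
Definition slot_prob (eps : R) (v : V) (k : nat) : R :=
  expR (- (q v * (k%:R * eps))) - expR (- (q v * (k.+1%:R * eps))).

Definition cylinder_prob (eps : R) (n : nat) (y : nat -> V) (k : nat -> nat) : R :=
  (y 0%N == x)%:R * \prod_(i < n) jp (y i) (y i.+1)
    * \prod_(i < n) slot_prob eps (y i) (k i).

(** The lower bound 0 on the last holding time is no restriction, as holding times are positive. *)
Definition cylinder (eps : R) (n : nat) (y : nat -> V) (k : nat -> nat) : set T :=
  box Y S n n y (fun i => (k i)%:R * eps) (fun i => (k i).+1%:R * eps) (fun=> 0).

Lemma measurable_cylinder eps n y k : measurable (cylinder eps n y k).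
Proof. exact: (measurable_box chain). Qed.

Lemma cylinderP eps n y k w : cylinder eps n y k w <->
  (forall i, (i <= n)%N -> Y i w = y i) /\
  (forall i, (i < n)%N -> (k i)%:R * eps < S i w <= (k i).+1%:R * eps).
Proof.
split.
  move=> h; split=> i ni; first by have [] := h i ni.
  by have [_] := h i (ltnW ni); rewrite ni.
move=> [h1 h2] i ni; split; first exact: h1.
case: ifP => ii; first exact: h2.
exact: (holding_time_gt0 chain).
Qed.

Lemma slot_ge0 (eps : R) (k : nat -> nat) : 0 < eps ->
  forall i, 0 <= (k i)%:R * eps <= (k i).+1%:R * eps.
Proof.
move=> e0 i; rewrite mulr_ge0 ?(ltW e0) //= ler_wpM2r ?(ltW e0) //.
by rewrite ler_nat.
Qed.

Lemma cylinder_tail eps n y k s : 0 < eps -> 0 <= s ->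
  prx (cylinder eps n y k `&` [set w | s < S n w]) =
  cylinder_prob eps n y k * expR (- (q (y n) * s)).
Proof.
move=> e0 s0.
have -> : cylinder eps n y k `&` [set w | s < S n w] =
    box Y S n n y (fun i => (k i)%:R * eps) (fun i => (k i).+1%:R * eps) (fun=> s).
  apply/seteqP; split => w.
    move=> [/cylinderP[h1 h2] /= h3] i ni; split; first exact: h1.
    case: ltnP => [|ni']; first exact: h2.
    by have -> : i = n by apply/eqP; rewrite eqn_leq ni ni'.
  move=> h; split.
    apply/cylinderP; split => i ni; first by have [] := h i ni.
    by have [_] := h i (ltnW ni); rewrite ni.
  by have [_] := h n (leqnn n); rewrite ltnn.
rewrite /prx (box_law chain) //; last exact: slot_ge0.
rewrite big_ord_recr /= [in X in _ * (_ * X)]/factor ltnn mulrA; congr (_ * _ * _).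
by apply: eq_bigr => i _; rewrite /factor ltn_ord.
Qed.

Lemma cylinder_jump eps n y k : 0 < eps ->
  prx (cylinder eps n y k `&` [set w | Y n.+1 w = y n.+1]) =
  cylinder_prob eps n y k * jp (y n) (y n.+1).
Proof.
move=> e0.
have -> : cylinder eps n y k `&` [set w | Y n.+1 w = y n.+1] =
    box Y S n.+1 n y (fun i => (k i)%:R * eps) (fun i => (k i).+1%:R * eps) (fun=> 0).
  apply/seteqP; split => w.
    move=> [/cylinderP[h1 h2] /= h3] i; rewrite leq_eqVlt => /orP[/eqP->|ni].
      by split => //; rewrite ltnNge leqnSn; exact: (holding_time_gt0 chain).
    split; first exact: h1.
    case: ltnP => [|ni']; first exact: h2.
    exact: (holding_time_gt0 chain).
  move=> h; split; last by have [] := h n.+1 (leqnn _).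
  apply/cylinderP; split => i ni; first by have [] := h i (leqW ni).
  by have [_] := h i (leqW (ltnW ni)); rewrite ni.
rewrite /prx (box_law chain) //; last exact: slot_ge0.
rewrite big_ord_recr /= [X in _ * X]big_ord_recr /= big_ord_recr /=.
rewrite {2 3}/factor ltnn ltnNge leqnSn /= !mulr0 oppr0 expR0 !mulr1 /cylinder_prob.
rewrite mulrA mulrAC; congr (_ * _ * _).
by apply: eq_bigr => i _; rewrite /factor ltn_ord.
Qed.

Lemma cylinder_prob_pr eps n y k : 0 < eps ->
  cylinder_prob eps n y k = prx (cylinder eps n y k).
Proof.
move=> e0; have := @cylinder_tail eps n y k 0 e0 (lexx _).
rewrite mulr0 oppr0 expR0 mulr1 => <-; congr prx.
by apply/setIidl => w _; exact: (holding_time_gt0 chain).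
Qed.

Lemma cylinder_prob_ge0 eps n y k : 0 < eps -> 0 <= cylinder_prob eps n y k.
Proof. by move=> e0; rewrite cylinder_prob_pr // pr_ge0. Qed.

Lemma cylinder_prob_succ eps n y k y' k' :
  (forall i, (i <= n)%N -> y' i = y i) -> (forall i, (i < n)%N -> k' i = k i) ->
  cylinder_prob eps n.+1 y' k' =
  cylinder_prob eps n y k * (jp (y n) (y' n.+1) * slot_prob eps (y n) (k' n)).
Proof.
move=> hy hk; rewrite /cylinder_prob !big_ord_recr /= (hy 0%N) // (hy n) //.
have -> : \prod_(i < n) jp (y' i) (y' i.+1) = \prod_(i < n) jp (y i) (y i.+1).
  by apply: eq_bigr => i _; rewrite !hy // ltnW.
have -> : \prod_(i < n) slot_prob eps (y' i) (k' i) = \prod_(i < n) slot_prob eps (y i) (k i).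
  by apply: eq_bigr => i _; rewrite hy ?hk // ltnW.
ring.
Qed.

Lemma pr_jump_notin n (s : seq V) (A : set T) : measurable A -> uniq s ->
  measurable [set w | Y n w \in s] /\
  prx (A `\` [set w | Y n w \in s]) = prx A - \sum_(z <- s) prx (A `&` [set w | Y n w = z]).
Proof.
move=> mA; elim: s => [_|z s IH /= /andP[zs us]].
  rewrite big_nil subr0 (_ : [set w | Y n w \in [::]] = set0); last by apply/seteqP; split.
  by rewrite setD0.
have [mU IHs] := IH us.
have mz := measurable_Y chain n z.
have E1 : [set w | Y n w \in z :: s] = [set w | Y n w = z] `|` [set w | Y n w \in s].
  apply/seteqP; split => w /=; rewrite in_cons.
    by move=> /orP[/eqP|]; [left|right].
  by move=> [->|->]; rewrite ?eqxx ?orbT.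
split; first by rewrite E1; exact: measurableU.
have -> : A `\` [set w | Y n w \in z :: s] =
    (A `\` [set w | Y n w \in s]) `\` [set w | Y n w = z].
  by rewrite setDDl E1 setUC.
rewrite /prx prD //; last exact: measurableD.
have -> : (A `\` [set w | Y n w \in s]) `&` [set w | Y n w = z] = A `&` [set w | Y n w = z].
  apply/seteqP; split => w; first by move=> [[]].
  by move=> [h1 h2]; split => //; split => //= ; rewrite h2; apply/negP.
by rewrite -/prx IHs big_cons; ring.
Qed.

End Cylinder.

(** * Comparison of the jump chain with a solution of the backward equation *)

Section Comparison.
Context {R : realType} {V : choiceType} {disp : measure_display} {T : measurableType disp}.
Variables (L : (V -> R) -> V -> R) (P : V -> probability T R)
  (Y : nat -> T -> V) (S : nat -> T -> R).
Hypothesis chain : jump_chain_holding_times L P Y S.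
(** [B n v] stands for v being within reach of n jumps from x. The properties of W are required only
    there, because the killed solution satisfies the backward equation of the walk only within a
    bounded distance of x. *)
Variables (x target : V) (nbr : V -> seq V) (B : nat -> V -> Prop) (W : R -> V -> R).
Variables (N : nat) (Q lip t : R).
Hypotheses (t0 : 0 < t) (Q0 : 0 <= Q) (lip0 : 0 <= lip) (Bx : B 0 x).

Let q := exit_rate L.
Let jp := jump_prob L.

Hypothesis B_nbr : forall n v z, B n v -> z \in nbr v -> B n.+1 z.
Hypothesis nbr_uniq : forall v, uniq (nbr v).
Hypothesis q_ge0 : forall v, 0 <= q v.
Hypothesis q_le : forall n v, (n <= N)%N -> B n v -> q v <= Q.
Hypothesis jp_ge0 : forall v z, z \in nbr v -> 0 <= jp v z.
Hypothesis jp_sum : forall v, \sum_(z <- nbr v) jp v z = 1.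
Hypothesis W_derive : forall n v (s : R), (n <= N)%N -> B n v ->
  is_derive s 1 (W^~ v) (q v * (\sum_(z <- nbr v) jp v z * W s z - W s v)).
Hypothesis W_start : forall n v, (n <= N)%N -> B n v -> W 0 v = (v == target)%:R.
Hypothesis W_ge0 : forall n v (s : R), (n <= N.+1)%N -> B n v -> 0 <= s -> 0 <= W s v.
Hypothesis W_lip : forall n v (a b : R), (n <= N.+1)%N -> B n v -> 0 <= a -> a <= b -> b <= t ->
  W b v - W a v <= lip * (b - a).

Lemma expR_decrement_le (a b : R) : 0 <= a -> a <= b -> expR (- a) - expR (- b) <= b - a.
Proof.
move=> a0 ab; have -> : expR (- b) = expR (- a) * expR (a - b).
  by rewrite -expRD; congr expR; ring.
have h1 := expR_ge1Dx (a - b); have h2 := expR_gt0 (- a).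
have h3 : expR (- a) <= 1 by rewrite -expR0 ler_expR; lra.
have : 0 <= (1 - expR (- a)) * (b - a) by rewrite mulr_ge0; lra.
have : 0 <= expR (- a) * (expR (a - b) - (1 + (a - b))) by rewrite mulr_ge0 ?subr_ge0 ?(ltW h2).
move: (expR (- a)) (expR (a - b)) => u v; lra.
Qed.

Lemma slot_sum_le (eps : R) J v : \sum_(k < J) slot_prob L eps v k <= 1.
Proof.
have -> : \sum_(k < J) slot_prob L eps v k = 1 - expR (- (q v * (J%:R * eps))).
  rewrite -[LHS]opprK -sumrN -(big_mkord xpredT (fun k => - slot_prob L eps v k)).
  rewrite (eq_bigr (fun k => expR (- (q v * (k.+1%:R * eps))) - expR (- (q v * (k%:R * eps))))).
    by rewrite (telescope_sumr (fun k => expR (- (q v * (k%:R * eps))))) // mul0r mulr0 oppr0 expR0 opprB.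
  by move=> k _; rewrite opprB.
by rewrite gerBl expR_ge0.
Qed.

(* A Riemann sum version of Duhamel's formula, obtained from the derivative of
   r |-> exp (- q r) W (tau - r). *)
Lemma duhamel_slots (eps : R) J n v : 0 < eps -> J%:R * eps <= t -> (n <= N)%N -> B n v ->
  (v == target)%:R * expR (- (q v * (J%:R * eps)))
  + \sum_(k < J) slot_prob L eps v k * \sum_(z <- nbr v) jp v z * W (J%:R * eps - k%:R * eps) z
  <= W (J%:R * eps) v + lip * eps.
Proof.
move=> e0 Jt nN Bv; set tau : R := J%:R * eps.
have tau0 : 0 <= tau by rewrite mulr_ge0 // ltW.
pose g (r : R) := \sum_(z <- nbr v) jp v z * W (tau - r) z.
pose F (r : R) := - (expR (- (q v * r)) * W (tau - r) v).
have dE (c r : R) : is_derive r 1 (fun r => expR (- (c * r))) (- c * expR (- (c * r))).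
  by apply: is_derive_eq; rewrite /GRing.scale /=; ring.
have dF (r : R) : is_derive r 1 F (q v * expR (- (q v * r)) * g r).
  have d1 : is_derive r 1 (fun r : R => tau - r) (-1).
    by apply: is_derive_eq; rewrite add0r mul1r.
  have d2 := W_derive (tau - r) nN Bv.
  have d3 := @is_derive1_comp R (W^~ v) (fun r => tau - r) r _ _ d2 d1.
  have d4 := is_derive_mul (dE (q v) r) d3.
  have d5 := is_derive_scale (-1) d4.
  have -> : F = fun r => -1 * (expR (- (q v * r)) * (W^~ v \o (fun r => tau - r)) r).
    by apply/funext => s; rewrite /F mulN1r.
  apply: is_derive_eq; rewrite /g /GRing.scale /=; ring.
(* By the one-sided bound [W_lip], g falls within a slot by at most lip eps below its value at the
   left end. *)
have gk k r : (k < J)%N -> k%:R * eps <= r <= k.+1%:R * eps -> g (k%:R * eps) - lip * eps <= g r.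
  move=> kJ /andP[r1 r2].
  have kt : k.+1%:R * eps <= tau by rewrite ler_wpM2r ?(ltW e0) // ler_nat.
  have -> : lip * eps = \sum_(z <- nbr v) jp v z * (lip * eps) by rewrite -mulr_suml jp_sum mul1r.
  rewrite /g -sumrB big_seq [leRHS]big_seq; apply: ler_sum => z zv.
  rewrite -mulrBr ler_wpM2l ?jp_ge0 //.
  have k0 : 0 <= k%:R * eps by rewrite mulr_ge0 // ltW.
  have h := @W_lip n.+1 z (tau - r) (tau - k%:R * eps) nN (B_nbr Bv zv).
  have := h _ _ _; rewrite subr_ge0 lerD2l lerN2 => /(_ (le_trans r2 kt) r1).
  have tt : tau - k%:R * eps <= t by rewrite lerBlDr (le_trans Jt) // lerDl.
  move=> /(_ tt).
  have : lip * ((tau - k%:R * eps) - (tau - r)) <= lip * eps.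
    by rewrite ler_wpM2l //; move: r2; rewrite -natr1 mulrDl mul1r; move: (k%:R * eps) => u; lra.
  lra.
have step k : (k < J)%N ->
    (g (k%:R * eps) - lip * eps) * slot_prob L eps v k <= F (k.+1%:R * eps) - F (k%:R * eps).
  move=> kJ; set c := g _ - _.
  pose G (r : R) := - c * expR (- (q v * r)).
  have dG (r : R) : is_derive r 1 G (- c * (- q v * expR (- (q v * r)))) by exact: is_derive_scale.
  have kk : k%:R * eps <= k.+1%:R * eps by rewrite ler_wpM2r ?(ltW e0) // ler_nat.
  have := @increment_le R _ _ _ _ _ _ kk (fun r _ => dG r) (fun r _ => dF r) _.
  rewrite /G /slot_prob -/q => h; apply: le_trans (h _).
    by apply: eq_ler; ring.
  move=> r rk; have := gk _ _ kJ rk; rewrite -/c => cg.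
  have : 0 <= q v * expR (- (q v * r)) * (g r - c) by rewrite !mulr_ge0 ?expR_ge0 ?subr_ge0.
  lra.
have tele : \sum_(k < J) (F (k.+1%:R * eps) - F (k%:R * eps)) = F tau - F 0.
  by rewrite -(big_mkord xpredT (fun k => F (k.+1%:R * eps) - F (k%:R * eps)))
    telescope_sumr // mul0r.
have slots := slot_sum_le eps J v.
have main : \sum_(k < J) (g (k%:R * eps) - lip * eps) * slot_prob L eps v k <= F tau - F 0.
  by rewrite -tele; apply: ler_sum => k _; exact: step.
have main' : \sum_(k < J) slot_prob L eps v k * g (k%:R * eps) <= F tau - F 0 + lip * eps.
  have : lip * eps * \sum_(k < J) slot_prob L eps v k <= lip * eps.
    by rewrite ler_piMr // mulr_ge0 // ltW.
  rewrite mulr_sumr => h.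
  have : \sum_(k < J) slot_prob L eps v k * g (k%:R * eps) =
     \sum_(k < J) (g (k%:R * eps) - lip * eps) * slot_prob L eps v k
     + \sum_(k < J) lip * eps * slot_prob L eps v k.
    by rewrite -big_split /=; apply: eq_bigr => k _; ring.
  lra.
have Ft : F tau = - ((v == target)%:R * expR (- (q v * tau))).
  by rewrite /F subrr (W_start nN Bv) mulrC.
have F0 : F 0 = - W tau v by rewrite /F mulr0 oppr0 expR0 mul1r addr0.
move: main'; rewrite Ft F0 /g.
move: (\sum_(k < J) _) ((v == target)%:R * _) (lip * eps) (W tau v) => a b c e; lra.
Qed.

Definition hit (m : nat) : set T :=
  [set w | Y m w = target /\ \sum_(i < m) S i w <= t < \sum_(i < m.+1) S i w].

Definition hits (n j : nat) : set T := [set w | exists2 i, (n <= i < n + j)%N & hit i w].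

Lemma measurable_hit m : measurable (hit m).
Proof.
have mS n : measurable_fun [set: T] (fun w => \sum_(i < n) S i w).
  by apply: measurable_sum => i; exact: (holding_time_measurable chain).
have -> : hit m = [set w | Y m w = target] `&`
    ((fun w => \sum_(i < m) S i w) @^-1` `]-oo, t]
     `&` (fun w => \sum_(i < m.+1) S i w) @^-1` `]t, +oo[).
  apply/seteqP; split => w /=.
    by move=> [e /andP[h1 h2]]; split => //; rewrite /= !in_itv /= andbT.
  by move=> [e [h1 h2]]; split => //; move: h1 h2; rewrite /= !in_itv /= andbT => -> ->.
apply: measurableI; first exact: (measurable_Y chain).
by apply: measurableI; rewrite -[X in measurable X]setTI; exact: mS.
Qed.

Lemma measurable_hits n j : measurable (hits n j).
Proof.
have -> : hits n j = \bigcup_i (if (n <= i < n + j)%N then hit i else set0).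
  apply/seteqP; split => w.
    by move=> [i nij h]; exists i => //; rewrite nij.
  by move=> [i _]; case: ifP => // nij h; exists i.
by apply: bigcup_measurable => i _; case: ifP => // _; exact: measurable_hit.
Qed.

Let prx := pr P x.

Section Grid.
Variables (M : nat) (eps : R).
Hypotheses (e0 : 0 < eps) (Me : M%:R * eps = t).

Let total n (k : nat -> nat) := (\sum_(i < n) k i)%N.

Lemma cylinder_time n y k w : cylinder Y S eps n y k w ->
  (total n k)%:R * eps <= \sum_(i < n) S i w <= (total n k + n)%:R * eps.
Proof.
move=> /(cylinderP chain)[_ h].
have E : (total n k + n)%:R * eps = \sum_(i < n) (k i).+1%:R * eps.
  rewrite -mulr_suml; congr (_ * _); rewrite natrD natr_sum.
  under [in RHS]eq_bigr do rewrite -natr1.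
  by rewrite big_split /= sumr_const card_ord.
rewrite E natr_sum mulr_suml; apply/andP; split; apply: ler_sum => i _.
  by have /andP[/ltW] := h i (ltn_ord i).
by have /andP[] := h i (ltn_ord i).
Qed.

(** The slots determine the time of the n-th jump up to n eps. Sitting at the target at time t after
    n jumps thus forces the next holding time to exceed (J - n) eps; replacing this by J eps costs
    at most Q N eps. *)
Lemma cylinder_hit_le n y k J : (n <= N)%N -> B n (y n) -> (total n k + J)%N = M ->
  prx (cylinder Y S eps n y k `&` hit n) <=
  cylinder_prob L x eps n y k *
   ((y n == target)%:R * expR (- (q (y n) * (J%:R * eps))) + Q * N%:R * eps).
Proof.
move=> nN Bn JM; have c0 := cylinder_prob_ge0 chain x n y k e0.
have err0 : 0 <= Q * N%:R * eps by rewrite !mulr_ge0 // ltW.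
have mC := measurable_cylinder chain eps n y k.
case: (eqVneq (y n) target) => yt; last first.
  have -> : cylinder Y S eps n y k `&` hit n = set0.
    apply/seteqP; split => // w [/(cylinderP chain)[h _] [e _]].
    by move: yt; rewrite -(h n (leqnn n)) e eqxx.
  by rewrite /prx /pr measure0 mul0r add0r mulr_ge0.
(* The maximum with 0 covers J < n, where the lower bound on the holding time is vacuous. *)
rewrite mul1r; pose s := Num.max 0 ((J%:R - n%:R) * eps).
have s0 : 0 <= s by rewrite /s le_max lexx.
have J0 : 0 <= J%:R * eps by rewrite mulr_ge0 // ltW.
have n0 : 0 <= n%:R * eps by rewrite mulr_ge0 // ltW.
have sJ : s <= J%:R * eps by rewrite /s ge_max J0 mulrBl; lra.
have Js : J%:R * eps - s <= n%:R * eps.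
  have : (J%:R - n%:R) * eps <= s by rewrite /s le_max lexx orbT.
  by rewrite mulrBl; lra.
apply: (@le_trans _ _ (prx (cylinder Y S eps n y k `&` [set w | s < S n w]))).
  apply: pr_le; [by apply: measurableI => //; exact: measurable_hit| |].
    by apply: measurableI => //; exact: (measurable_S_gt chain).
  move=> w [hc [_ /andP[_ hT]]]; split => //=.
  have /andP[_ hS] := cylinder_time hc.
  rewrite /s gt_max (holding_time_gt0 chain) /=; move: hT; rewrite big_ord_recr /= -Me -JM.
  move: hS; rewrite !natrD; move: (\sum_(i < n) _) (S n w) => a b.
  rewrite !mulrDl mulNr; lra.
rewrite /prx (cylinder_tail chain) // ler_wpM2l //.
have h := expR_decrement_le (mulr_ge0 (q_ge0 (y n)) s0) (ler_wpM2l (q_ge0 (y n)) sJ).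
suff : q (y n) * (J%:R * eps) - q (y n) * s <= Q * N%:R * eps.
  by move: h; rewrite -/q; lra.
rewrite -mulrBr -mulrA; apply: ler_pM; rewrite ?subr_ge0 //; first exact: q_le Bn.
by apply: le_trans Js _; rewrite ler_wpM2r ?(ltW e0) // ler_nat.
Qed.

Lemma exists_slot w n : exists k : nat, k%:R * eps < S n w <= k.+1%:R * eps.
Proof.
have S0 := holding_time_gt0 chain n w.
have ex : exists k : nat, S n w <= k%:R * eps.
  exists (Num.trunc (S n w / eps)).+1.
  by rewrite -ler_pdivrMr // ltW // Num.Theory.truncnS_gt.
case: (ex_minnP ex) => [[|k] hk hmin]; first by move: hk; rewrite mul0r leNgt S0.
exists k; rewrite hk andbT ltNge; apply/negP => /hmin; by rewrite ltnn.
Qed.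

Let upd (A : Type) (f : nat -> A) n z i := if i == n then z else f i.

Let updE A (f : nat -> A) n z : upd f n z n = z.
Proof. by rewrite /upd eqxx. Qed.

Let upd_lt A (f : nat -> A) n z i : (i < n)%N -> upd f n z i = f i.
Proof. by move=> h; rewrite /upd ltn_eqF. Qed.

Let total_upd n k k0 : total n.+1 (upd k n k0) = (total n k + k0)%N.
Proof.
rewrite /total big_ord_recr /= updE; congr (_ + _)%N.
by apply: eq_bigr => i _; rewrite upd_lt.
Qed.

(** The second alternative will have probability 0, since the jump probabilities to the neighbours
    add up to 1. In the third, [k0 < J] because a later hit requires jump n+1 to have occurred by
    time t. *)
Lemma hits_cover j n y k J w : (total n k + J)%N = M ->
  cylinder Y S eps n y k w -> hits n j.+1 w ->
  [\/ hit n w, Y n.+1 w \notin nbr (y n) |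
     exists (k0 : 'I_J) z, [/\ z \in nbr (y n),
       cylinder Y S eps n.+1 (upd y n.+1 z) (upd k n (k0 : nat)) w & hits n.+1 j w]].
Proof.
move=> JM hc [m /andP[nm mj] hm].
move: nm; rewrite leq_eqVlt => /orP[/eqP->|nm]; first by constructor 1.
case: (boolP (Y n.+1 w \in nbr (y n))) => Yn; last by constructor 2.
constructor 3; have [k0 /andP[hk1 hk2]] := exists_slot w n.
have k0J : (k0 < J)%N.
  have /andP[hS _] := cylinder_time hc.
  case: hm => _ /andP[hT _].
  have : \sum_(i < n.+1) S i w <= \sum_(i < m) S i w.
    rewrite -!(big_mkord xpredT (fun i => S i w)) [leRHS](big_cat_nat (n := n.+1)) //=.
    by rewrite lerDl sumr_ge0 // => i _; rewrite ltW // (holding_time_gt0 chain).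
  rewrite big_ord_recr /= => hT'.
  have : (total n k)%:R * eps + k0%:R * eps < M%:R * eps.
    by rewrite Me; apply: lt_le_trans hT; apply: lt_le_trans hT'; exact: ler_ltD.
  by rewrite -mulrDl ltr_pM2r // -natrD ltr_nat -JM ltn_add2l.
exists (Ordinal k0J), (Y n.+1 w); split => //; last first.
  by exists m => //; rewrite nm addSnnS.
have [h1 h2] := (cylinderP chain eps n y k w).1 hc.
apply/(cylinderP chain); split => i; rewrite leq_eqVlt => /orP[/eqP ii|ii].
- by rewrite ii updE.
- by rewrite upd_lt // h1.
- by case: ii => ->; rewrite updE hk1.
- by rewrite upd_lt // h2.
Qed.

(* Induction on the number j of jumps still allowed: W solves the backward
   equation from the indicator of the target, and each jump costs O(eps). *)
Lemma hits_cylinder_le j n y k J : (n + j <= N.+1)%N -> B n (y n) -> (total n k + J)%N = M ->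
  prx (cylinder Y S eps n y k `&` hits n j) <=
  cylinder_prob L x eps n y k *
    (W (J%:R * eps) (y n) + j%:R * ((Q * N%:R + lip) * eps)).
Proof.
set err := (Q * N%:R + lip) * eps.
have err0 : 0 <= err by rewrite mulr_ge0 ?(ltW e0) // addr_ge0 // mulr_ge0.
elim: j n y k J => [|j IH] n y k J nj Bn JM.
  have -> : cylinder Y S eps n y k `&` hits n 0 = set0.
    apply/seteqP; split => // w [_ [i]]; rewrite addn0 => /andP[h1 h2].
    by move: (leq_trans h2 h1); rewrite ltnn.
  rewrite addn0 in nj; rewrite /prx /pr measure0 mul0r addr0 mulr_ge0 //.
    exact: (cylinder_prob_ge0 chain).
  by apply: (W_ge0 nj Bn); rewrite mulr_ge0 // ltW.
have nN : (n <= N)%N by rewrite -ltnS; apply: leq_trans nj; rewrite addnS ltnS leq_addr.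
set C := cylinder Y S eps n y k; set c := cylinder_prob L x eps n y k.
have c0 : 0 <= c by exact: (cylinder_prob_ge0 chain).
have mC : measurable C by exact: (measurable_cylinder chain).
pose sub (k0 : 'I_J) z := cylinder Y S eps n.+1 (upd y n.+1 z) (upd k n (k0 : nat)) `&` hits n.+1 j.
have msub k0 z : measurable (sub k0 z).
  by apply: measurableI; [exact: (measurable_cylinder chain)|exact: measurable_hits].
pose mid := \big[setU/set0]_(k0 <- index_enum 'I_J) \big[setU/set0]_(z <- nbr (y n)) sub k0 z.
have mmid k0 : measurable (\big[setU/set0]_(z <- nbr (y n)) sub k0 z).
  by apply: bigsetU_measurable.
have Mmid : measurable mid by apply: bigsetU_measurable.
have [mU Unull] := @pr_jump_notin _ _ _ _ _ _ _ _ chain x n.+1 (nbr (y n)) C mC (nbr_uniq _).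
have null : prx (C `\` [set w | Y n.+1 w \in nbr (y n)]) = 0.
  rewrite /prx Unull (eq_bigr (fun z => c * jp (y n) z)) => [|z _].
    by rewrite -mulr_sumr jp_sum mulr1 /c (cylinder_prob_pr chain) // subrr.
  rewrite /C -[z in LHS](updE y n.+1).
  have -> : cylinder Y S eps n y k = cylinder Y S eps n (upd y n.+1 z) k.
    apply/seteqP; split => w /(cylinderP chain)[h1 h2]; apply/(cylinderP chain); split=> // i ni.
      by rewrite upd_lt // h1.
    by rewrite h1 // upd_lt.
  rewrite updE.
  have := cylinder_jump chain x n (upd y n.+1 z) k e0; rewrite updE => ->.
  rewrite upd_lt //; congr (_ * _); rewrite /c /cylinder_prob upd_lt //.
  by congr (_ * _ * _); apply: eq_bigr => i _; rewrite /upd ?ltn_eqF // ?ltnS // ltnW.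
have cover : C `&` hits n j.+1 `<=`
    (C `&` hit n) `|` (mid `|` (C `\` [set w | Y n.+1 w \in nbr (y n)])).
  move=> w [hc hh]; case: (hits_cover JM hc hh) => [h|/negP h|[k0 [z [zn h1 h2]]]].
  - by left.
  - by right; right.
  - right; left; rewrite /mid (bigD1_seq k0) ?mem_index_enum ?index_enum_uniq //=; left.
    by rewrite (bigD1_seq z) //=; left.
have mhit : measurable (C `&` hit n) by apply: measurableI => //; exact: measurable_hit.
have mdiff : measurable (C `\` [set w | Y n.+1 w \in nbr (y n)]) by exact: measurableD.
apply: le_trans (@pr_le _ _ _ _ P x _ _ _ _ cover) _.
- by apply: measurableI => //; exact: measurable_hits.
- by apply: measurableU => //; exact: measurableU.
apply: le_trans (prU P x _ _) _ => //; first exact: measurableU.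
have h1 := cylinder_hit_le nN Bn JM.
have h2 := prU P x Mmid mdiff; rewrite -/prx null addr0 in h2.
have h3 : prx mid <= \sum_(k0 < J) \sum_(z <- nbr (y n))
    c * (jp (y n) z * slot_prob L eps (y n) k0) * (W (J%:R * eps - k0%:R * eps) z + j%:R * err).
  apply: le_trans (pr_bigU P x _ _) _ => //; apply: ler_sum => k0 _.
  apply: le_trans (pr_bigU P x _ _) _ => //; rewrite big_seq [leRHS]big_seq; apply: ler_sum => z zn.
  have := IH n.+1 (upd y n.+1 z) (upd k n (k0 : nat)) (J - k0)%N.
  rewrite addSnnS updE total_upd -addnA subnKC; last exact: ltnW.
  move=> /(_ nj (B_nbr Bn zn) JM); rewrite -/(sub k0 z).
  rewrite (@cylinder_prob_succ _ _ L x eps n y k) => [|i ni|i ni]; last 2 first.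
  - by rewrite upd_lt.
  - by rewrite upd_lt.
  by rewrite !updE (natrB _ (ltnW (ltn_ord k0))) mulrBl; exact.
have Jt : J%:R * eps <= t by rewrite -Me ler_wpM2r ?(ltW e0) // ler_nat -JM leq_addl.
have h4 := duhamel_slots e0 Jt nN Bn.
set D := \sum_(k < J) _ in h4.
have h5 : prx mid <= c * (D + j%:R * err).
  apply: le_trans h3 _.
  have je : 0 <= j%:R * err by rewrite mulr_ge0.
  apply: (@le_trans _ _ (c * (D + j%:R * err * \sum_(k0 < J) slot_prob L eps (y n) k0))).
    apply: eq_ler; rewrite /D [in RHS]mulr_sumr -big_split mulr_sumr /=; apply: eq_bigr => k0 _.
    rewrite -[X in _ = _ * (_ + X)]mulr1 -[X in _ = _ * (_ + _ * X)](jp_sum (y n)).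
    rewrite !mulr_sumr -big_split mulr_sumr /=; apply: eq_bigr => z _; ring.
  by rewrite ler_wpM2l // lerD2l ler_piMr // slot_sum_le.
apply: le_trans (lerD h1 (le_trans h2 h5)) _; rewrite -mulrDr ler_wpM2l //.
rewrite -natr1 /err; move: h4; rewrite -/err.
clear h2 h3 h5; move: D (_ * expR _) (W _ _) => D' e u; rewrite /err; lra.
Qed.

End Grid.

(** The total error is N+1 times a quantity of order eps, where eps is t divided by the number of
    slots; it vanishes as the grid is refined with N fixed. *)
Lemma hits_le : prx (hits 0 N.+1) <= W t x.
Proof.
have mH := measurable_hits 0 N.+1.
pose c := N.+1%:R * (Q * N%:R + lip) * t.
have H M : prx (hits 0 N.+1) <= W t x + c / M.+1%:R.
  pose eps := t / M.+1%:R.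
  have e0 : 0 < eps by rewrite divr_gt0 // ltr0n.
  have Me : M.+1%:R * eps = t by rewrite /eps mulrC divfK // pnatr_eq0.
  set C := cylinder Y S eps 0 (fun=> x) (fun=> 0%N).
  have mC : measurable C by exact: (measurable_cylinder chain).
  (* The cylinder of length 0 only fixes the starting point. *)
  have C1 : prx C = 1.
    by rewrite /prx -(cylinder_prob_pr chain) // /cylinder_prob !big_ord0 eqxx !mulr1.
  have := @hits_cylinder_le M.+1 eps e0 Me N.+1 0 (fun=> x) (fun=> 0%N) M.+1 (leqnn _) Bx.
  rewrite big_ord0 => /(_ erefl); rewrite (cylinder_prob_pr chain) // -/prx -/C C1 mul1r Me.
  have out0 : prx (hits 0 N.+1 `\` C) <= 0.
    have : prx (setT `\` C) = 0.
      by rewrite /prx prD // setTI -/prx C1 /prx /pr probability_setT subrr.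
    move=> <-; apply: pr_le; [exact: measurableD|exact: measurableD|].
    by move=> w [_ h]; split.
  have -> : N.+1%:R * ((Q * N%:R + lip) * eps) = c / M.+1%:R by rewrite /c /eps !mulrA.
  move: out0; rewrite /prx prD // setIC.
  move: (pr _ _ _) (pr _ _ _) (c / _) => a b e; lra.
rewrite leNgt; apply/negP => h.
have d0 : 0 < prx (hits 0 N.+1) - W t x by rewrite subr_gt0.
have := H (Num.trunc (c / (prx (hits 0 N.+1) - W t x))).
have := @Num.Theory.truncnS_gt R (c / (prx (hits 0 N.+1) - W t x)).
move: (Num.trunc _) => M; rewrite ltr_pdivrMr // => h1.
rewrite -lerBlDl ler_pdivlMr ?ltr0n // leNgt mulrC; move=> /negP; apply.
by [].
Qed.

End Comparison.

(** The total of h over the vertices is continuous, hence bounded on [0, t], and it bounds the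
    derivative from above up to an exit rate. The negative part of the derivative is discarded, so
    the estimate is one-sided. *)
Lemma killed_lipschitz (R : realType) (I : finType) (G : weighted_graph R I) (h : R -> I -> R) (t : R) :
  0 <= t -> killed_solution G h -> exists2 lip, 0 <= lip &
  forall z a b, 0 <= a -> a <= b -> b <= t -> h b z - h a z <= lip * (b - a).
Proof.
move=> t0 hP; pose H s := \sum_z h s z.
have cH : {within `[0, t], continuous H}.
  apply: continuous_in_subspaceT => s _; apply: continuous_bigsum => z.
  exact: is_derive_continuous (killed_derive hP s z).
have [c cin Hc] := EVT_max t0 cH.
have H0 : 0 <= H c.
  by apply: sumr_ge0 => z _; apply: killed_ge0 hP _ _ _; move: cin; rewrite in_itv /= => /andP[].
pose rate z := (wtheta G z)^-1 * \sum_y wc G z y.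
have th0 z : 0 <= (wtheta G z)^-1 by rewrite invr_ge0 ltW ?wtheta_gt0.
have r0 z : 0 <= rate z by rewrite mulr_ge0 // sumr_ge0 // => y _; exact: wc_ge0.
have rs0 : 0 <= \sum_z rate z by exact: sumr_ge0.
exists ((\sum_z rate z) * H c); first exact: mulr_ge0.
move=> z a b a0 ab bt; rewrite mulrBr.
have dl (s : R) : is_derive s 1 (fun s : R => (\sum_z rate z) * H c * s) ((\sum_z rate z) * H c).
  by apply: is_derive_eq; rewrite /GRing.scale /= mulr1.
apply: (increment_le ab (fun s _ => killed_derive hP s z) (fun s _ => dl s)) => s /andP[sa sb].
have s0 : 0 <= s by exact: le_trans sa.
have hs u : 0 <= h s u by exact: (killed_ge0 hP).
case: ifP => _; last exact: mulr_ge0.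
apply: (@le_trans _ _ (rate z * H c)); last first.
  by rewrite ler_wpM2r // (bigD1 z) //= lerDl sumr_ge0.
rewrite /rate -mulrA ler_wpM2l // mulr_suml; apply: ler_sum => y _.
rewrite ler_wpM2l ?wc_ge0 //; apply: (@le_trans _ _ (h s y)); first by rewrite gerBl hs.
apply: (@le_trans _ _ (H s)); first by rewrite /H (bigD1 y) //= lerDl sumr_ge0.
by apply: Hc; rewrite in_itv /= s0 (le_trans sb).
Qed.

(** * Transition probabilities of the walk against the killed flow *)

Section Transition.
Context {R : realType} {V : choiceType} {disp : measure_display} {T : measurableType disp}.

Lemma pr_bigcup_le (P : V -> probability T R) x (F : nat -> set T) (b : R) :
  (forall n, measurable (F n)) -> (forall n, F n `<=` F n.+1) ->
  (forall n, pr P x (F n) <= b) -> pr P x (\bigcup_n F n) <= b.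
Proof.
move=> mF FS Fb.
have mU : measurable (\bigcup_n F n) by exact: bigcupT_measurable.
have nd : nondecreasing_seq F.
  by apply/nondecreasing_seqP => n; apply/subsetPset; exact: FS.
have h := @nondecreasing_cvg_mu _ _ _ (P x) F mF mU nd.
rewrite -lee_fin -pr_EFin // -(cvg_lim _ h) //; apply: lime_le.
  by apply/cvg_ex; eexists; exact: h.
by near=> n; rewrite /= pr_EFin // lee_fin.
Unshelve. all: by end_near.
Qed.

Section Generator.
Variables (E : rel V) (omega : V -> V -> R) (theta : V -> R).
Hypothesis Gr : infinite_graph E.
Hypothesis th0 : forall x, 0 < theta x.
Hypothesis om : conductances E omega.

Let L := generator E omega theta.

Definition neighbors (v : V) : {fset V} := fset_set [set z | E v z].

Lemma in_neighbors v z : (z \in neighbors v) = E v z.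
Proof.
rewrite /neighbors in_fset_set; last exact: (neighbors_finite Gr).
by apply/idP/idP; rewrite inE.
Qed.

Lemma generatorE f v :
  L f v = (theta v)^-1 * \sum_(z <- neighbors v) omega v z * (f z - f v).
Proof. by rewrite /L /generator fsbig_finite //; exact: (neighbors_finite Gr). Qed.

Lemma jump_rateE v z : E v z -> jump_rate L v z = (theta v)^-1 * omega v z.
Proof.
move=> vz; rewrite /jump_rate; case: eqP => [e|/eqP ne].
  by move: vz; rewrite e (edge_irrefl Gr).
rewrite generatorE (bigD1_seq z) ?fset_uniq ?in_neighbors //= eqxx (negPf ne) subr0 mulr1.
by rewrite big1 ?addr0 // => u /negPf ->; rewrite subr0 mulr0.
Qed.

Lemma exit_rateE v : exit_rate L v = (theta v)^-1 * \sum_(z <- neighbors v) omega v z.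
Proof.
rewrite /exit_rate generatorE -mulrN -sumrN; congr (_ * _).
rewrite big_seq [RHS]big_seq; apply: eq_bigr => z; rewrite in_neighbors eqxx.
case: eqP => [-> |_ _]; first by rewrite (edge_irrefl Gr).
by rewrite sub0r mulrN mulr1 opprK.
Qed.

Lemma exit_rate_gt0 v : 0 < exit_rate L v.
Proof.
rewrite exit_rateE mulr_gt0 ?invr_gt0 //; have [z vz] := exists_neighbor Gr v.
rewrite (bigD1_seq z) ?fset_uniq ?in_neighbors //= ltr_pwDl //; first by have [] := om vz.
rewrite big_seq_cond sumr_ge0 // => u /andP[]; rewrite in_neighbors => vu _.
by apply: ltW; have [] := om vu.
Qed.

Lemma exit_jump v z : E v z -> exit_rate L v * jump_prob L v z = (theta v)^-1 * omega v z.
Proof.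
by move=> vz; rewrite /jump_prob mulrC divfK ?gt_eqF ?exit_rate_gt0 // jump_rateE.
Qed.

Lemma jump_prob_ge0 v z : E v z -> 0 <= jump_prob L v z.
Proof.
move=> vz; rewrite /jump_prob jump_rateE // divr_ge0 ?(ltW (exit_rate_gt0 _)) //.
by rewrite mulr_ge0 ?invr_ge0 ?(ltW (th0 _)) // ltW; have [] := om vz.
Qed.

Lemma jump_prob_sum v : \sum_(z <- neighbors v) jump_prob L v z = 1.
Proof.
apply: (mulfI (lt0r_neq0 (exit_rate_gt0 v))); rewrite mulr1 mulr_sumr.
rewrite [RHS]exit_rateE mulr_sumr big_seq [RHS]big_seq; apply: eq_bigr => z.
by rewrite in_neighbors => /exit_jump.
Qed.

Variables (P : V -> probability T R) (Y : nat -> T -> V) (S : nat -> T -> R).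
Hypothesis chain : jump_chain_holding_times L P Y S.
Variables (x : V) (K N : nat) (t : R).
Hypotheses (t0 : 0 < t) (NK : (N < K)%N).

Let G := restriction Gr th0 om x K.

(** Since N < K, the vertices reached in at most N jumps are ones at which the killed solution
    satisfies the backward equation of the original walk. The factor theta(y) turns h, a density
    relative to theta, into a probability. *)
Lemma hits_le_killed (y : verts (R := R) E x K) (h : R -> verts (R := R) E x K -> R) x' :
  val x' = x -> winn G y -> killed_solution G h -> (forall z, h 0 z = delta_density G y z) ->
  pr P x (hits Y S (val y) t 0 N.+1) <= theta (val y) * h t x'.
Proof.
move=> xx yK hP h0.
(* The value 0 off the finite graph is a default; the comparison involves W only within distance N+1
   of x, where it is given by h. *)
pose W (s : R) v := if insub v is Some v' then theta (val y) * h s v' else 0.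
have WE s (v : verts (R := R) E x K) : W s (val v) = theta (val y) * h s v by rewrite /W valK.
pose B n v := gball (R := R) E x n v.
have Bv n v : (n <= N.+1)%N -> B n v -> exists2 v' : verts (R := R) E x K, val v' = v & winn G v'.
  move=> nN Bv; have vv : v \in verts (R := R) E x K.
    by apply: in_verts => //; apply: gball_mono Bv; exact: leq_trans nN (leqW NK).
  exists [` vv]%fset => //; apply/asboolP; apply: gball_mono Bv; exact: leq_trans nN NK.
have thy : 0 < theta (val y) by [].
have [lip lip0 hlip] := killed_lipschitz (ltW t0) hP.
pose rates := \sum_(z : verts (R := R) E x K) exit_rate L (val z).
have rates0 : 0 <= rates by apply: sumr_ge0 => z _; exact: ltW (exit_rate_gt0 _).
rewrite -(WE t x') xx.
apply: (hits_le chain (nbr := neighbors) (B := B) (Q := rates) (lip := theta (val y) * lip)) => //.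
- by rewrite mulr_ge0 // ltW.
- exact: gball_center.
- move=> n v z Bn zn; have : z \in neighbors v by []; rewrite in_neighbors; exact: gball_step Bn.
- by move=> v; exact: ltW (exit_rate_gt0 _).
- move=> n v nN Bn; have [v' <- _] := Bv _ _ (leqW nN) Bn.
  by rewrite /rates (bigD1 v') //= lerDl sumr_ge0 // => z _; exact: ltW (exit_rate_gt0 _).
- by move=> v z; rewrite in_neighbors; exact: jump_prob_ge0.
- exact: jump_prob_sum.
- move=> n v s nN Bn; have [v' vv vK] := Bv _ _ (leqW nN) Bn; subst v.
  have -> : W^~ (val v') = fun s => theta (val y) * h s v' by apply/funext => r; rewrite WE.
  have := killed_derive hP s v'; rewrite vK => /(is_derive_scale (theta (val y))).
  move=> d; apply: is_derive_eq d _; rewrite WE.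
  have nb z : E (val v') z -> exists z' : verts (R := R) E x K, val z' = z.
    by move=> vz; have [z' <- _] := Bv n.+1 z nN (gball_step Gr Bn vz); exists z'.
  pose g z := omega (val v') z * (W s z - W s (val v')).
  have -> : theta (val y) * ((wtheta G v')^-1 * \sum_z wc G v' z * (h s z - h s v')) =
      (theta (val v'))^-1 * \sum_(z <- neighbors (val v')) g z.
    rewrite mulrCA; congr (_ * _).
    have -> : \sum_(z <- neighbors (val v')) g z = \sum_(z \in [set z | E (val v') z]) g z.
      by rewrite fsbig_finite //; exact: (neighbors_finite Gr).
    rewrite (@fsum_fintype R V (verts (R := R) E x K) val _ _ val_inj (neighbors_finite Gr _)).
      rewrite mulr_sumr [RHS]big_mkcond /=; apply: eq_bigr => z _.
      rewrite /g !WE /cond; case: asboolP => /= [->|/negP/negPf ->]; ring.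
    by move=> z /= /nb[z' zz] /(_ z').
  rewrite -[in RHS](mulr1 (theta (val y) * h s v')) -(jump_prob_sum (val v')).
  rewrite [X in _ - X]mulr_sumr -sumrB mulr_sumr [RHS]mulr_sumr big_seq [RHS]big_seq.
  apply: eq_bigr => z; rewrite in_neighbors => vz; rewrite /g WE.
  by rewrite mulrA -(exit_jump vz); ring.
- move=> n v nN Bn; have [v' <- vK] := Bv _ _ (leqW nN) Bn.
  rewrite WE h0 /delta_density val_eqE; case: eqP => [_|_]; last by rewrite mul0r mulr0.
  by rewrite mul1r divff // gt_eqF.
- move=> n v s nN Bn s0; have [v' <- vK] := Bv _ _ nN Bn.
  by rewrite WE mulr_ge0 ?(ltW thy) //; exact: (killed_ge0 hP).
- move=> n v a b nN Bn a0 ab bt; have [v' <- vK] := Bv _ _ nN Bn.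
  by rewrite !WE -mulrBr -mulrA ler_wpM2l ?(ltW thy) // hlip.
Qed.

End Generator.
End Transition.

(** As X is [None] from explosion on, being at y at time t means having made finitely many jumps,
    and continuity of the measure along increasing events applies. It is essential that b does not
    depend on K, which grows with N. *)
Lemma heat_kernel_le (R : realType) (V : choiceType) (E : rel V) (Gr : infinite_graph E)
    (theta : V -> R) (omega : V -> V -> R) (th0 : forall x, 0 < theta x) (om : conductances E omega)
    (disp : measure_display) (T : measurableType disp)
    (P : V -> probability T R) (X : R -> T -> option V) (t b : R) (x y : V) :
  markov_chain (generator E omega theta) P X -> 0 < t ->
  (forall K (x' y' : verts (R := R) E x K) (h : R -> verts (R := R) E x K -> R),
    let G := restriction Gr th0 om x K in
    val x' = x -> val y' = y -> winn G y' -> killed_solution G h ->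
    (forall z, h 0 z = delta_density G y' z) -> h t x' <= b) ->
  heat_kernel theta P X t x y <= b.
Proof.
move=> [Y [S [chain hX]]] t0 hb; rewrite /heat_kernel ler_pdivrMr // mulrC.
have -> : [set w | X t w = Some y] = \bigcup_N hits Y S y t 0 N.+1.
  apply/seteqP; split => w /=.
    by move=> /(hX t w y (ltW t0))[n [hn yn]]; exists n => //; exists n => //=; rewrite add0n.
  by move=> [N _ [n _ [yn hn]]]; apply/(hX t w y (ltW t0)); exists n.
apply: pr_bigcup_le => [N|N|N]; first exact: (measurable_hits chain).
  by move=> w [i /andP[_ iN] hi]; exists i => //; rewrite !add0n in iN *; exact: leqW.
have [p [h1 h2]] := graph_connected Gr x y.
(* K exceeds N and is at least the length of a path from x to y, so that y is a surviving vertex and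
   the point mass at y is an admissible initial value. *)
have yK : gball (R := R) E x (N.+1 + size p)%N y.
  by apply/(gballP Gr); exists p; rewrite leq_addl.
set K := (N.+1 + size p)%N in yK.
have yv : y \in verts (R := R) E x K by apply: in_verts => //; exact: gball_mono yK.
have xv : x \in verts (R := R) E x K by apply: in_verts => //; exact: gball_center.
pose G := restriction Gr th0 om x K; pose y' : verts (R := R) E x K := [` yv]%fset.
have wy : winn G y' by apply/asboolP.
have [h [hP h0]] := exists_killed_solution (delta_density_ge0 G y') (delta_density_supported wy).
have NK : (N < K)%N by exact: leq_addr.
apply: le_trans (hits_le_killed chain t0 NK (x' := [` xv]%fset) erefl wy hP h0) _.
by rewrite ler_wpM2l ?(ltW (th0 _)) //; exact: hb wy hP h0.
Qed.

Theorem theorem3p2 (R : realType) (d d' Cdeg Creg CS Cint : R) (p q r : \bar R)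
    (hd : 2 <= d) (hd' : d <= d') (hCdeg : 1 <= Cdeg) (hCreg : 0 < Creg)
    (hCS : 0 < CS) (hCint : 1 <= Cint)
    (hp : (1 < p)%E) (hq : (1 < q)%E) (hr : (1 < r)%E)
    (hpqr : (r^-1 + p^-1 * (1 - r^-1) + q^-1 < (2 / d')%:E)%E) :
  exists c1 c2 c3 c4 c5 gamma : R,
    [/\ 0 < c1, 0 < c2, 0 < c3, 0 < c4 & 0 < c5] /\
    forall (V : choiceType) (E : rel V) (N1 N2 : V -> nat),
      infinite_graph E ->
      bounded_degree E Cdeg ->
      volume_regular E d Creg N1 ->
      local_sobolev E d d' CS N2 ->
    forall (theta : V -> R) (omega : V -> V -> R) (N4 : V -> nat),
      (forall x, 0 < theta x) ->
      conductances E omega ->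
      integrability E omega theta p q r Cint N4 ->
    forall (disp : measure_display) (T : measurableType disp)
      (P : V -> probability T R) (X : R -> T -> option V),
      markov_chain (generator E omega theta) P X ->
    forall (t : R) (x y : V),
      0 < t ->
      (maxn (maxn (N1 x) (N2 x)) (N4 x))%:R <= Num.sqrt t ->
      let D := intrinsic_dist E omega theta x y in
      let prefactor :=
        c2 * t `^ (- (d / 2)) * (1 + graph_dist E x y / Num.sqrt t) `^ gamma in
      (D <= c1 * t ->
        heat_kernel theta P X t x y
          <= prefactor * expR (- (c3 * (D ^+ 2 / t)))) /\
      (c5 * t <= D ->
        heat_kernel theta P X t x y
          <= prefactor * expR (- (c4 * (D * Num.max 1 (ln (D / t)))))).

Proof.
have [c1 [c2 [c3 [c4 [c5 [gamma [c0 H]]]]]]] :=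
  killed_heat_bound hd hd' hCdeg hCreg hCS hCint hp hq hr hpqr.
exists c1, c2, c3, c4, c5, gamma; split=> // V E N1 N2 Gr hdeg hvol hsob theta omega N4 th0 om hint.
move=> disp T P X mc t x y t0 ht D prefactor.
split=> hD; apply: (@heat_kernel_le R V E Gr theta omega th0 om) => // K x' y' h G xx yy wy hP h0;
  have [H1 H2] := H _ _ _ _ _ Gr _ _ th0 om hdeg hvol hsob hint x K t x' y' h t0 ht xx wy hP h0;
  move: H1 H2; rewrite yy => H1 H2; [exact: H1|exact: H2].
Qed.
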